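(* Let $\mathfrak{g}=\bigoplus_{i\in\mathbb{Z}}\mathfrak{g}(i)$ be a $\mathbb{Z}$-graded Lie superalgebra satisfying axioms (i)–(iii) of the context, with $\mathfrak{p},\mathfrak{l},S,T$ and the modules $\widehat{L}_S(\cdot),\widehat{L}_T(\cdot),M_S(\cdot),M_T(\cdot)$ as defined there. Let $\lambda\in\mathfrak{h}_0^*$ with $\dim\widehat{L}_T(\lambda)<\infty$, and let $c=\dim(\mathfrak{g}/\mathfrak{p})_1$. Then $M_T(\lambda)$ has a filtration by $\mathfrak{g}_0$-submodules $$0=M_0\subset M_1\subset\cdots\subset M_k=M_T(\lambda)$$ such that for $i=1,\dots,k$, $M_i/M_{i-1}\cong M_S(\lambda_i)$ for certain $\lambda_i\in P_S^{++}$, and $$\sum_{i=1}^k\dim\widehat{L}_S(\lambda_i)=2^c\dim\widehat{L}_T(\lambda).$$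
   Context: Setting. $\mathfrak{g}=\mathfrak{g}_0\oplus\mathfrak{g}_1$ is a finite dimensional Lie superalgebra over $\mathbb{C}$ such that: (i) $\mathfrak{g}=\bigoplus_{i\in\mathbb{Z}}\mathfrak{g}(i)$ is a graded Lie superalgebra with $\mathfrak{g}_0$ reductive. (ii) $\mathfrak{h}_0\subseteq\mathfrak{g}(0)$, where $\mathfrak{h}_0$ is a Cartan subalgebra of $\mathfrak{g}_0$, and $\mathfrak{g}$ is a semisimple $\mathfrak{h}_0$-module. Put $\mathfrak{m}=\bigoplus_{i<0}\mathfrak{g}(i)$, $\mathfrak{l}=\mathfrak{g}(0)$, $\mathfrak{m}^+=\bigoplus_{i>0}\mathfrak{g}(i)$, $\mathfrak{p}=\mathfrak{l}\oplus\mathfrak{m}^+$. Subscripts $0,1$ on subalgebras or subquotients denote even/odd parts. Let $\mathfrak{h}$ be the centralizer of $\mathfrak{h}_0$ in $\mathfrak{g}$, $\mathfrak{g}^\alpha=\{x:[h,x]=\alpha(h)x\ \forall h\in\mathfrak{h}_0\}$, $\Delta=\{\alpha\in\mathfrak{h}_0^*:\alpha\neq0,\mathfrak{g}^\alpha\ne0\}$. (iii) $\Delta=\Delta^+\cup\Delta^-$ is a disjoint union such that $\alpha,\beta\in\Delta^\pm$ implies $\alpha+\beta\in\Delta^\pm$ or $\mathfrak{g}^{\alpha+\beta}=0$, and $\mathfrak{g}^\alpha\cap\mathfrak{g}_0\subseteq\mathfrak{p}$ for all $\alpha\in\Delta^+$. Let $\Delta(\mathfrak{l})$ be the set of roots of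 $\mathfrak{l}$, $\Delta^\pm(\mathfrak{l})=\Delta^\pm\cap\Delta(\mathfrak{l})$, and $\Delta^+(\mathfrak{l})_0$ the set of $\alpha\in\Delta^+(\mathfrak{l})$ with $\mathfrak{g}^\alpha\cap\mathfrak{g}_0\ne0$. Let $\mathfrak{b}=\mathfrak{h}\oplus\bigoplus_{\alpha\in\Delta^+}\mathfrak{g}^\alpha$ and $\mathfrak{c}=\mathfrak{h}\oplus\bigoplus_{\alpha\in\Delta^+(\mathfrak{l})}\mathfrak{g}^\alpha=\mathfrak{b}\cap\mathfrak{l}$. $S$ (resp. $T$) is the set of indecomposable roots of $\Delta^+(\mathfrak{l})_0$ (resp. $\Delta^+(\mathfrak{l})$), i.e. those that are not a sum of two elements of that set. Modules. For an even root $\alpha$, $h_\alpha\in[\mathfrak{g}_0^\alpha,\mathfrak{g}_0^{-\alpha}]$ is the element with $\alpha(h_\alpha)=2$ and $(\lambda,\alpha^\vee):=\lambda(h_\alpha)$. $P_S^{++}=\{\lambda\in\mathfrak{h}_0^*:(\lambda,\alpha^\vee)\in\mathbb{N}\ \forall\alpha\in S\}$ ($0\in\mathbb{N}$). $\widehat{L}_S(\lambda)$ is the simple highest weight $\mathfrak{l}_0$-module with highest weight $\lambda$ relative to the Borel subalgebra $\mathfrak{c}_0$ of $\mathfrak{l}_0$; it is finite dimensional iff $\lambda\in P_S^{++}$. For $\lambda\in\mathfrak{h}_0^*$ let $V_\lambda$ be the unique graded simple $\mathfrak{c}$-module with $\mathfrak{g}^\alpha V_\lambda=0$ for all $\alpha\in\Delta^+(\mathfrak{l})$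 and $(h-\lambda(h))V_\lambda=0$ for all $h\in\mathfrak{h}_0$; $\widehat{L}_T(\lambda)$ is the unique simple graded quotient of $U(\mathfrak{l})\otimes_{U(\mathfrak{c})}V_\lambda$. Letting $\mathfrak{m}_0^+$ (resp. $\mathfrak{m}^+$) act by zero, set $M_S(\lambda)=U(\mathfrak{g}_0)\otimes_{U(\mathfrak{p}_0)}\widehat{L}_S(\lambda)$ and $M_T(\lambda)=U(\mathfrak{g})\otimes_{U(\mathfrak{p})}\widehat{L}_T(\lambda)$. *)

(* Defs.v *)
From HB Require Import structures.
From mathcomp Require Import all_boot all_order all_algebra.
From mathcomp Require Import generic_quotient ring_quotient finmap.
From mathcomp Require Import complex.
From mathcomp Require Import boolp classical_sets reals.
From mathcomp Require Import monalg.
Set Implicit Arguments.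
Unset Strict Implicit.
Unset Printing Implicit Defensive.
Import GRing.Theory.
Local Open Scope classical_set_scope.
Local Open Scope quotient_scope.
Local Open Scope ring_scope.

Section Span.
Variables (K : fieldType) (V : lmodType K).
Implicit Types W R : set V.

Definition subspace W :=
  W 0 /\ forall a u v, W u -> W v -> W (a *: u + v).

Definition lspan R : set V :=
  [set x | forall W, subspace W -> R `<=` W -> W x].

Lemma subspace_lspan R : subspace (lspan R).
Proof.
split=> [W [] //|a u v Ru Rv W sW RW].
by apply: sW.2; [apply: Ru | apply: Rv].
Qed.

Lemma sub_lspan R : R `<=` lspan R.
Proof. by move=> x Rx W _; apply. Qed.

Definition lspanb R : {pred V} := fun x => `[< lspan R x >].

Lemma lspanbE R x : (x \in lspanb R) = `[< lspan R x >].
Proof. by []. Qed.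

Fact lspanb_closed R : zmod_closed (lspanb R).
Proof.
split=> [|x y]; rewrite !lspanbE; first by apply/asboolP; case: (subspace_lspan R).
move=> /asboolP Rx /asboolP Ry; apply/asboolP.
rewrite addrC -scaleN1r; exact: (subspace_lspan R).2.
Qed.

HB.instance Definition _ R := GRing.isZmodClosed.Build V (lspanb R)
  (lspanb_closed R).

Definition quotl R : Type := Quotient.quot (lspanb R).

HB.instance Definition _ R := GRing.Zmodule.on (quotl R).

(* The locks here and below only keep unification from unfolding. *)
Fact pil_key : unit. Proof. exact: tt. Qed.
Definition pil R : V -> quotl R :=
  locked_with pil_key (fun x => \pi_(Quotient.quot (lspanb R)) x).

Lemma pilE R x : pil R x = \pi_(Quotient.quot (lspanb R)) x.
Proof. by rewrite /pil locked_withE. Qed.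

Fact scaleq_key : unit. Proof. exact: tt. Qed.
Definition scaleq R : K -> quotl R -> quotl R :=
  locked_with scaleq_key
    (fun a x => pil R (a *: repr (x : Quotient.quot (lspanb R)))).

Lemma pil_eq R x y : (pil R x = pil R y) <-> lspan R (x - y).
Proof.
rewrite !pilE; split.
  by move/eqP; rewrite -Quotient.idealrBE lspanbE => /asboolP.
by move=> h; apply/eqP; rewrite -Quotient.idealrBE lspanbE; apply/asboolP.
Qed.

Lemma pil_surj R (x : quotl R) : exists y, x = pil R y.
Proof. by exists (repr (x : Quotient.quot (lspanb R))); rewrite pilE reprK. Qed.

Lemma pilD R : {morph pil R : x y / x + y}.
Proof. by move=> x y; rewrite !pilE !piE. Qed.

Lemma pil0 R : pil R 0 = 0.
Proof. by rewrite !pilE !piE. Qed.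

Lemma scaleqE R a x : scaleq a (pil R x) = pil R (a *: x).
Proof.
rewrite /scaleq locked_withE; apply/pil_eq; rewrite -scalerBr -[_ *: _]addr0.
apply: (subspace_lspan R).2; last exact: (subspace_lspan R).1.
by apply/pil_eq; rewrite pilE reprK.
Qed.

Fact scaleqA R a b (x : quotl R) : scaleq a (scaleq b x) = scaleq (a * b) x.
Proof. by have [y ->] := pil_surj x; rewrite !scaleqE scalerA. Qed.
Fact scale1q R : left_id 1 (@scaleq R).
Proof. by move=> x; have [y ->] := pil_surj x; rewrite scaleqE scale1r. Qed.
Fact scaleqDr R : right_distributive (@scaleq R) +%R.
Proof.
move=> a x y; have [x' ->] := pil_surj x; have [y' ->] := pil_surj y.
by rewrite -pilD !scaleqE scalerDr pilD.
Qed.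
Fact scaleqDl R (x : quotl R) : {morph (@scaleq R)^~ x : a b / a + b}.
Proof.
by move=> a b; have [y ->] := pil_surj x; rewrite !scaleqE scalerDl pilD.
Qed.

HB.instance Definition _ R := GRing.Zmodule_isLmodule.Build K (quotl R)
  (@scaleqA R) (@scale1q R) (@scaleqDr R) (@scaleqDl R).

Lemma pil_linear R : linear (pil R).
Proof. by move=> a x y; rewrite pilD -scaleqE. Qed.

Definition has_dim (d : nat) :=
  exists e : 'I_d -> V, bijective (fun c : 'rV[K]_d => \sum_i c 0 i *: e i).

End Span.

Section VSpan.
Variables (K : fieldType) (V : vectType K).
Implicit Types (A : set V) (U W : {vspace V}).

Lemma span_seq A :
  exists s : seq V, (forall x, x \in s -> A x) /\ A `<=` [set` <<s>>%VS].
Proof.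
pose P n := `[< exists s : seq V, (forall x, x \in s -> A x) /\ \dim <<s>>%VS = n >].
have exP : exists n, P n.
  by exists (\dim <<[::] : seq V>>%VS); apply/asboolP; exists [::].
have ubP n : P n -> (n <= \dim (fullv : {vspace V}))%N.
  by move=> /asboolP[s [_ <-]]; apply/dimvS/subvf.
case: (ex_maxnP exP ubP) => n /asboolP[s [sA dims]] maxn.
exists s; split=> // x Ax /=.
have /maxn : P (\dim <<x :: s>>%VS).
  apply/asboolP; exists (x :: s); split=> // y.
  by rewrite inE => /orP[/eqP->//|/sA].
rewrite -dims => le; have sub : (<<s>> <= <<x :: s>>)%VS.
  by rewrite span_cons addvSr.
have /eqP -> : <<s>>%VS == <<x :: s>>%VS by rewrite eqEdim sub.
by rewrite memv_span ?mem_head.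
Qed.

(* The subspace spanned by an arbitrary subset of V; vspanP characterizes it. *)
Definition vspan A : {vspace V} :=
  xget 0%VS [set U : {vspace V} |
    A `<=` [set` U] /\ forall W : {vspace V}, A `<=` [set` W] -> (U <= W)%VS].

Lemma vspanP A :
  A `<=` [set` vspan A] /\ forall W, A `<=` [set` W] -> (vspan A <= W)%VS.
Proof.
rewrite /vspan; case: xgetP => [U _ //|noU]; exfalso.
have [s [sA As]] := span_seq A; apply: (noU <<s>>%VS); split=> // W AW.
by apply/span_subvP => x /sA /AW.
Qed.

Lemma mem_vspan A x : subspace A -> x \in vspan A <-> A x.
Proof.
case=> A0 AS; have [AU Umin] := vspanP A; split=> [xU|/AU //].
have [s [sA As]] := span_seq A.
rewrite (coord_span (X := in_tuple s) (subvP (Umin _ As) _ xU)).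
apply: (big_ind A) => // [u v Au Av|i _]; first by rewrite -[u]scale1r; apply: AS.
by rewrite -[_ *: _]addr0; apply: AS => //; apply/sA/mem_nth.
Qed.

End VSpan.

(* The data of a Lie superalgebra; part false and part true are the even and
   the odd part. *)
Record superalg (K : fieldType) := Superalg {
  superalg_sort :> vectType K;
  part : bool -> {vspace superalg_sort};
  br : superalg_sort -> superalg_sort -> superalg_sort }.

Section Superalgebras.
Variable K : fieldType.

Definition bilinear_op (U V W : lmodType K) (f : U -> V -> W) :=
  (forall y, linear (f^~ y)) /\ (forall x, linear (f x)).

Definition lie_superalgebra (A : superalg K) :=
  [/\ bilinear_op (@br K A),
      (part A false + part A true)%VS = fullv /\
        (part A false :&: part A true)%VS = 0%VS,
      forall a b x y, x \in part A a -> y \in part A b ->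
        br x y \in part A (a (+) b),
      forall a b (x y : A), x \in part A a -> y \in part A b ->
        br x y = - ((-1) ^+ (a && b) *: br y x)
    & forall a b (x y z : A), x \in part A a -> y \in part A b ->
        br x (br y z) = br (br x y) z + (-1) ^+ (a && b) *: br y (br x z)].

(* The subspace P with the induced structure. The projection vsproj has no
   effect when P is closed under the bracket. *)
Definition sub (A : superalg K) (P : {vspace A}) : superalg K :=
  Superalg (fun a => (linfun (vsval : subvs_of P -> A) @^-1: part A a)%VS)
           (fun x y : subvs_of P => vsproj P (br (vsval x) (vsval y))).

Definition incl (A : superalg K) (P Q : {vspace A}) (x : sub P) : sub Q :=
  vsproj Q (vsval x).

Definition is_module (A : superalg K) (V : lmodType K) (act : A -> V -> V) :=
  bilinear_op act /\
  forall a b (x y : A) (v : V), x \in part A a -> y \in part A b ->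
    act (br x y) v = act x (act y v) - (-1) ^+ (a && b) *: act y (act x v).

Definition submodule (A : superalg K) (V : lmodType K) (act : A -> V -> V)
    (W : set V) :=
  subspace W /\ forall x w, W w -> W (act x w).

Definition simple_module (A : superalg K) (V : lmodType K)
    (act : A -> V -> V) :=
  [/\ is_module act, exists v : V, v != 0
    & forall W, submodule act W -> W = [set 0] \/ W = setT].

Definition module_grading (A : superalg K) (V : lmodType K)
    (act : A -> V -> V) (Vp : bool -> set V) :=
  [/\ forall a, subspace (Vp a),
      forall v, exists v0 v1, [/\ Vp false v0, Vp true v1 & v = v0 + v1],
      Vp false `&` Vp true = [set 0]
    & forall a b x v, x \in part A a -> Vp b v -> Vp (a (+) b) (act x v)].

Definition graded_subset (V : lmodType K) (Vp : bool -> set V) (W : set V) :=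
  forall w, W w -> exists w0 w1,
    [/\ W w0 /\ Vp false w0, W w1 /\ Vp true w1 & w = w0 + w1].

Definition graded_simple (A : superalg K) (V : lmodType K)
    (act : A -> V -> V) (Vp : bool -> set V) :=
  [/\ is_module act, module_grading act Vp, exists v : V, v != 0
    & forall W, submodule act W -> graded_subset Vp W ->
        W = [set 0] \/ W = setT].

End Superalgebras.

Section QuotientAlgebra.
Variables (K : fieldType) (F : algType K) (R : set F).

Definition ideal_gens : set F := [set f | exists u r v, R r /\ f = u * r * v].

Definition quota : Type := quotl ideal_gens.

HB.instance Definition _ := GRing.Lmodule.on quota.

Definition pia (x : F) : quota := pil ideal_gens x.

Definition repra (u : quota) : F :=
  repr (u : Quotient.quot (lspanb ideal_gens)).

Lemma pia_eq x y : (pia x = pia y) <-> lspan ideal_gens (x - y).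
Proof. exact: pil_eq. Qed.

Lemma repraK : cancel repra pia.
Proof. by move=> u; rewrite /pia pilE reprK. Qed.

Lemma pia_surj u : exists x, u = pia x.
Proof. by exists (repra u); rewrite repraK. Qed.

Lemma piaD : {morph pia : x y / x + y}.
Proof. exact: pilD. Qed.

Lemma piaZ a x : a *: pia x = pia (a *: x).
Proof. exact: scaleqE. Qed.

Lemma lspan_idealMl u x : lspan ideal_gens x -> lspan ideal_gens (u * x).
Proof.
move=> h; apply: (h [set x | lspan ideal_gens (u * x)]).
  split=> [|a y z]; rewrite /= ?mulr0; first exact: (subspace_lspan _).1.
  by rewrite mulrDr -scalerAr; apply: (subspace_lspan _).2.
move=> _ [v [r [w [hr ->]]]] /=; apply: sub_lspan.
by exists (u * v), r, w; rewrite !mulrA.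
Qed.

Lemma lspan_idealMr u x : lspan ideal_gens x -> lspan ideal_gens (x * u).
Proof.
move=> h; apply: (h [set x | lspan ideal_gens (x * u)]).
  split=> [|a y z]; rewrite /= ?mul0r; first exact: (subspace_lspan _).1.
  by rewrite mulrDl -scalerAl; apply: (subspace_lspan _).2.
move=> _ [v [r [w [hr ->]]]] /=; apply: sub_lspan.
by exists v, r, (w * u); rewrite !mulrA.
Qed.

Definition onea : quota := pia 1.

Fact mula_key : unit. Proof. exact: tt. Qed.
Definition mula : quota -> quota -> quota :=
  locked_with mula_key (fun u v => pia (repra u * repra v)).

Lemma mulaE x y : mula (pia x) (pia y) = pia (x * y).
Proof.
rewrite /mula locked_withE; apply/pia_eq; set x' := repra _; set y' := repra _.
have hx : lspan ideal_gens (x' - x) by apply/pia_eq; rewrite repraK.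
have hy : lspan ideal_gens (y' - y) by apply/pia_eq; rewrite repraK.
have -> : x' * y' - x * y = 1 *: ((x' - x) * y') + x * (y' - y).
  by rewrite scale1r mulrBl mulrBr addrA subrK.
by apply: (subspace_lspan _).2; [apply: lspan_idealMr | apply: lspan_idealMl].
Qed.

Fact mulaA : associative mula.
Proof.
move=> u v w; have [x ->] := pia_surj u; have [y ->] := pia_surj v.
by have [z ->] := pia_surj w; rewrite !mulaE mulrA.
Qed.
Fact mul1a : left_id onea mula.
Proof. by move=> u; have [x ->] := pia_surj u; rewrite mulaE mul1r. Qed.
Fact mula1 : right_id onea mula.
Proof. by move=> u; have [x ->] := pia_surj u; rewrite mulaE mulr1. Qed.
Fact mulaDl : left_distributive mula +%R.
Proof.
move=> u v w; have [x ->] := pia_surj u; have [y ->] := pia_surj v.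
by have [z ->] := pia_surj w; rewrite -piaD !mulaE mulrDl piaD.
Qed.
Fact mulaDr : right_distributive mula +%R.
Proof.
move=> u v w; have [x ->] := pia_surj u; have [y ->] := pia_surj v.
by have [z ->] := pia_surj w; rewrite -piaD !mulaE mulrDr piaD.
Qed.

HB.instance Definition _ := GRing.Zmodule_isPzRing.Build quota
  mulaA mul1a mula1 mulaDl mulaDr.

Fact scalea_Al (a : K) (u v : quota) : a *: (u * v) = a *: u * v.
Proof.
have [x ->] := pia_surj u; have [y ->] := pia_surj v.
by rewrite /GRing.mul /= mulaE !piaZ mulaE scalerAl.
Qed.
Fact scalea_Ar (a : K) (u v : quota) : a *: (u * v) = u * (a *: v).
Proof.
have [x ->] := pia_surj u; have [y ->] := pia_surj v.
by rewrite /GRing.mul /= mulaE !piaZ mulaE scalerAr.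
Qed.

End QuotientAlgebra.

(* The free associative algebra on the set I. *)
Section FreeAlgebra.
Variables (K : fieldType) (I : choiceType).

Definition freealg : Type := {malg K[{fmonom I}]}.

HB.instance Definition _ := GRing.Lalgebra.on freealg.

Fact freealg_scaleAr (a : K) (x y : freealg) : a *: (x * y) = x * (a *: y).
Proof.
have malg_scaleAr (u v : {malg K[{fmonom I}]}) : a *: (u * v) = u * (a *: v).
  have cen : u * a%:MP = a%:MP * u.
    rewrite {1}/GRing.mul {1}/GRing.mul /= fgmulUg fgmulgU.
    by apply: eq_bigr => k _; rewrite mulrC mul1m mulm1.
  transitivity (a%:MP * u * v); first by rewrite -mulrA; exact/esym/mul_malgC.
  by rewrite -cen -mulrA; congr (_ * _); exact: mul_malgC.
exact: malg_scaleAr.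
Qed.

HB.instance Definition _ := GRing.Lalgebra_isAlgebra.Build K freealg
  freealg_scaleAr.

(* The augmentation, i.e. the constant coefficient. *)
Definition augm (f : freealg) : K := mcoeff (@mone {fmonom I}) (f : {malg K[{fmonom I}]}).

Lemma augmZD a f g : augm (a *: f + g) = a * augm f + augm g.
Proof. by rewrite /augm mcoeffD mcoeffZ. Qed.

Lemma augmM f g : augm (f * g) = augm f * augm g.
Proof. exact: (rmorphM (mcoeff (@mone {fmonom I}) : {malg K[{fmonom I}]} -> K)). Qed.

Lemma augm0 : augm 0 = 0. Proof. exact: mcoeff0. Qed.

Lemma augmZ a f : augm (a *: f) = a * augm f.
Proof. by rewrite -[a *: f]addr0 augmZD augm0 addr0. Qed.

Lemma augm1 : augm 1 = 1. Proof. by rewrite /augm mcoeffC eqxx. Qed.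

Lemma augmB f g : augm (f - g) = augm f - augm g.
Proof. by rewrite -scaleN1r addrC augmZD mulN1r addrC. Qed.

Lemma augm_comb0 a p q r : augm p = 0 -> augm q = 0 -> augm r = 0 ->
  augm (p - a *: q - r) = 0.
Proof. by move=> p0 q0 r0; rewrite !augmB augmZ p0 q0 r0 mulr0 !subr0. Qed.

End FreeAlgebra.

Section Enveloping.
Variables (K : fieldType) (A : superalg K).

Local Notation freealg := (freealg K A).

Fact gen_key : unit. Proof. exact: tt. Qed.
Definition gen : A -> freealg :=
  locked_with gen_key (fun x => mkmalgU (fmu x) 1).

Lemma genE x : gen x = mkmalgU (fmu x) 1.
Proof. by rewrite /gen locked_withE. Qed.

Definition env_rel : set freealg :=
  [set f | (exists a x y, f = gen (a *: x + y) - (a *: gen x + gen y)) \/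
           (exists a b x y, [/\ x \in part A a, y \in part A b
              & f = gen x * gen y - (-1) ^+ (a && b) *: (gen y * gen x)
                    - gen (br x y)])].

Definition env : Type := quota env_rel.

HB.instance Definition _ := GRing.PzRing.on env.
HB.instance Definition _ := GRing.Lmodule.on env.

Lemma augm_gen x : augm (gen x) = 0.
Proof. by rewrite genE /augm mcoeffU -val_eqE /= fm1 fmuE. Qed.

Fact env_oner_neq0 : (1 : env) != 0.
Proof.
apply/eqP => e1; have /pia_eq : pia env_rel 1 = pia env_rel 0 by rewrite /pia pil0.
rewrite subr0 => /(_ [set f : freealg | augm f = 0]) H.
suff /eqP : augm (1 : freealg) = 0 by rewrite augm1 oner_eq0.
apply: H; first split=> [|a f g] /=; first exact: augm0.
  by rewrite augmZD => -> ->; rewrite mulr0 addr0.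
move=> _ [u [r [v [hr ->]]]] /=.
suff r0 : augm r = 0 by rewrite !augmM r0 mulr0 mul0r.
case: hr => [[a [x [y ->]]]|[a [b [x [y [_ _ ->]]]]]].
  by rewrite augmB augmZD !augm_gen mulr0 addr0 subr0.
have gg z w : augm (gen z * gen w) = 0 by rewrite augmM augm_gen mul0r.
exact: augm_comb0 (gg _ _) (gg _ _) (augm_gen _).
Qed.

HB.instance Definition _ := GRing.PzSemiRing_isNonZero.Build env env_oner_neq0.
HB.instance Definition _ :=
  GRing.Lmodule_isLalgebra.Build K env (@scalea_Al K freealg env_rel).
HB.instance Definition _ :=
  GRing.Lalgebra_isAlgebra.Build K env (@scalea_Ar K freealg env_rel).

Definition env_inj (x : A) : env := pia env_rel (gen x).

(* The Z/2-grading of U(A). *)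
Definition env_part (a : bool) : set env :=
  lspan [set u | exists s : seq (bool * A),
    [/\ forall p, p \in s -> p.2 \in part A p.1,
        \big[addb/false]_(p <- s) p.1 = a
      & u = \prod_(p <- s) env_inj p.2]].

Lemma env_inj_linear : linear env_inj.
Proof.
move=> a x y; rewrite /env_inj piaZ -piaD; apply/pia_eq; apply: sub_lspan.
exists 1, (gen (a *: x + y) - (a *: gen x + gen y)), 1.
by rewrite mul1r mulr1; split=> //; left; exists a, x, y.
Qed.

Lemma env_inj_br a b x y : x \in part A a -> y \in part A b ->
  env_inj (br x y) =
    env_inj x * env_inj y - (-1) ^+ (a && b) *: (env_inj y * env_inj x).
Proof.
move=> xa yb; have env_injM u v :
  env_inj u * env_inj v = pia env_rel (gen u * gen v) by exact: mulaE.
rewrite !env_injM -scaleNr piaZ -piaD scaleNr; apply/esym/pia_eq; apply: sub_lspan.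
exists 1, (gen x * gen y - (-1) ^+ (a && b) *: (gen y * gen x) - gen (br x y)), 1.
by rewrite mul1r mulr1; split=> //; right; exists a, b, x, y.
Qed.

End Enveloping.

Section LinearExtension.
Variables (K : fieldType) (I : choiceType) (V : lmodType K) (h : I -> V).

Definition lext (f : {malg K[I]}) : V := \sum_(k <- msupp f) f@_k *: h k.

Lemma lextEw (d : {fset I}) f : (msupp f `<=` d)%fset ->
  lext f = \sum_(k <- d) f@_k *: h k.
Proof.
move=> le; rewrite [LHS](big_fset_incl _ le) => //= x xd /mcoeff_outdom ->.
by rewrite scale0r.
Qed.

Lemma lext_linear : linear lext.
Proof.
move=> a f g; set d := (msupp f `|` msupp g)%fset.
rewrite (lextEw (d := d)); last first.
  by apply: fsubset_trans (msuppD_le _ _) _; apply: fsetUSS => //; exact: msuppZ_le.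
rewrite (lextEw (fsubsetUl _ (msupp g))) (lextEw (fsubsetUr (msupp f) _)).
rewrite scaler_sumr -big_split; apply: eq_bigr => k _ /=.
by rewrite mcoeffD mcoeffZ scalerDl scalerA.
Qed.

Lemma lextU k : lext (mkmalgU k 1) = h k.
Proof. by rewrite (lextEw msuppU_le) big_seq_fset1 mcoeffUU scale1r. Qed.

End LinearExtension.

Lemma malg_span (K : fieldType) (I : choiceType) (W : set {malg K[I]}) f :
  subspace W -> (forall k, W (mkmalgU k 1)) -> W f.
Proof.
move=> [W0 WS] W1; rewrite [f]monalgE; elim/big_rec: _ => // k p _ Wp.
have -> : mkmalgU k f@_k = f@_k *: mkmalgU k 1 :> {malg K[I]}.
  by apply/malgP => j; rewrite mcoeffZ !mcoeffU mulrnAr mulr1.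
exact: WS.
Qed.

Section Induction.
Variables (K : fieldType) (B A : superalg K) (phi : B -> A).
Variables (N : lmodType K) (act : B -> N -> N).

(* U(A) (x)_{U(B)} N, where U(B) acts on U(A) through phi: the vector space on
   the set U(A) * N, modulo bilinearity and u phi(b) (x) n = u (x) b n. The
   latter need only be imposed for b in B, as B generates U(B). *)
Definition freetens : lmodType K := {malg K[(env A * N)%type]}.

Fact tens_key : unit. Proof. exact: tt. Qed.
Definition tens : env A -> N -> freetens :=
  locked_with tens_key (fun u n => mkmalgU (u, n) 1).

Lemma tensE u n : tens u n = mkmalgU (u, n) 1.
Proof. by rewrite /tens locked_withE. Qed.

Definition ind_rel : set freetens :=
  [set f | [\/ exists a u v n,
                 f = tens (a *: u + v) n - (a *: tens u n + tens v n),
               exists a u n m,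
                 f = tens u (a *: n + m) - (a *: tens u n + tens u m)
             | exists u b n,
                 f = tens (u * env_inj (phi b)) n - tens u (act b n)]].

Definition ind : lmodType K := quotl ind_rel.

Definition indt (u : env A) (n : N) : ind := pil ind_rel (tens u n).

(* u . (v (x) n) = (u v) (x) n, see ind_mulE *)
Fact ind_mul_key : unit. Proof. exact: tt. Qed.
Definition ind_mul : env A -> ind -> ind :=
  locked_with ind_mul_key (fun u m =>
    lext (fun p : env A * N => indt (u * p.1) p.2)
         (repr (m : Quotient.quot (lspanb ind_rel)))).

Definition ind_act (x : A) (m : ind) : ind := ind_mul (env_inj x) m.

Definition ind_part (Np : bool -> set N) (a : bool) : set ind :=
  lspan [set m | exists b u n, [/\ env_part b u, Np (b (+) a) n & m = indt u n]].

Lemma indt_linearl n : linear (indt^~ n).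
Proof.
move=> a u v; rewrite /indt -pil_linear; apply/pil_eq; apply: sub_lspan.
by apply: Or31; exists a, u, v, n.
Qed.

Lemma indt_linearr u : linear (indt u).
Proof.
move=> a n m; rewrite /indt -pil_linear; apply/pil_eq; apply: sub_lspan.
by apply: Or32; exists a, u, n, m.
Qed.

Lemma indt_balanced u b n : indt (u * env_inj (phi b)) n = indt u (act b n).
Proof. by apply/pil_eq; apply: sub_lspan; apply: Or33; exists u, b, n. Qed.

Lemma linearB_fun (V W : lmodType K) (l : V -> W) : linear l ->
  (l 0 = 0) * (forall x y, l (x - y) = l x - l y).
Proof.
move=> lE; split; first by have := lE (-1) 0 0; rewrite !scaleN1r !addNr.
by move=> x y; have := lE (-1) y x; rewrite !scaleN1r ![- _ + _]addrC.
Qed.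

Lemma ind_rel_vanish u (l : freetens -> ind) : linear l ->
  (forall v n, l (tens v n) = indt (u * v) n) ->
  forall f, lspan ind_rel f -> l f = 0.
Proof.
move=> lE lt f /(_ [set f | l f = 0]); apply; first split=> /=.
- exact: (linearB_fun lE).1.
- by move=> a x y lx ly; rewrite lE lx ly scaler0 addr0.
have lB x y : l x = l y -> l (x - y) = 0.
  by move=> e; rewrite (linearB_fun lE).2 e subrr.
move=> p [[a [v [w [n ->]]]]|[a [v [n [m ->]]]]|[v [b [n ->]]]]; apply: lB.
- rewrite lE !lt -indt_linearl; congr indt.
  by rewrite mulrDr -scalerAr.
- by rewrite lE !lt -indt_linearr.
- by rewrite !lt mulrA indt_balanced.
Qed.

Lemma ind_mul_pil u f : ind_mul u (pil ind_rel f) =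
  lext (fun p : env A * N => indt (u * p.1) p.2) f.
Proof.
rewrite /ind_mul locked_withE; set f' := repr _; set h := fun p => _.
apply/eqP; rewrite -subr_eq0 -(linearB_fun (lext_linear h)).2; apply/eqP.
apply: (@ind_rel_vanish u (lext h)); first exact: lext_linear.
  by move=> v n; rewrite tensE; exact: lextU.
by apply/pil_eq; rewrite pilE reprK.
Qed.

Lemma ind_mulE u v n : ind_mul u (indt v n) = indt (u * v) n.
Proof. by rewrite /indt ind_mul_pil tensE lextU. Qed.

Lemma ind_mul_linear u : linear (ind_mul u).
Proof.
move=> a m m'; have [f ->] := pil_surj m; have [f' ->] := pil_surj m'.
by rewrite -pil_linear !ind_mul_pil; exact: lext_linear.
Qed.

Lemma ind_span (W : set ind) : subspace W -> (forall u n, W (indt u n)) ->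
  W = setT.
Proof.
move=> [W0 WS] Wt; apply/seteqP; split=> // m _; have [f ->] := pil_surj m.
apply: (malg_span (W := [set f | W (pil ind_rel f)])).
- by split=> /= [|a p q]; rewrite ?pil0 // pil_linear; exact: WS.
- by move=> [u n] /=; rewrite -tensE; exact: Wt.
Qed.

Lemma ind_ext (f g : ind -> ind) : linear f -> linear g ->
  (forall u n, f (indt u n) = g (indt u n)) -> f =1 g.
Proof.
move=> lf lg e m; have l0 (h : ind -> ind) : linear h -> h 0 = 0.
  by move=> lh; have := lh (-1) 0 0; rewrite !scaleN1r !addNr.
suff: [set m | f m = g m] = setT by move=> W; have : setT m by []; rewrite -W.
apply: ind_span => //; split=> /= [|a u v fu fv]; first by rewrite !l0.
by rewrite lf lg fu fv.
Qed.

Lemma indt_scale a u n : indt (a *: u) n = a *: indt u n.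
Proof.
have i0 : indt 0 n = 0.
  by have := indt_linearl n (-1) 0 0; rewrite !scaleN1r !addNr.
by have := indt_linearl n a u 0; rewrite !i0 !addr0.
Qed.

Lemma ind_act_is_module : is_module ind_act.
Proof.
split; first (split=> [m|x]; last exact: ind_mul_linear).
  move=> a x y; apply: (ind_ext (f := fun m => ind_act (a *: x + y) m)
    (g := fun m => a *: ind_act x m + ind_act y m)) => [|b u v|u n].
- exact: ind_mul_linear.
- rewrite /ind_act !ind_mul_linear !scalerDr addrACA !scalerA.
  by rewrite [a * b]mulrC.
- by rewrite /ind_act !ind_mulE env_inj_linear mulrDl -scalerAl indt_linearl.
move=> a b x y m xa yb.
apply: (ind_ext (f := fun m => ind_act (br x y) m)
  (g := fun m => ind_act x (ind_act y m)
                 - (-1) ^+ (a && b) *: ind_act y (ind_act x m))) => [|c u v|u n].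
- exact: ind_mul_linear.
- rewrite /ind_act !ind_mul_linear scalerDr opprD addrACA !scalerA.
  by rewrite mulrC -scalerA -scalerBr.
- rewrite /ind_act !ind_mulE (env_inj_br xa yb) mulrBl -scalerAl.
  by rewrite (linearB_fun (indt_linearl n)).2 indt_scale !mulrA.
Qed.

End Induction.

Section Structure.
Variables (K : fieldType) (A : superalg K).
Implicit Types U W : {vspace A}.

(* [U, W] *)
Definition brs U W : {vspace A} :=
  vspan [set z | exists x y, [/\ x \in U, y \in W & z = br x y]].

(* Every ideal of the subalgebra U has a complementary ideal. *)
Definition reductive U :=
  forall I, (I <= U)%VS -> (brs U I <= I)%VS ->
    exists J, [/\ (J <= U)%VS, (brs U J <= J)%VS, (I + J)%VS = U
                & (I :&: J)%VS = 0%VS].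

Definition nilpotent U := exists n, iter n (brs U) U = 0%VS.

Definition self_normalizing U W :=
  forall x, x \in W -> (forall y, y \in U -> br x y \in U) -> x \in U.

(* U is a Cartan subalgebra of the subalgebra W. *)
Definition cartan U W :=
  [/\ (U <= W)%VS, (brs U U <= U)%VS, nilpotent U & self_normalizing U W].

(* A is a semisimple U-module under the adjoint action. *)
Definition ad_semisimple U :=
  forall W, (brs U W <= W)%VS ->
    exists W', [/\ (brs U W' <= W')%VS, (W + W')%VS = fullv
                 & (W :&: W')%VS = 0%VS].

Definition Z_grading (gr : int -> {vspace A}) :=
  [/\ forall i, gr i = (gr i :&: part A false + gr i :&: part A true)%VS,
      forall i j, (brs (gr i) (gr j) <= gr (i + j)%R)%VS,
      vspan (\bigcup_i [set` gr i]) = fullv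
    & forall (s : seq int) (x : int -> A), uniq s ->
        (forall i, x i \in gr i) -> \sum_(i <- s) x i = 0 ->
        forall i, i \in s -> x i = 0].

End Structure.

Section Setting.
Variables (K : fieldType) (g : superalg K) (gr : int -> {vspace g}).
Variable h0 : {vspace g}.

Local Notation g0 := (part g false).
Local Notation g1 := (part g true).

Definition weight : lmodType K := 'Hom(subvs_of h0, K^o).

(* lam x, for x in h0 *)
Definition wt (lam : weight) (x : g) : K :=
  (lam : 'Hom(subvs_of h0, K^o)) (vsproj h0 x).

(* g^al *)
Definition rspace (al : weight) : {vspace g} :=
  vspan [set x | forall h, h \in h0 -> br h x = wt al h *: x].

Definition centralizer : {vspace g} :=
  vspan [set x | forall h, h \in h0 -> br h x = 0].

Definition roots : set weight :=
  [set al | al != 0 /\ rspace al != 0%VS].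

Definition levi : {vspace g} := gr 0.
Definition mplus : {vspace g} := vspan (\bigcup_(i in [set i | 0 < i]) [set` gr i]).
Definition parab : {vspace g} := (levi + mplus)%VS.

Definition closed_roots (P : set weight) :=
  forall al be, P al -> P be -> P (al + be) \/ rspace (al + be) = 0%VS.

Definition graded_reductive :=
  [/\ lie_superalgebra g, Z_grading gr & reductive g0].

Definition semisimple_cartan :=
  [/\ (h0 <= gr 0)%VS, cartan h0 g0 & ad_semisimple h0].

Definition positive_system (Dp Dm : set weight) :=
  [/\ roots = Dp `|` Dm, Dp `&` Dm = set0, closed_roots Dp, closed_roots Dm
    & forall al, Dp al -> (rspace al :&: g0 <= parab)%VS].

Variable Dp : set weight.

(* Delta^+(l) *)
Definition pos_levi : set weight :=
  Dp `&` [set al | al != 0 /\ (rspace al :&: levi)%VS != 0%VS].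

(* Delta^+(l)_0. A root of l is counted as even according to the even part of
   its root space in l; that is all of the even part of g^al if g^al lies in l. *)
Definition pos_levi0 : set weight :=
  pos_levi `&` [set al | (rspace al :&: levi :&: g0)%VS != 0%VS].

Definition indecomposable (P : set weight) : set weight :=
  [set al | P al /\ ~ exists be ga, [/\ P be, P ga & al = be + ga]].

Definition simple_even : set weight := indecomposable pos_levi0.

Definition coroot (al : weight) : g :=
  xget 0 [set h | h \in brs (rspace al :&: g0) (rspace (- al) :&: g0)
                  /\ wt al h = 2].

(* P_S^{++} *)
Definition dominant (lam : weight) :=
  forall al, simple_even al -> exists n : nat, wt lam (coroot al) = n%:R.

Definition borel : {vspace g} :=
  (centralizer + vspan (\bigcup_(al in Dp) [set` rspace al]))%VS.

(* c, as the intersection of b and l *)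
Definition borel_levi : {vspace g} := (borel :&: levi)%VS.

Definition levi0 : {vspace g} := (levi :&: g0)%VS.
Definition mplus0 : {vspace g} := (mplus :&: g0)%VS.
Definition parab0 : {vspace g} := (parab :&: g0)%VS.

(* h0 acts on V through lam, and the positive root vectors of l in Q by 0. *)
Definition highest_weight_vector (Q : {vspace g}) (V : lmodType K)
    (act : sub Q -> V -> V) (lam : weight) (v : V) :=
  (forall x : sub Q, vsval x \in h0 -> act x v = wt lam (vsval x) *: v) /\
  (forall al (x : sub Q), pos_levi al -> vsval x \in rspace al -> act x v = 0).

(* V is (isomorphic to) the graded simple c-module V_lam. *)
Definition is_V (lam : weight) (V : lmodType K) (Vp : bool -> set V)
    (act : sub borel_levi -> V -> V) :=
  graded_simple act Vp /\ forall v, highest_weight_vector act lam v.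

Definition MV (V : lmodType K) (act : sub borel_levi -> V -> V) : lmodType K :=
  ind (@incl _ g borel_levi levi) act.

(* L is the simple graded quotient of U(l) (x)_{U(c)} V_lam. *)
Definition is_LT (lam : weight) (L : lmodType K) (act : sub levi -> L -> L) :=
  exists (V : lmodType K) (Vp : bool -> set V) (actV : sub borel_levi -> V -> V)
      (Lp : bool -> set L) (f : MV actV -> L),
    [/\ is_V lam Vp actV, graded_simple act Lp,
        linear f /\ (forall y, exists m, f m = y),
        forall x m, f (ind_act x m) = act x (f m)
      & forall a, ind_part Vp a `<=` f @^-1` Lp a].

(* L is the simple l_0-module with highest weight lam relative to c_0. *)
Definition is_LS (lam : weight) (L : lmodType K) (act : sub levi0 -> L -> L) :=
  simple_module act /\ exists v, v != 0 /\ highest_weight_vector act lam v.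

(* An L-module as a module over P = L (+) M, with M acting by 0: here
   daddv_pi L M is the projection onto L along M. *)
Definition inflate (L M P : {vspace g}) (V : lmodType K) (act : sub L -> V -> V)
    (x : sub P) (v : V) : V :=
  act (vsproj L (daddv_pi L M (vsval x))) v.

Definition MT (V : lmodType K) (act : sub levi -> V -> V) : lmodType K :=
  ind (fun x : sub parab => vsval x) (inflate mplus (P := parab) act).

Definition MT_act (V : lmodType K) (act : sub levi -> V -> V) :
    g -> MT act -> MT act := @ind_act _ _ _ _ _ _.

Definition MS (V : lmodType K) (act : sub levi0 -> V -> V) : lmodType K :=
  ind (@incl _ g parab0 g0) (inflate mplus0 (P := parab0) act).

Definition MS_act (V : lmodType K) (act : sub levi0 -> V -> V) :
    sub g0 -> MS act -> MS act := @ind_act _ _ _ _ _ _.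

End Setting.

(* The quotient W / W' of submodules W' <= W of M is isomorphic to N: the map
   f, restricted to W, is a surjective homomorphism with kernel W'. *)
Definition subquotient_iso (K : fieldType) (A : superalg K) (M N : lmodType K)
    (actM : A -> M -> M) (actN : A -> N -> N) (W W' : set M) :=
  exists f : M -> N,
    [/\ forall a u v, W u -> W v -> f (a *: u + v) = a *: f u + f v,
        forall x w, W w -> f (actM x w) = actN x (f w),
        forall n, exists2 w, W w & f w = n
      & forall w, W w -> (f w = 0 <-> W' w)].

(* Main.v *)
(* By the Poincare-Birkhoff-Witt theorem, M_T(lambda) is free over U(m_0) on E =
   Lambda(g_1 / p_1) (x) L_T(lambda), which is embedded by ordered products of odd
   basis vectors and has dimension 2^c dim L_T(lambda). Let E_m be the part of odd
   degree at most m: the spaces U(g_0) E_m filter M_T(lambda), since modulo lower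
   odd degree p_0 preserves E_m. A composition series of the finite dimensional
   p_0-modules E_m / E_{m-1} then refines E_0 < E_1 < ... to subspaces C_i for
   which U(g_0) C_i / U(g_0) C_{i-1} is induced from the simple p_0-module C_i /
   C_{i-1}. The even part of m^+ acts on this simple module by nilpotent operators,
   hence by 0; it is thus a simple finite dimensional l_0-module and has a dominant
   highest weight. *)

From HB Require Import structures.
Require Import Defs.
From mathcomp Require Import all_boot all_order all_algebra.
From mathcomp Require Import falgebra monalg ring zify spectral.
From mathcomp Require Import complex boolp classical_sets reals.
Set Implicit Arguments.
Unset Strict Implicit.
Unset Printing Implicit Defensive.
Import GRing.Theory.
Local Open Scope classical_set_scope.
Local Open Scope ring_scope.

(** * Linear maps and spans *)

(** The space E need not be p_0-stable in M_T(lambda): an element of p_0 sends E to E only up to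
    U(g_0) times lower layers. Hence E gets no module structure. It is a space of row vectors with a
    linear map to M_T(lambda); its subspaces are compared by the relation [adjacent], which allows
    such an error, and the action on a subquotient is read off as the coefficient of the empty even
    word. All this rests on the linear independence of ordered words, proved by letting g act on the
    free module on words and checking the bracket relation there. The divisions by 2 and 3 come from
    odd elements x, for which x x = [x, x] / 2 and 3 [x, [x, x]] = 0. Words are taken in a
    homogeneous basis of a complement of p, even vectors before odd ones, so that an ordered word is
    an even word, standing for U(m_0), followed by a set of odd letters; these sets are counted by
    2^c. Dominance needs care because the coroot is defined in all of g_0, while only p_0 acts on a
    layer. *)

Section LinearMaps.
Variables (K : fieldType) (V W : lmodType K).
Implicit Type f : V -> W.

Lemma lin0 f : linear f -> f 0 = 0.
Proof. by move=> /linearB_fun[]. Qed.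

Lemma linB f : linear f -> {morph f : x y / x - y}.
Proof. by move=> /linearB_fun[]. Qed.

Lemma linD f : linear f -> {morph f : x y / x + y}.
Proof. by move=> lf x y; rewrite -[x in LHS]scale1r lf scale1r. Qed.

Lemma linZ f : linear f -> forall a, {morph f : x / a *: x}.
Proof. by move=> lf a x; rewrite -[a *: x]addr0 lf (lin0 lf) addr0. Qed.

Lemma linN f : linear f -> {morph f : x / - x}.
Proof. by move=> lf x; rewrite -scaleN1r (linZ lf) scaleN1r. Qed.

Lemma lin_sum f I (r : seq I) (P : pred I) F : linear f ->
  f (\sum_(i <- r | P i) F i) = \sum_(i <- r | P i) f (F i).
Proof.
by move=> lf; apply: (big_morph f (linD lf) (lin0 lf)).
Qed.

Lemma subspace_eq f g : linear f -> linear g -> subspace [set x | f x = g x].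
Proof.
move=> lf lg; split=> /= [|a u v fu fv]; first by rewrite !lin0.
by rewrite lf lg fu fv.
Qed.

Lemma subspace_preim f (S : set W) : linear f -> subspace S -> subspace (f @^-1` S).
Proof.
move=> lf [S0 SS]; split=> /= [|a u v fu fv]; first by rewrite lin0.
by rewrite lf; apply: SS.
Qed.

End LinearMaps.

Section Subspaces.
Variables (K : fieldType) (V : lmodType K).
Implicit Types S R : set V.

Lemma sub0 S : subspace S -> S 0. Proof. by case. Qed.

Lemma subD S : subspace S -> forall u v, S u -> S v -> S (u + v).
Proof. by move=> [_ SS] u v Su Sv; rewrite -[u]scale1r; apply: SS. Qed.

Lemma subZ S : subspace S -> forall a u, S u -> S (a *: u).
Proof. by move=> [S0 SS] a u Su; rewrite -[_ *: _]addr0; apply: SS. Qed.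

Lemma subN S : subspace S -> forall u, S u -> S (- u).
Proof. by move=> sS u Su; rewrite -scaleN1r; apply: subZ. Qed.

Lemma subB S : subspace S -> forall u v, S u -> S v -> S (u - v).
Proof. by move=> sS u v Su Sv; apply: subD => //; apply: subN. Qed.

Lemma sub_bigsum S : subspace S -> forall I (r : seq I) (P : pred I) F,
  (forall i, P i -> S (F i)) -> S (\sum_(i <- r | P i) F i).
Proof. by move=> sS I r P F SF; apply: big_ind => //; [exact: sub0 | exact: subD]. Qed.

Lemma lspan_le R S : subspace S -> R `<=` S -> lspan R `<=` S.
Proof. by move=> sS RS x; apply. Qed.

Lemma lspan_id S : subspace S -> lspan S = S.
Proof. by move=> sS; apply/seteqP; split; [exact: lspan_le | exact: sub_lspan]. Qed.

Lemma lspan_mono R S : R `<=` S -> lspan R `<=` lspan S.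
Proof.
move=> RS; apply: lspan_le; first exact: subspace_lspan.
by move=> x /RS; apply: sub_lspan.
Qed.

Lemma lspan_map (W : lmodType K) (f : V -> W) (R : set V) (S : set W) :
  linear f -> (forall x, R x -> lspan S (f x)) -> forall x, lspan R x -> lspan S (f x).
Proof.
move=> lf RS x Rx; apply: (Rx (f @^-1` lspan S)) => //.
exact: subspace_preim (subspace_lspan _).
Qed.

Definition sadd S R : set V := [set x | exists u v, [/\ S u, R v & x = u + v]].

Lemma subspace_sadd S R : subspace S -> subspace R -> subspace (sadd S R).
Proof.
move=> sS sR; split=> [|a _ _ [u [v [Su Rv ->]]] [u' [v' [Su' Rv' ->]]]].
  by exists 0, 0; rewrite addr0; split=> //; exact: sub0.
exists (a *: u + u'), (a *: v + v'); split; [exact: sS.2 | exact: sR.2 |].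
by rewrite scalerDr addrACA.
Qed.

Lemma saddl S R : subspace R -> S `<=` sadd S R.
Proof. by move=> sR x Sx; exists x, 0; rewrite addr0; split=> //; exact: sub0. Qed.

Lemma saddr S R : subspace S -> R `<=` sadd S R.
Proof. by move=> sS x Rx; exists 0, x; rewrite add0r; split=> //; exact: sub0. Qed.

End Subspaces.

Section FreeModule.
Variables (K : fieldType) (I : choiceType) (V : lmodType K).

Lemma lext_linear_fun (W : lmodType K) (h : W -> I -> V) (t : {malg K[I]}) :
  (forall q, linear (h^~ q)) -> linear (fun w => lext (h w) t).
Proof.
move=> lh a u v; rewrite /lext scaler_sumr -big_split; apply: eq_bigr => q _ /=.
by rewrite lh scalerDr !scalerA mulrC.
Qed.

End FreeModule.

(** * The action of the enveloping algebra on a module *)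

Section EnvelopingAction.
Variables (K : fieldType) (A : superalg K) (P : lmodType K) (aP : A -> P -> P).
Hypothesis modP : is_module aP.

Definition wact (w : seq A) (p : P) : P := foldr aP p w.

Lemma aP_linl p : linear (aP^~ p). Proof. exact: modP.1.1. Qed.
Lemma aP_linr x : linear (aP x). Proof. exact: modP.1.2. Qed.

Lemma wact_linear w : linear (wact w).
Proof. by elim: w => [|x w IH] a p q //=; rewrite IH aP_linr. Qed.

Lemma wact_cat w w' p : wact (w ++ w') p = wact w (wact w' p).
Proof. exact: foldr_cat. Qed.

(* The lock only keeps unification from unfolding. *)
Fact free_act_key : unit. Proof. exact: tt. Qed.
Definition free_act : freealg K A -> P -> P :=
  locked_with free_act_key
    (fun f p => lext (fun m : fmonom A => wact m p) f).

Lemma free_actE f p : free_act f p = lext (fun m : fmonom A => wact m p) f.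
Proof. by rewrite /free_act locked_withE. Qed.

Lemma free_act_linl p : linear (free_act^~ p).
Proof. by move=> a f g; rewrite !free_actE; exact: lext_linear. Qed.

Lemma free_act_linr f : linear (free_act f).
Proof.
move=> a p q; rewrite !free_actE.
by apply: (lext_linear_fun (h := fun p (m : fmonom A) => wact m p)) => m; exact: wact_linear.
Qed.

Lemma free_actU m p : free_act (mkmalgU m 1) p = wact m p.
Proof. by rewrite free_actE; exact: lextU. Qed.

Lemma freealg_mulUU (m m' : fmonom A) :
  (mkmalgU m 1 : freealg K A) * mkmalgU m' 1 = mkmalgU (mmul m m') 1.
Proof.
by rewrite -[in RHS](mulr1 1); exact: (@fgmulUU (fmonom A) K 1 1 m m').
Qed.

Lemma freealg_mull (g : freealg K A) : linear (fun f : freealg K A => f * g).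
Proof. by move=> a u v; rewrite mulrDl -scalerAl. Qed.

Lemma freealg_mulr (g : freealg K A) : linear (fun f : freealg K A => g * f).
Proof. by move=> a u v; rewrite mulrDr -scalerAr. Qed.

Lemma free_act_mul f g p : free_act (f * g) p = free_act f (free_act g p).
Proof.
apply: (malg_span (W := [set f | free_act (f * g) p = free_act f (free_act g p)])).
  apply: (subspace_eq (f := fun f => free_act (f * g) p)
    (g := free_act^~ (free_act g p))); last exact: free_act_linl.
  by move=> a u v; rewrite freealg_mull; exact: free_act_linl.
move=> m; apply: (malg_span (W := [set g | free_act (mkmalgU m 1 * g) p
   = free_act (mkmalgU m 1) (free_act g p)])).
  apply: (subspace_eq (f := fun g => free_act (mkmalgU m 1 * g) p)
    (g := fun g => free_act (mkmalgU m 1) (free_act g p))).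
    by move=> a u v; rewrite freealg_mulr; exact: free_act_linl.
  by move=> a u v; rewrite free_act_linl; exact: free_act_linr.
by move=> m' /=; rewrite freealg_mulUU !free_actU fmM wact_cat.
Qed.

Lemma free_act_gen x p : free_act (gen x) p = aP x p.
Proof. by rewrite genE free_actU fmU. Qed.

Lemma free_act1 p : free_act 1 p = p.
Proof.
have -> : (1 : freealg K A) = mkmalgU (@mone (fmonom A)) 1 by [].
by rewrite free_actU fm1.
Qed.

Lemma free_act_rel r p : env_rel r -> free_act r p = 0.
Proof.
have lB f g : free_act f p = free_act g p -> free_act (f - g) p = 0.
  by move=> e; rewrite (linB (free_act_linl p) f g) e subrr.
have lZ a f : free_act (a *: f) p = a *: free_act f p.
  exact: (linZ (free_act_linl p) a f).
case=> [[a [x [y ->]]]|[a [b [x [y [xa yb ->]]]]]].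
  apply: lB; rewrite (linD (free_act_linl p) (a *: gen x) (gen y)) lZ.
  by rewrite !free_act_gen aP_linl.
apply: lB; rewrite free_act_gen (modP.2 _ _ _ _ _ xa yb).
rewrite (linB (free_act_linl p) (gen x * gen y) (_ *: _)) lZ.
have gg z t : free_act (gen z * gen t) p = aP z (aP t p).
  by rewrite free_act_mul !free_act_gen.
by congr (_ - _ *: _); exact: gg.
Qed.

Lemma free_act_ideal f p : lspan (ideal_gens (@env_rel K A)) f -> free_act f p = 0.
Proof.
move=> If; apply: (If [set f | free_act f p = 0]).
  split=> /= [|a u v eu ev]; first exact: lin0 (free_act_linl p).
  by rewrite (free_act_linl p a u v) eu ev scaler0 addr0.
move=> _ [u [r [v [hr ->]]]] /=.
rewrite (free_act_mul (u * r) v) (free_act_mul u r) (free_act_rel _ hr).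
exact: lin0 (free_act_linr u).
Qed.

Definition eact (u : env A) (p : P) : P := free_act (repra u) p.

(** The representative chosen in [eact] is immaterial: two of them differ by an element of the ideal
    generated by [env_rel], which acts by 0 because its generators express the module axioms. *)
Lemma eact_pia f p : eact (pia (@env_rel K A) f) p = free_act f p.
Proof.
apply/eqP; rewrite -subr_eq0 -(linB (free_act_linl p)); apply/eqP.
by apply: free_act_ideal; apply/pia_eq; rewrite repraK.
Qed.

Lemma eact_linl p : linear (eact^~ p).
Proof.
move=> a u v; have [f ->] := pia_surj u; have [g ->] := pia_surj v.
have -> : a *: (pia (@env_rel K A) f : env A) + pia (@env_rel K A) g = pia (@env_rel K A) (a *: f + g).
  by rewrite piaD; congr (_ + _); exact: piaZ.
by rewrite !eact_pia free_act_linl.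
Qed.

Lemma eact_linr u : linear (eact u). Proof. exact: free_act_linr. Qed.

Lemma eact_mul u v p : eact (u * v) p = eact u (eact v p).
Proof.
have [f ->] := pia_surj u; have [g ->] := pia_surj v.
have -> : (pia (@env_rel K A) f : env A) * pia (@env_rel K A) g = pia (@env_rel K A) (f * g).
  exact: mulaE.
by rewrite !eact_pia free_act_mul.
Qed.

Lemma eact_inj x p : eact (env_inj x) p = aP x p.
Proof. by rewrite eact_pia free_act_gen. Qed.

Lemma eact1 p : eact 1 p = p.
Proof. by rewrite -[RHS]free_act1; exact: eact_pia. Qed.

End EnvelopingAction.

(** The free algebra is spanned by monomials, and a nonempty monomial is a generator times a shorter
    one. *)
Lemma env_ind (K : fieldType) (A : superalg K) (W : set (env A)) :
  subspace W -> W 1 -> (forall x u, W u -> W (env_inj x * u)) -> forall u, W u.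
Proof.
move=> sW W1 WM u; have [f ->] := pia_surj u.
have piD a (p q : freealg K A) : pia (@env_rel K A) (a *: p + q) =
    a *: (pia (@env_rel K A) p : env A) + pia (@env_rel K A) q.
  by rewrite piaD; congr (_ + _); exact/esym/piaZ.
apply: (malg_span (W := [set f : freealg K A | W (pia (@env_rel K A) f)])).
  split=> /= [|a p q Wp Wq]; first by rewrite /pia pil0; exact: sW.1.
  by rewrite piD; apply: sW.2.
move=> [w] /=; elim: w => [|x w IH].
  have -> : FMonom [::] = @mone (fmonom A) by apply/val_inj; rewrite /= fm1.
  by move: W1.
have -> : FMonom (x :: w) = mmul (fmu x) (FMonom w).
  by apply/val_inj; rewrite /= fmM fmU.
rewrite -freealg_mulUU -genE.
have -> : pia (@env_rel K A) (gen x * mkmalgU (FMonom w) 1) =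
    env_inj x * (pia (@env_rel K A) (mkmalgU (FMonom w) 1) : env A).
  exact/esym/mulaE.
exact: WM.
Qed.

(** * The universal property of induced modules *)

Section InductionUniversal.
Variables (K : fieldType) (B A : superalg K) (phi : B -> A).
Variables (N : lmodType K) (act : B -> N -> N).
Local Notation ind := (ind phi act).

Lemma ind_gen (W : set ind) : subspace W -> (forall n, W (indt phi act 1 n)) ->
  (forall x m, W m -> W (ind_act x m)) -> forall m, W m.
Proof.
move=> sW W1 WA m; rewrite (_ : W = setT) //; apply: ind_span => // u n.
suff H : forall v m, W m -> W (ind_mul v m).
  by have := H u _ (W1 n); rewrite ind_mulE mulr1.
clear u n m; move=> u; apply: (env_ind (W := [set u | forall m, W m -> W (ind_mul u m)])).
- have lin (m : ind) : linear (fun u : env A => ind_mul u m).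
    move=> a u1 u2; apply: (ind_ext (f := ind_mul (a *: u1 + u2))
      (g := fun m => a *: ind_mul u1 m + ind_mul u2 m)).
    + exact: ind_mul_linear.
    + by move=> b p q; rewrite !ind_mul_linear !scalerDr addrACA !scalerA mulrC.
    + by move=> v n; rewrite !ind_mulE mulrDl -scalerAl indt_linearl.
  split=> [m _|a u1 u2 /= W1' W2' m Wm]; first by rewrite (lin0 (lin m)); exact: sub0.
  by rewrite lin; apply: sW.2; [exact: W1' | exact: W2'].
- move=> m Wm; rewrite (_ : ind_mul 1 m = m) //.
  apply: (ind_ext (f := ind_mul 1) (g := id)) => //; first exact: ind_mul_linear.
  by move=> v n; rewrite ind_mulE mul1r.
- move=> x v /= Wv m Wm; rewrite (_ : ind_mul _ m = ind_act x (ind_mul v m)).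
    exact/WA/Wv.
  apply: (ind_ext (f := ind_mul (env_inj x * v)) (g := fun m => ind_act x (ind_mul v m))).
  + exact: ind_mul_linear.
  + by move=> a p q; rewrite /ind_act !ind_mul_linear.
  + by move=> w n; rewrite /ind_act !ind_mulE mulrA.
Qed.

Variables (P : lmodType K) (aP : A -> P -> P) (modP : is_module aP).
Variables (tau : N -> P) (ltau : linear tau).
Hypothesis tauB : forall b n, tau (act b n) = aP (phi b) (tau n).

(** Frobenius reciprocity: u (x) n goes to u acting on [tau n], and [tauB] makes this balanced over
    B. *)
Lemma ind_lift_ex : exists Psi : ind -> P,
  [/\ linear Psi, forall n, Psi (indt phi act 1 n) = tau n
    & forall x m, Psi (ind_act x m) = aP x (Psi m)].
Proof.
pose h (p : (env A * N)%type) := eact aP p.1 (tau p.2).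
pose Psi (m : ind) : P := lext h (generic_quotient.repr (m : ring_quotient.Quotient.quot (lspanb (ind_rel phi act)))).
have lextT u n : lext h (tens u n) = eact aP u (tau n).
  by rewrite tensE; exact: lextU.
have PsiE f : Psi (pil (ind_rel phi act) f) = lext h f.
  rewrite /Psi; set f' := generic_quotient.repr _.
  apply/eqP; rewrite -subr_eq0 -(linB (lext_linear h)); apply/eqP.
  have : lspan (ind_rel phi act) (f' - f).
    by apply/pil_eq; rewrite pilE generic_quotient.reprK.
  move/(_ [set f | lext h f = 0]); apply; first split=> /=.
  - exact: lin0 (lext_linear h).
  - by move=> a x y lx ly; rewrite lext_linear lx ly scaler0 addr0.
  move=> p [[a [v [w [n ->]]]]|[a [v [n [m ->]]]]|[v [b [n ->]]]] /=.
  - rewrite (linB (lext_linear h)) (linD (lext_linear h)) (linZ (lext_linear h)).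
    by rewrite !lextT eact_linl ?subrr.
  - rewrite (linB (lext_linear h)) (linD (lext_linear h)) (linZ (lext_linear h)).
    by rewrite !lextT ltau eact_linr ?subrr.
  - rewrite (linB (lext_linear h)) !lextT eact_mul // eact_inj // tauB.
    by rewrite subrr.
have lPsi : linear Psi.
  move=> a u v; have [f ->] := pil_surj u; have [g ->] := pil_surj v.
  by rewrite -pil_linear !PsiE lext_linear.
exists Psi; split=> // [n|x m].
  by rewrite /indt PsiE lextT eact1.
have : setT m by [].
rewrite -(@ind_span _ _ _ _ _ _ [set m | Psi (ind_act x m) = aP x (Psi m)]) //.
- apply: (subspace_eq (f := fun m => Psi (ind_act x m)) (g := fun m => aP x (Psi m))).
  + by move=> a u v; rewrite /ind_act ind_mul_linear lPsi.
  + by move=> a u v; rewrite lPsi (aP_linr modP).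
- move=> u n /=; rewrite /ind_act ind_mulE /indt !PsiE !lextT.
  by rewrite eact_mul // eact_inj.
Qed.

End InductionUniversal.

(** * Poincare-Birkhoff-Witt independence for induced modules *)

Section LinearCombinations.
Variables (K : fieldType) (V W : lmodType K).

Lemma linear_comb (f g : V -> W) (c : K) : linear f -> linear g ->
  linear (fun x => f x + c *: g x).
Proof.
move=> lf lg a x y; rewrite lf lg !scalerDr !scalerA [c * a]mulrC.
by rewrite addrACA.
Qed.

Lemma linear_comp (Z : lmodType K) (f : V -> W) (g : Z -> V) :
  linear f -> linear g -> linear (fun x => f (g x)).
Proof. by move=> lf lg a x y; rewrite lg lf. Qed.

Lemma linear_sum_fun (I : Type) (r : seq I) (f : I -> V -> W) :
  (forall i, linear (f i)) -> linear (fun x => \sum_(i <- r) f i x).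
Proof.
move=> lf a x y; rewrite scaler_sumr -big_split; apply: eq_bigr => i _ /=.
exact: lf.
Qed.

End LinearCombinations.

Section Super.
Variables (K : fieldType) (A : superalg K).
Hypothesis HA : lie_superalgebra A.
Hypotheses (ch2 : 2%:R != 0 :> K) (ch3 : 3%:R != 0 :> K).

Lemma br_linl (y : A) : linear (fun x : A => br x y).
Proof. by case: HA => -[]. Qed.

Lemma br_linr (x : A) : linear (br x : A -> A).
Proof. by case: HA => -[]. Qed.

Lemma br_part a b (x y : A) : x \in part A a -> y \in part A b -> br x y \in part A (a (+) b).
Proof. by case: HA => _ _ h _ _; exact: h. Qed.

Lemma brC a b (x y : A) : x \in part A a -> y \in part A b ->
  br x y = - ((-1) ^+ (a && b) *: br y x).
Proof. by case: HA => _ _ _ h _; exact: h. Qed.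

Lemma br_jacobi a b (x y z : A) : x \in part A a -> y \in part A b ->
  br x (br y z) = br (br x y) z + (-1) ^+ (a && b) *: br y (br x z).
Proof. by case: HA => _ _ _ _ h; exact: h. Qed.

Lemma part_cap (x : A) : x \in part A false -> x \in part A true -> x = 0.
Proof.
case: HA => _ [_ e] _ _ _ x0 x1; apply/eqP.
by rewrite -memv0 -e memv_cap x0 x1.
Qed.

Lemma part_dec (x : A) : exists x0 x1, [/\ x0 \in part A false, x1 \in part A true & x = x0 + x1].
Proof.
case: HA => _ [e _] _ _ _; have : x \in fullv by exact: memvf.
by rewrite -e => /memv_addP[x0 h0 [x1 h1 ->]]; exists x0, x1.
Qed.

Lemma half_half (V : lmodType K) (v w : V) : v + v = w -> v = 2%:R^-1 *: w.
Proof. by move=> <-; rewrite -[v + v]/(v *+ 2) -scaler_nat scalerA mulVf // scale1r. Qed.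

Lemma br_even_self (x : A) : x \in part A false -> br x x = 0.
Proof.
move=> x0; rewrite [LHS](half_half (w := 0)) ?scaler0 //.
by rewrite {1}(brC x0 x0) expr0 scale1r addNr.
Qed.

(** With t = [x, [x, x]], Jacobi gives t = [[x, x], x] - t and antisymmetry gives [[x, x], x] = - t,
    so 3 t = 0. *)
Lemma br_odd_self (x : A) : x \in part A true -> br x (br x x) = 0.
Proof.
move=> x1; have x2 := br_part x1 x1.
have := br_jacobi x x1 x1; rewrite (brC x2 x1) /= expr0 expr1 scale1r scaleN1r.
move=> e; have : br x (br x x) *+ 3 = 0.
  by rewrite !mulrS mulr0n addr0 {1}e addrA addrNK addNr.
by rewrite -scaler_nat => /eqP; rewrite scaler_eq0 (negbTE ch3) => /eqP.
Qed.

End Super.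

(** * The module structure on the space of words *)

Section PBW.
Variables (K : fieldType) (A : superalg K).
Hypothesis HA : lie_superalgebra A.
Hypotheses (ch2 : 2%:R != 0 :> K) (ch3 : 3%:R != 0 :> K).
Variables (nn n0 d : nat) (X : nn.-tuple A) (par : nat -> bool) (B : {vspace A}).
Hypothesis bX : basis_of fullv X.
Hypothesis le_n0 : (n0 <= nn)%N.
Hypothesis parX : forall k, (k < nn)%N -> X`_k \in part A (par k).
Hypothesis BX : forall k, (n0 <= k < nn)%N -> X`_k \in B.
Hypothesis BE : forall b, b \in B -> forall k : 'I_nn, (k < n0)%N -> coord X k b = 0.
Hypothesis Bbr : forall x y, x \in B -> y \in B -> br x y \in B.
Variables (N : lmodType K) (nu : 'I_d -> N) (co : 'I_d -> N -> K).
Hypothesis co_lin : forall j, linear (co j : N -> K^o).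
Hypothesis coE : forall n, n = \sum_j co j n *: nu j.
Hypothesis co_nu : forall i j, co i (nu j) = (i == j)%:R.
Variable actN : A -> N -> N.
Hypothesis actN_lin : bilinear_op actN.
Hypothesis actN_br : forall a b x y n, x \in part A a -> y \in part A b ->
  x \in B -> y \in B ->
  actN (br x y) n = actN x (actN y n) - (-1) ^+ (a && b) *: actN y (actN x n).

Local Notation word := (seq nat * 'I_d)%type.
(* P is a free module on the words; keeping it abstract prevents unification
   from unfolding finitely supported functions. *)
Variables (P : lmodType K) (Uw : seq nat -> 'I_d -> P).
Variables (ext : (word -> P) -> P -> P) (coef : word -> P -> K).
Hypothesis ext_linear : forall h, linear (ext h).
Hypothesis extU : forall h s j, ext h (Uw s j) = h (s, j).
Hypothesis Uw_span : forall S : set P, subspace S -> (forall s j, S (Uw s j)) -> forall t, S t.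
Hypothesis coef_linear : forall q, linear (coef q : P -> K^o).
Hypothesis coef_inj : forall t t', (forall q, coef q t = coef q t') -> t = t'.

Definition supp_on (Z : set word) : set P := lspan [set t | exists2 q, Z q & t = Uw q.1 q.2].

Lemma subspace_supp_on Z : subspace (supp_on Z). Proof. exact: subspace_lspan. Qed.

Lemma supp_onD Z t t' : supp_on Z t -> supp_on Z t' -> supp_on Z (t + t').
Proof. exact: (subD (subspace_supp_on Z)). Qed.

Lemma supp_onZ Z a t : supp_on Z t -> supp_on Z (a *: t).
Proof. exact: (subZ (subspace_supp_on Z)). Qed.

Lemma supp_on_sum Z I (r : seq I) (Q : pred I) F : (forall i, Q i -> supp_on Z (F i)) ->
  supp_on Z (\sum_(i <- r | Q i) F i).
Proof. exact: (sub_bigsum (subspace_supp_on Z)). Qed.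

Lemma supp_onU (Z : set word) s j : Z (s, j) -> supp_on Z (Uw s j).
Proof. by move=> Zq; apply: sub_lspan; exists (s, j). Qed.

Lemma supp_on_ind (Z : set word) (S : set P) : subspace S ->
  (forall q, Z q -> S (Uw q.1 q.2)) -> supp_on Z `<=` S.
Proof. by move=> sS SU; apply: lspan_le => // _ [q Zq ->]; exact: SU. Qed.

Lemma supp_on_mono (Z Z' : set word) (t : P) : Z `<=` Z' -> supp_on Z t -> supp_on Z' t.
Proof. by move=> ZZ'; apply: lspan_mono => _ [q /ZZ' Zq ->]; exists q. Qed.

Lemma ext_in (Z : set word) h (S : set P) t : subspace S -> (forall q, Z q -> S (h q)) ->
  supp_on Z t -> S (ext h t).
Proof.
move=> sS Sh; apply: (supp_on_ind (S := ext h @^-1` S)).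
  exact: subspace_preim.
by move=> [s j] Zq; rewrite /preimage /= extU; exact: Sh.
Qed.

Lemma ext_eq (Z : set word) h h' t : (forall q, Z q -> h q = h' q) -> supp_on Z t ->
  ext h t = ext h' t.
Proof.
move=> hh'; apply: (supp_on_ind (S := [set t | ext h t = ext h' t])).
  exact: subspace_eq.
by move=> [s j] Zq; rewrite /= !extU; exact: hh'.
Qed.

Lemma ext_eqT h h' t : (forall q, h q = h' q) -> ext h t = ext h' t.
Proof.
move=> hh'; apply: (Uw_span (S := [set t | ext h t = ext h' t])).
  exact: subspace_eq.
by move=> s j; rewrite /= !extU.
Qed.

Lemma ext_linear_fun (W : lmodType K) (h : W -> word -> P) t :
  (forall q, linear (h^~ q)) -> linear (fun w => ext (h w) t).
Proof.
move=> lh a u v.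
apply: (Uw_span (S := [set t | ext (h (a *: u + v)) t = a *: ext (h u) t + ext (h v) t])).
  apply: (subspace_eq (g := fun t => a *: ext (h u) t + ext (h v) t)) => // b x y.
  by rewrite !ext_linear !scalerDr !scalerA addrACA [a * b]mulrC.
by move=> s j /=; rewrite !extU lh.
Qed.

(* Ordered words in the first n0 basis vectors, which span a complement of B;
   odd letters are not repeated. *)
Definition allow i h := (i < h)%N || ((i == h) && ~~ par i).
Definition okw s := sorted allow s && all (fun k => k < n0)%N s.

Lemma allow_trans : transitive allow.
Proof.
move=> j i k; rewrite /allow => /orP[ij|/andP[/eqP-> pj]] /orP[jk|/andP[/eqP<- pk]].
- by rewrite (ltn_trans ij jk).
- by rewrite ij.
- by rewrite jk.
- by rewrite eqxx pj orbT.
Qed.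

Lemma okw_cons i s : okw (i :: s) = [&& all (allow i) s, (i < n0)%N & okw s].
Proof.
rewrite /okw /= (path_sortedE allow_trans) -!andbA; congr (_ && _).
by rewrite andbCA.
Qed.

Definition emb (n : N) : P := \sum_j co j n *: Uw [::] j.

Lemma emb_lin : linear emb.
Proof.
apply: linear_sum_fun => j a x y; rewrite co_lin scalerDl.
by rewrite -[_ *: _ in LHS]scalerA.
Qed.

Lemma emb_nu j : emb (nu j) = Uw [::] j.
Proof.
rewrite /emb (bigD1 j) //= co_nu eqxx scale1r big1 ?addr0 // => i /negbTE ne.
by rewrite co_nu ne scale0r.
Qed.

(* X_k times an ordered word: for k > i use x_k x_i = [x_k, x_i] +- x_i x_k, for
   odd k = i use x_k x_k = [x_k, x_k] / 2. G gives the products with shorter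
   words. A word as long as i :: s occurring in x_k s is sorted, with letters
   above i, hence may be prefixed by i. *)
Definition step (G : nat -> word -> P) (k : nat) (p : word) : P :=
  match p.1 with
  | [::] => if (k < n0)%N then Uw [:: k] p.2 else emb (actN X`_k (nu p.2))
  | i :: s =>
      if allow k i then Uw (k :: i :: s) p.2 else
      let c := \sum_(l < nn) coord X l (br X`_k X`_i) *: G l (s, p.2) in
      if k == i then 2%:R^-1 *: c else
      c + (-1) ^+ (par k && par i) *:
        ext (fun q : word => if (size q.1 <= size s)%N then G i q else Uw (i :: q.1) q.2)
             (G k (s, p.2))
  end.

Lemma step_nil G k j : step G k ([::], j) =
  if (k < n0)%N then Uw [:: k] j else emb (actN X`_k (nu j)).
Proof. by []. Qed.

Lemma step_cons G k i s j : step G k (i :: s, j) =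
  if allow k i then Uw (k :: i :: s) j else
  let c := \sum_(l < nn) coord X l (br X`_k X`_i) *: G l (s, j) in
  if k == i then 2%:R^-1 *: c else
  c + (-1) ^+ (par k && par i) *:
    ext (fun q : word => if (size q.1 <= size s)%N then G i q else Uw (i :: q.1) q.2)
         (G k (s, j)).
Proof. by []. Qed.

Lemma step_ext G G' k p :
  (forall l q, (size q.1 < size p.1)%N -> G l q = G' l q) -> step G k p = step G' k p.
Proof.
case: p => [[|i s] j] GG' //; rewrite !step_cons; case: ifP => // _.
rewrite (eq_bigr (fun l : 'I_nn => coord X l (br X`_k X`_i) *: G' l (s, j))); last first.
  by move=> l _; rewrite GG'.
move=> /=; case: eqP => // _; rewrite GG' //; set c := bigop _ _ _.
rewrite (ext_eqT (h' := fun q => if (size q.1 <= size s)%N then G' i q else Uw (i :: q.1) q.2)) // => q.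
by case: ifP => // qs; rewrite GG'.
Qed.

(** The recursion of [step] descends in word length, so m serves as a bound for the length. The
    function 0 at the bottom is never consulted for words of length at most m, since [step] makes no
    recursive call on the empty word. *)
Fixpoint Wact (m : nat) : nat -> word -> P :=
  if m is m'.+1 then step (Wact m') else step (fun _ _ => 0).

Lemma Wact_fuel m m' k p : (size p.1 <= m)%N -> (size p.1 <= m')%N ->
  Wact m k p = Wact m' k p.
Proof.
elim: m m' k p => [|m IH] [|m'] k p pm pm' //; apply: step_ext => l q qp //.
- by move: (leq_trans qp pm).
- by move: (leq_trans qp pm').
- by apply: IH; rewrite -ltnS; apply: (leq_trans qp).
Qed.

Definition G k (p : word) := Wact (size p.1) k p.

Lemma GE k p : G k p = step G k p.
Proof.
rewrite /G; case e: (size p.1) => [|m]; apply: step_ext => l q; rewrite e // => qm.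
by apply: Wact_fuel.
Qed.

(* Words that are not ordered are killed, so that the module law holds on all of P. *)
Definition gact (a : A) (q : word) : P :=
  if okw q.1 then \sum_(l < nn) coord X l a *: G l q else 0.

Definition pact (a : A) (t : P) : P := ext (gact a) t.

Lemma pact_linr a : linear (pact a). Proof. exact: ext_linear. Qed.

Lemma pact_linl t : linear (pact^~ t).
Proof.
apply: (ext_linear_fun (h := gact)) => q a u v; rewrite /gact; case: ifP => _.
  move: a u v; apply: (@linear_sum_fun _ _ _ _ _ (fun l a => coord X l a *: G l q)) => l a u v.
  have -> : coord X l (a *: u + v) = a * coord X l u + coord X l v by rewrite linearP.
  by rewrite scalerDl scalerA.
by rewrite scaler0 addr0.
Qed.

Lemma pactX k s j : (k < nn)%N -> pact X`_k (Uw s j) = if okw s then G k (s, j) else 0.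
Proof.
move=> kn; rewrite /pact extU /gact /=; case: ifP => // _.
have fX := basis_free bX.
rewrite (bigD1 (Ordinal kn)) //= big1 ?addr0 => [|l /negbTE ne].
  by rewrite (coord_free (Ordinal kn)) // eqxx scale1r.
by rewrite (coord_free (Ordinal kn)) // eq_sym ne scale0r.
Qed.

Lemma pact_bad a s j : ~~ okw s -> pact a (Uw s j) = 0.
Proof. by move=> /negbTE h; rewrite /pact extU /gact /= h. Qed.

Lemma pact_sum a s j : okw s ->
  pact a (Uw s j) = \sum_(l < nn) coord X l a *: G l (s, j).
Proof. by move=> h; rewrite /pact extU /gact /= h. Qed.

(* x_k s is a combination of words of size at most size s + 1, and the words of
   this size have their letters in k :: s. *)
Definition bound_on (k : nat) (s : seq nat) : set word :=
  [set q | [/\ okw q.1, (size q.1 <= (size s).+1)%N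
             & (size q.1 == (size s).+1 -> {subset q.1 <= k :: s})]].

Lemma bound_onI k s t j : okw t -> (size t <= (size s).+1)%N ->
  (size t == (size s).+1 -> {subset t <= k :: s}) -> bound_on k s (t, j).
Proof. by []. Qed.

(** Induction on the length. Bracket terms act on the tail s only and give short words. In the
    exchanged term a word of maximal length has its letters in k :: s; as i < k and i may precede s,
    it can be prefixed by i and stays ordered. *)
Lemma G_supp k s j : (k < nn)%N -> okw s -> supp_on (bound_on k s) (G k (s, j)).
Proof.
have [m] := ubnP (size s); elim: m k s j => // m IH k [|i s] j; rewrite /= => sm kn oks.
  rewrite GE step_nil; case: ifP => kn0.
    by apply: supp_onU; apply: bound_onI => [||_ h] //; rewrite /okw /= kn0.
  by apply: supp_on_sum => l _; apply: supp_onZ; apply: supp_onU; apply: bound_onI.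
have /[!okw_cons]/and3P[iall in0 oks'] := oks.
have low q : okw q.1 -> (size q.1 <= (size s).+1)%N -> bound_on k (i :: s) q.
  case: q => q j' /= okq qs; apply: bound_onI => //=; first exact: leqW.
  by rewrite eqn_leq ltnNge qs andbF.
have Glow l p : (l < nn)%N -> okw p.1 -> (size p.1 <= size s)%N ->
    supp_on (bound_on k (i :: s)) (G l p).
  case: p => p j' /= ln okp ps.
  apply: supp_on_mono (IH l p j' _ ln okp); last by apply: leq_ltn_trans ps _.
  by move=> q [okq qs _]; apply: low => //; apply: (leq_trans qs).
rewrite GE step_cons; case: ifP => [ki|nki].
  apply: supp_onU; apply: bound_onI => [||_ h] //=; rewrite okw_cons /= ki oks /= andbT; apply/andP; split.
    by apply: sub_all iall => h; apply: allow_trans.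
  by move: ki => /orP[ki|/andP[/eqP-> //]]; apply: ltn_trans ki in0.
have cs : supp_on (bound_on k (i :: s))
    (\sum_(l < nn) coord X l (br X`_k X`_i) *: G l (s, j)).
  by apply: supp_on_sum => l _; apply: supp_onZ; exact: Glow.
rewrite /=; case: ifP => [_|nkei]; first exact: supp_onZ.
apply: supp_onD => //; apply: supp_onZ.
have ik : (i < k)%N.
  by move: nki; rewrite /allow nkei orbF ltnNge => /negbFE; rewrite leq_eqVlt eq_sym nkei.
apply: (ext_in (Z := bound_on k s)); first exact: subspace_supp_on; last exact: IH.
move=> [q j'] /= [okq qs qk]; case: leqP => [le|gt].
  by apply: Glow => //; apply: leq_trans le_n0.
have qe : size q == (size s).+1 by rewrite eqn_leq qs.
apply: supp_onU; apply: bound_onI => /=.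
- rewrite okw_cons okq in0 !andbT /=; apply/allP => h /(qk qe).
  by rewrite inE => /orP[/eqP->|/(allP iall)//]; rewrite /allow ik.
- by rewrite ltnS.
- move=> _ h; rewrite inE => /orP[/eqP->|/(qk qe)]; first by rewrite !inE eqxx orbT.
  by rewrite !inE => /orP[->//|->]; rewrite !orbT.
Qed.

Definition below (i : nat) (s : seq nat) : set word :=
  [set q | okw q.1 /\ ((size q.1 <= size s)%N \/ okw (i :: q.1))].

(** This identifies the test on lengths in [step] with multiplication by X_i, see [pact_straighten]:
    every word of X_k s that is longer than s accepts the prefix i. *)
Lemma G_below i s j k : okw (i :: s) -> (i < k)%N -> (k < nn)%N ->
  supp_on (below i s) (G k (s, j)).
Proof.
rewrite okw_cons => /and3P[iall in0 oks] ik kn.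
apply: supp_on_mono (G_supp j kn oks) => -[q j'] /= [okq qs qk]; split=> //=.
have [le|gt] := leqP (size q) (size s); [by left | right].
have qe : size q == (size s).+1 by rewrite eqn_leq qs.
rewrite okw_cons okq in0 !andbT /=; apply/allP => h /(qk qe).
by rewrite inE => /orP[/eqP->|/(allP iall)//]; rewrite /allow ik.
Qed.

Lemma okw_lt k s : okw (k :: s) -> [/\ (k < nn)%N & okw s].
Proof.
by rewrite okw_cons => /and3P[_ kn ->]; split=> //; apply: leq_trans le_n0.
Qed.

Lemma pact_prepend k s j : okw (k :: s) -> pact X`_k (Uw s j) = Uw (k :: s) j.
Proof.
move=> oks; have [kn oks'] := okw_lt oks; rewrite pactX // oks'.
move: oks; rewrite GE okw_cons; case: s oks' => [|i s] _.
  by rewrite step_nil => /and3P[_ -> _].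
by rewrite step_cons => /and3P[/andP[-> _] _ _].
Qed.

Lemma pact_square k s j : par k -> okw (k :: s) ->
  pact X`_k (Uw (k :: s) j) = 2%:R^-1 *: pact (br X`_k X`_k) (Uw s j).
Proof.
move=> pk oks; have [kn oks'] := okw_lt oks; rewrite pactX // oks.
by rewrite GE step_cons /allow ltnn eqxx pk /= pact_sum.
Qed.

Lemma pact_straighten i k s j : okw (i :: s) -> (i < k)%N -> (k < nn)%N ->
  pact X`_k (Uw (i :: s) j) = pact (br X`_k X`_i) (Uw s j) +
    (-1) ^+ (par k && par i) *: pact X`_i (pact X`_k (Uw s j)).
Proof.
move=> oks ik kn; have [iN oks'] := okw_lt oks; rewrite pactX // oks.
rewrite GE step_cons /allow ltnNge (ltnW ik) (gtn_eqF ik) /=.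
rewrite -pact_sum //; congr (_ + _ *: _); rewrite pactX // oks'.
apply: (ext_eq (Z := below i s)); last exact: G_below.
move=> [q j'] /= [okq]; have := pactX q j' iN; rewrite okq {1}/pact {1}extU => ->.
case: ifP => [_ _|_ [//|oki]] //.
by rewrite -(pact_prepend j' oki) pactX // okq.
Qed.

(** Coordinates of b below n0 vanish, so every letter that contributes falls into the branch of
    [step] given by the action on N. *)
Lemma pact_emb b n : b \in B -> pact b (emb n) = emb (actN b n).
Proof.
move=> Bb; have [lN rN] := actN_lin.
rewrite {1}/emb (lin_sum _ _ _ (pact_linr b)) {2}(coE n) (lin_sum _ _ _ (rN b)).
rewrite (lin_sum _ _ _ emb_lin); apply: eq_bigr => j _.
rewrite (linZ (pact_linr b)) (linZ (rN b)) (linZ emb_lin); congr (_ *: _).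
rewrite pact_sum // {2}(coord_basis bX (memvf b)) (lin_sum _ _ _ (lN _)).
rewrite (lin_sum _ _ _ emb_lin); apply: eq_bigr => l _.
have [ln|ln] := ltnP l n0; first by rewrite BE // !scale0r (lin0 (lN _)) (lin0 emb_lin).
by rewrite (linZ (lN _)) (linZ emb_lin) GE step_nil ltnNge ln.
Qed.

Definition law a b (x y : A) : set P := [set t |
  pact (br x y) t = pact x (pact y t) - (-1) ^+ (a && b) *: pact y (pact x t)].

Lemma subspace_law a b x y : subspace (law a b x y).
Proof.
apply: (subspace_eq (f := fun t => pact (br x y) t)
  (g := fun t => pact x (pact y t) - (-1) ^+ (a && b) *: pact y (pact x t))).
  exact: pact_linr.
move=> c u v; rewrite -!scaleNr.
apply: (linear_comb (f := fun t => pact x (pact y t)) (g := fun t => pact y (pact x t))).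
  by apply: linear_comp; exact: pact_linr.
by apply: linear_comp; exact: pact_linr.
Qed.

Lemma part_sum a x : x \in part A a ->
  x = \sum_(k < nn | par k == a) coord X k x *: X`_k.
Proof.
move=> xa; set y := \sum_(k < nn | _) _.
have ya : y \in part A a.
  by apply: memv_suml => k /eqP <-; apply/memvZ/parX.
pose z := \sum_(k < nn | par k != a) coord X k x *: X`_k.
have za : z \in part A (~~ a).
  apply: memv_suml => k pk; apply: memvZ; have := parX (ltn_ord k).
  by move: pk; case: (par k); case: (a).
have xE : x = y + z by rewrite [LHS](coord_basis bX (memvf x)) (bigID (fun k : 'I_nn => par k == a)).
have z0 : z = 0.
  have : z \in part A a by rewrite -[z](addKr y) -xE addrC memvB.
  by move: za; case: (a) => /= h1 h2; apply: (part_cap HA).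
by rewrite {1}xE z0 addr0.
Qed.

Lemma law_lin a b (t : P) :
  (forall k l, (k < nn)%N -> (l < nn)%N -> law (par k) (par l) X`_k X`_l t) ->
  forall x y, x \in part A a -> y \in part A b -> law a b x y t.
Proof.
move=> H x y xa yb.
pose D x y := pact (br x y) t - pact x (pact y t) + (-1) ^+ (a && b) *: pact y (pact x t).
suff D0 : D x y = 0.
  apply/eqP; rewrite -subr_eq0; move/eqP: D0; rewrite /D.
  by rewrite opprB addrCA addrC addrAC => ->.
have lDl y' : linear (D^~ y').
  apply: (linear_comb (f := fun x => pact (br x y') t - pact x (pact y' t))
    (g := fun x => pact y' (pact x t))).
    move=> c u v; rewrite -!scaleN1r.
    apply: (linear_comb (f := fun x => pact (br x y') t) (g := fun x => pact x (pact y' t))).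
      exact: linear_comp (pact_linl t) (br_linl HA y').
    exact: pact_linl.
  exact: linear_comp (pact_linr y') (pact_linl t).
have lDr x' : linear (D x').
  apply: (linear_comb (f := fun y => pact (br x' y) t - pact x' (pact y t))
    (g := fun y => pact y (pact x' t))).
    move=> c u v; rewrite -!scaleN1r.
    apply: (linear_comb (f := fun y => pact (br x' y) t) (g := fun y => pact x' (pact y t))).
      exact: linear_comp (pact_linl t) (br_linr HA x').
    exact: linear_comp (pact_linr x') (pact_linl t).
  exact: pact_linl.
rewrite (part_sum xa) (lin_sum _ _ _ (lDl y)) big1 // => k /eqP pk.
rewrite (linZ (lDl y)) (part_sum yb) (lin_sum _ _ _ (lDr _)) big1 ?scaler0 // => l /eqP pl.
have := H _ _ (ltn_ord k) (ltn_ord l); rewrite /law /= (linZ (lDr _)) /D pk pl => ->.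
by rewrite [_ - _ - _]addrAC subrr sub0r addNr scaler0.
Qed.

Lemma law_sym k l t : (k < nn)%N -> (l < nn)%N ->
  law (par k) (par l) X`_k X`_l t -> law (par l) (par k) X`_l X`_k t.
Proof.
move=> kn ln; rewrite /law /= => e.
rewrite (brC HA (parX ln) (parX kn)) (linN (pact_linl t)) (linZ (pact_linl t)) e.
rewrite scalerBr scalerA andbC -signr_odd /= -expr2 sqrr_sign scale1r.
by rewrite opprB.
Qed.

(** When l may precede s, the law is built into the definition of the action: straightening for l <
    k, the rule for squares for odd l = k, while for even l = k the bracket vanishes. *)
Lemma law_prepend k l s j : okw (l :: s) -> (l <= k)%N -> (k < nn)%N ->
  law (par k) (par l) X`_k X`_l (Uw s j).
Proof.
move=> oks lk kn; have [ln oks'] := okw_lt oks; rewrite /law /= pact_prepend //.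
move: lk; rewrite leq_eqVlt => /orP[/eqP e|lk]; last first.
  by rewrite pact_straighten // addrK.
rewrite -e !(pact_prepend _ oks); case pl: (par l) => /=; last first.
  have xl := parX ln; rewrite pl in xl.
  by rewrite (br_even_self HA ch2 xl) (lin0 (pact_linl _)) expr0 scale1r subrr.
rewrite expr1 scaleN1r opprK pact_square // -mulr2n -scaler_nat scalerA mulfV //.
by rewrite scale1r.
Qed.

(** Induction on the length of s, with l <= k by symmetry. If l may not precede the first letter i,
    then i < l, or i = l is odd. The products with i :: s are then straightened, and the law for k,
    l on i :: s follows from the laws for the pairs among k, l, i on smaller words by the Jacobi
    identity. *)
Lemma pact_law a b x y t : x \in part A a -> y \in part A b -> law a b x y t.
Proof.
move=> xa yb.
suff HU : forall s j k l, okw s -> (k < nn)%N -> (l < nn)%N ->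
    law (par k) (par l) X`_k X`_l (Uw s j).
  apply: Uw_span => [|s j]; first exact: subspace_law.
  have [oks|nok] := boolP (okw s); first by apply: law_lin xa yb => k l; apply: HU.
  rewrite /law /= !(pact_bad _ _ nok).
  by rewrite !(lin0 (pact_linr _)) scaler0 subrr.
move=> s j k l; have [m] := ubnP (size s); elim: m s j k l => // m IH s j k l sm oks kn ln.
wlog lk : k l kn ln / (l <= k)%N.
  move=> h; have [lk|/ltnW kl] := leqP l k; first exact: h.
  by apply: law_sym => //; apply: h.
case: s sm oks => [|i s] sm oks.
  have [l0|l0] := ltnP l n0.
    by apply: law_prepend => //; rewrite /okw /= l0.
  have kB : X`_k \in B by apply: BX; rewrite kn (leq_trans l0).
  have lB : X`_l \in B by apply: BX; rewrite ln l0.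
  rewrite /law /= -emb_nu !pact_emb ?Bbr // (actN_br _ (parX kn) (parX ln)) //.
  by rewrite (linB emb_lin) (linZ emb_lin).
have [/= al|nal] := boolP (okw (l :: i :: s)); first exact: law_prepend.
have [iN oks'] := okw_lt oks.
have /[!okw_cons]/and3P[iall in0 _] := oks.
have {nal} : ~~ allow l i.
  apply: contra nal => al; rewrite okw_cons /= al oks /= andbT; apply/andP; split.
    by apply: sub_all iall => h; apply: allow_trans.
  by move: al => /orP[al|/andP[/eqP-> //]]; apply: ltn_trans al in0.
rewrite /allow negb_or -leqNgt negb_and negbK => /andP[il ipl].
have IHt a' b' x' y' : x' \in part A a' -> y' \in part A b' ->
    law a' b' x' y' (Uw s j).
  by apply: law_lin => k' l' kn' ln'; apply: IH.
(* The vector X_l' s may contain words longer than s, beyond the induction hypothesis; these accept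
   the prefix i, so [law_prepend] applies to them. *)
have IHb k' l' : (i < k')%N -> (k' < nn)%N -> (l' < nn)%N -> (i < l')%N ->
    law (par k') (par i) X`_k' X`_i (pact X`_l' (Uw s j)).
  move=> ik' kn' ln' il'; rewrite pactX // oks'.
  apply: supp_on_ind (G_below j oks il' ln'); first exact: subspace_law.
  move=> [q j'] /= [okq [qs|oki]].
    by apply: IH => //; apply: leq_ltn_trans qs _.
  by apply: law_prepend => //; apply: ltnW.
move: il; rewrite leq_eqVlt => /orP[/eqP e|il]; last first.
  have ik := leq_trans il lk.
  have pk := parX kn; have pl := parX ln; have pi := parX iN.
  have h1 := pact_straighten j oks il ln.
  have h1' := pact_straighten j oks ik kn.
  have h2 := IHt _ _ _ _ pk (br_part HA pl pi).
  have h2' := IHt _ _ _ _ pl (br_part HA pk pi).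
  have h3 := IHb k l ik kn ln il.
  have h3' := IHb l k il ln kn ik.
  have h4 := IHt _ _ _ _ pk pl.
  have h5 := IHt _ _ _ _ (br_part HA pk pl) pi.
  have Us := pact_prepend j oks.
  move: h2 h2' h3 h3' h4 h5; rewrite /law /= Us (br_jacobi HA X`_i pk pl).
  rewrite (linD (pact_linl _)) (linZ (pact_linl _)) => h2 h2' h3 h3' h4 h5.
  rewrite h1 h1' !(linD (pact_linr _)) !(linZ (pact_linr _)).
  move: h5; rewrite h4 (linB (pact_linr _)) (linZ (pact_linr _)).
  (* What remains is a linear identity between eleven vectors. The functionals [coef q] turn it into
     an identity of scalars, and the signs are settled by cases on the three parities. *)
  move: h2 h2' h3 h3'; clear -coef_linear coef_inj.
  move: (pact (br X`_k X`_l) (Uw (i :: s) j)) => v0.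
  move: (pact (br (br X`_k X`_l) X`_i) (Uw s j)) => v1.
  move: (pact (br X`_l (br X`_k X`_i)) (Uw s j)) => v2.
  move: (pact X`_k (pact (br X`_l X`_i) (Uw s j))) => v3.
  move: (pact (br X`_l X`_i) (pact X`_k (Uw s j))) => v4.
  move: (pact X`_l (pact (br X`_k X`_i) (Uw s j))) => v5.
  move: (pact (br X`_k X`_i) (pact X`_l (Uw s j))) => v6.
  move: (pact X`_k (pact X`_i (pact X`_l (Uw s j)))) => v7.
  move: (pact X`_i (pact X`_k (pact X`_l (Uw s j)))) => v8.
  move: (pact X`_l (pact X`_i (pact X`_k (Uw s j)))) => v9.
  move: (pact X`_i (pact X`_l (pact X`_k (Uw s j)))) => v10.
  move=> h2 h2' h3 h3' h5; apply: coef_inj => q.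
  have cD x y : coef q (x + y) = coef q x + coef q y by exact: linD (coef_linear q) x y.
  have cN x : coef q (- x) = - coef q x by exact: linN (coef_linear q) x.
  have cZ a x : coef q (a *: x) = a * coef q x by exact: linZ (coef_linear q) a x.
  move: h2 h2' h3 h3' h5 => /(congr1 (coef q)) + /(congr1 (coef q)) +
    /(congr1 (coef q)) + /(congr1 (coef q)) + /(congr1 (coef q)).
  rewrite !(cD, cN, cZ).
  move: (coef q v0) (coef q v1) (coef q v2) (coef q v3) (coef q v4) (coef q v5)
    (coef q v6) (coef q v7) (coef q v8) (coef q v9) (coef q v10).
  clear => w0 w1 w2 w3 w4 w5 w6 w7 w8 w9 w10 e2 e2' e3 e3' e5.
  have {e5}-> : w0 = w1 + (-1) ^+ ((par k (+) par l) && par i) *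
    (w8 - (-1) ^+ (par k && par l) * w10) by rewrite e5 subrK.
  have {e2}-> : w3 = w1 + (-1) ^+ (par k && par l) * w2 +
    (-1) ^+ (par k && (par l (+) par i)) * w4 by rewrite e2 subrK.
  have {e2'}-> : w5 = w2 + (-1) ^+ (par l && (par k (+) par i)) * w6 by rewrite e2' subrK.
  have {e3}-> : w7 = w6 + (-1) ^+ (par k && par i) * w8 by rewrite e3 subrK.
  have {e3'}-> : w9 = w4 + (-1) ^+ (par l && par i) * w10 by rewrite e3' subrK.
  by case: (par k); case: (par l); case: (par i); rewrite /= ?expr0 ?expr1; ring.
have {ipl} pi : par i by move: ipl; rewrite e eqxx.
subst l.
have xi := parX iN; rewrite pi in xi.
have ii0 := br_part HA xi xi.
(* For odd i the law for the pair i, i determines the square of X_i, by division by 2. *)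
have sqb : forall u, supp_on (below i s) u ->
    pact X`_i (pact X`_i u) = 2%:R^-1 *: pact (br X`_i X`_i) u.
  have lawii q : law true true X`_i X`_i q ->
      pact X`_i (pact X`_i q) = 2%:R^-1 *: pact (br X`_i X`_i) q.
    rewrite /law /= expr1 scaleN1r opprK => h.
    exact: half_half (esym h).
  move=> u tb; apply: lawii; move: u tb; apply: supp_on_ind; first exact: subspace_law.
  move=> [q j'] /= [okq [qs|oki]].
    by have := IH q j' i i; rewrite pi; apply=> //; apply: leq_ltn_trans qs _.
  by have := law_prepend j' oki (leqnn i) iN; rewrite pi.
have sqs := pact_square j pi oks.
have Us := pact_prepend j oks.
move: lk; rewrite leq_eqVlt => /orP[/eqP <-|ik].
  (* For k = l = i both sides reduce to products of X_i and [X_i, X_i] on s, which commute by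
     [br_odd_self]. *)
  rewrite /law /= pi /= expr1 scaleN1r opprK sqs (linZ (pact_linr _)) -scalerDl.
  have -> : 2%:R^-1 + 2%:R^-1 = 1 :> K.
    by apply/(mulfI ch2); rewrite mulrDr mulfV // mulr1.
  rewrite scale1r -Us; have := IHt _ _ _ _ ii0 xi; rewrite /law /= expr0 scale1r.
  rewrite (brC HA ii0 xi) (br_odd_self HA ch3 xi) /= scaler0 oppr0 (lin0 (pact_linl _)).
  by move=> /esym/eqP; rewrite subr_eq0 => /eqP.
have pk := parX kn.
have h1 := IHt _ _ _ _ pk ii0.
have h2 := pact_straighten j oks ik kn.
have h3 : pact X`_i (pact X`_i (pact X`_k (Uw s j))) =
    2%:R^-1 *: pact (br X`_i X`_i) (pact X`_k (Uw s j)).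
  by apply: sqb; rewrite pactX // oks'; apply: G_below.
have h4 := IHt _ _ _ _ xi (br_part HA pk xi).
have h5 := br_jacobi HA X`_i pk xi.
have h6 := brC HA (br_part HA pk xi) xi.
rewrite -Us in sqs h2 *.
move: h1 h4; rewrite /law /= h5 h6 andbF.
rewrite !(linD (pact_linl _), linN (pact_linl _), linZ (pact_linl _)) => h1 h4.
rewrite pi sqs h2 !(linD (pact_linr _)) !(linZ (pact_linr _)) h3.
move: h1 h4; rewrite pi.
move: (pact (br X`_i (br X`_k X`_i)) (Uw s j)) => v1.
move: (pact X`_k (pact (br X`_i X`_i) (Uw s j))) => v2.
move: (pact (br X`_i X`_i) (pact X`_k (Uw s j))) => v3.
move: (pact X`_i (pact (br X`_k X`_i) (Uw s j))) => v4.
move: (pact (br X`_k X`_i) (pact X`_i (Uw s j))) => v5.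
move=> h1 h4; apply: coef_inj => q.
have cD u v : coef q (u + v) = coef q u + coef q v by exact: linD (coef_linear q) u v.
have cN u : coef q (- u) = - coef q u by exact: linN (coef_linear q) u.
have cZ c u : coef q (c *: u) = c * coef q u by exact: linZ (coef_linear q) c u.
move: h1 h4 => /(congr1 (coef q)) + /(congr1 (coef q)); rewrite !(cD, cN, cZ).
move: (coef q v1) (coef q v2) (coef q v3) (coef q v4) (coef q v5).
move=> w1 w2 w3 w4 w5 e1 e4.
have {e1}-> : w2 = - ((-1) ^+ ((par k (+) true) && true) * w1) +
    (-1) ^+ (par k && true) * w1 + (-1) ^+ false * w3 by rewrite e1 subrK.
have {e4}-> : w4 = w1 + (-1) ^+ (par k (+) true) * w5 by rewrite e4 subrK.
by case: (par k); rewrite /= ?expr0 ?expr1; field.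
Qed.

Lemma pact_is_module : is_module pact.
Proof.
split; first by split=> [t|a]; [exact: pact_linl | exact: pact_linr].
by move=> a b x y t xa yb; apply: pact_law.
Qed.

Lemma pact_wact s j : okw s -> wact pact [seq X`_i | i <- s] (Uw [::] j) = Uw s j.
Proof.
by elim: s => //= i s IH oks; have [_ oks'] := okw_lt oks; rewrite IH // pact_prepend.
Qed.

End PBW.

Section Subalgebra.
Variables (K : fieldType) (A : superalg K) (B : {vspace A}).

Lemma sub_partE a (x : sub B) : (x \in part (sub B) a) = (vsval x \in part A a).
Proof. by rewrite -memv_preim lfunE. Qed.

Lemma sub_brE (x y : sub B) : br (vsval x) (vsval y) \in B ->
  vsval (br x y : sub B) = br (vsval x) (vsval y).
Proof. by move=> h; rewrite /= vsprojK. Qed.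

End Subalgebra.

Section PBWInduced.
Variables (K : fieldType) (A : superalg K).
Hypothesis HA : lie_superalgebra A.
Hypotheses (ch2 : 2%:R != 0 :> K) (ch3 : 3%:R != 0 :> K).
Variables (nn n0 d : nat) (X : nn.-tuple A) (par : nat -> bool) (B : {vspace A}).
Hypothesis bX : basis_of fullv X.
Hypothesis le_n0 : (n0 <= nn)%N.
Hypothesis parX : forall k, (k < nn)%N -> X`_k \in part A (par k).
Hypothesis BX : forall k, (n0 <= k < nn)%N -> X`_k \in B.
Hypothesis BE : forall b, b \in B -> forall k : 'I_nn, (k < n0)%N -> coord X k b = 0.
Hypothesis Bbr : forall x y, x \in B -> y \in B -> br x y \in B.
Variables (N : lmodType K) (nu : 'I_d -> N) (co : 'I_d -> N -> K).
Hypothesis co_lin : forall j, linear (co j : N -> K^o).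
Hypothesis coE : forall n, n = \sum_j co j n *: nu j.
Hypothesis co_nu : forall i j, co i (nu j) = (i == j)%:R.
Variable act : sub B -> N -> N.
Hypothesis act_mod : is_module act.
Local Notation Ind := (ind (fun x : sub B => vsval x) act).
Local Notation P := {malg K[(seq nat * 'I_d)%type]}.

(** The universal property, applied to the module of words, gives a map sending the ordered words on
    a basis of N to distinct basis vectors. Hence they are linearly independent in the induced
    module. *)
Lemma pbw_independent : exists Theta : Ind -> P, linear Theta /\
  forall s j, okw n0 par s ->
    Theta (wact (@ind_act _ _ _ _ _ _ : A -> Ind -> Ind) [seq X`_i | i <- s]
       (indt (fun x : sub B => vsval x) act 1 (nu j))) = mkmalgU (s, j) 1.
Proof.
pose actN (x : A) n := act (vsproj B x) n.
have actN_lin : bilinear_op actN.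
  split=> [n a x y|x]; last exact: act_mod.1.2.
  by rewrite /actN linearP act_mod.1.1.
have actN_br a b x y n : x \in part A a -> y \in part A b -> x \in B -> y \in B ->
    actN (br x y) n = actN x (actN y n) - (-1) ^+ (a && b) *: actN y (actN x n).
  move=> xa yb xB yB; rewrite /actN.
  have -> : vsproj B (br x y) = @br _ (sub B) (vsproj B x) (vsproj B y) by rewrite /= !vsprojK.
  by apply: act_mod.2; rewrite sub_partE vsprojK.
pose U s j : P := mkmalgU (s, j) 1.
pose ext (h : seq nat * 'I_d -> P) (t : P) := lext h t.
pose coef q (t : P) : K := mcoeff q t.
have extL h : linear (ext h) by exact: lext_linear.
have extU h s j : ext h (U s j) = h (s, j) by exact: lextU.
have Uspan (S : set P) : subspace S -> (forall s j, S (U s j)) -> forall t, S t.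
  by move=> sS SU t; apply: malg_span => // -[s j]; exact: SU.
have coefL q : linear (coef q : P -> K^o).
  by move=> a u v; rewrite /coef mcoeffD mcoeffZ.
have coefI t t' : (forall q, coef q t = coef q t') -> t = t'.
  by move=> h; apply/malgP.
have modP := pact_is_module HA ch2 ch3 bX le_n0 parX BX BE Bbr co_lin coE co_nu
  actN_lin actN_br extL extU Uspan coefL coefI.
pose tau := emb co U.
have tauB b n : tau (act b n) = pact n0 X par nu co actN U ext (vsval b) (tau n).
  by rewrite (pact_emb par bX BE) ?subvsP // /tau /actN vsvalK.
have [Psi [lPsi Psi1 PsiA]] :=
  ind_lift_ex (phi := fun x : sub B => vsval x) modP (emb_lin co_lin U) tauB.
exists Psi; split=> // s j oks.
rewrite -[RHS]/(U s j) -(pact_wact bX le_n0 nu co actN extL extU Uspan _ oks).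
elim: {oks} [seq _ | _ <- _] => [|x w IH] /=; last by rewrite PsiA IH.
by rewrite Psi1 /tau emb_nu.
Qed.

End PBWInduced.

(** * Straightening of even words *)

Section Reordering.
Variables (K : fieldType) (M : lmodType K) (T : eqType) (e : T -> M -> M).
Hypothesis e_lin : forall t, linear (e t).
Variable Gf : nat -> set M.
Hypothesis Gf_sub : forall m, subspace (Gf m).
Hypothesis e_Gf : forall t m w, Gf m w -> Gf m.+1 (e t w).
Variable c : T -> T -> K.
Hypothesis e_comm : forall a b m w, Gf m w -> Gf m.+1 (e a (e b w) - c a b *: e b (e a w)).

(** Degree less than m, with 0 in place of degree -1. The reordering serves twice: with c = 1 for
    even letters graded by word length, and with c = -1 for odd letters graded by odd degree. In
    both cases exchanging two letters costs terms of lower degree. *)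
Definition shiftf (m : nat) : set M := if m is m'.+1 then Gf m' else [set 0].

Lemma foldr_Gf s v : Gf 0 v -> Gf (size s) (foldr e v s).
Proof. by move=> v0; elim: s => //= t s; exact: e_Gf. Qed.

Lemma reorder_front u x w v : Gf 0 v -> exists a,
  Gf (size (u ++ w)) (foldr e v (x :: u ++ w) - a *: foldr e v (u ++ x :: w)).
Proof.
move=> v0; elim: u => [|y u [a IH]] /=.
  by exists 1; rewrite scale1r subrr; exact: sub0.
exists (c x y * a); set F := foldr e v.
have -> : e x (e y (F (u ++ w))) - c x y * a *: e y (F (u ++ x :: w)) =
    (e x (e y (F (u ++ w))) - c x y *: e y (e x (F (u ++ w)))) +
    c x y *: e y (F (x :: u ++ w) - a *: F (u ++ x :: w)).
  rewrite (linB (e_lin y)) (linZ (e_lin y)) scalerBr scalerA addrA.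
  by rewrite subrK.
apply: subD => //; first by apply/e_comm/foldr_Gf.
by apply: subZ => //; apply: e_Gf.
Qed.

Lemma reorder s s' v : Gf 0 v -> perm_eq s s' -> exists a,
  shiftf (size s) (foldr e v s - a *: foldr e v s').
Proof.
move=> v0; elim: s s' => [|x t IH] s' pss'.
  have /perm_size/esym/size0nil -> := pss'.
  by exists 1; rewrite scale1r subrr.
have xs' : x \in s' by rewrite -(perm_mem pss') mem_head.
have [u [w es']] : exists u w, s' = u ++ x :: w.
  by case/splitPr: xs' => u w; exists u, w.
move=> {xs'}; have ptuw : perm_eq t (u ++ w).
  by rewrite -(perm_cons x) (perm_trans pss') // es' perm_catC /= perm_cons perm_catC.
have [a Ha] := IH _ ptuw; have [b Hb] := reorder_front u x w v0.
exists (a * b); rewrite es' /=; set F := foldr e v.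
have -> : e x (F t) - a * b *: F (u ++ x :: w) =
    e x (F t - a *: F (u ++ w)) + a *: (F (x :: u ++ w) - b *: F (u ++ x :: w)).
  by rewrite (linB (e_lin x)) (linZ (e_lin x)) scalerBr scalerA addrA subrK.
apply: subD => //; last by apply: subZ => //; rewrite (perm_size ptuw).
case: t Ha {IH pss' ptuw} => [|y t] /=; last exact: e_Gf.
move=> ->; rewrite (lin0 (e_lin x)); exact: sub0.
Qed.

(** A repeated letter is moved next to its copy, and its square counts for one degree instead of
    two. *)
Lemma reorder_dup s v : Gf 0 v -> ~~ uniq s ->
  (forall a m w, a \in s -> Gf m w -> Gf m.+1 (e a (e a w))) ->
  shiftf (size s) (foldr e v s).
Proof.
move=> v0; elim: s => //= x t IH; rewrite negb_and negbK => h sq.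
have sqt a m w : a \in t -> Gf m w -> Gf m.+1 (e a (e a w)).
  by move=> ha; apply: sq; rewrite inE ha orbT.
case/orP: h => [xt|nut].
  have pt := perm_to_rem xt; have [a Ha] := reorder v0 pt.
  set F := foldr e v.
  have -> : e x (F t) = e x (F t - a *: F (x :: rem x t)) + a *: e x (e x (F (rem x t))).
    by rewrite (linB (e_lin x)) (linZ (e_lin x)) subrK.
  rewrite (perm_size pt) /= in Ha *.
  apply: subD => //; first exact: e_Gf.
  by apply: subZ => //; apply/sq/foldr_Gf; rewrite ?mem_head.
have := IH nut sqt; case: t nut {IH sqt sq} => //= y t _.
exact: e_Gf.
Qed.

End Reordering.

Section Straightening.
Variables (K : fieldType) (A : superalg K) (M : lmodType K) (aM : A -> M -> M).
Hypothesis modM : is_module aM.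
Variables (G0 : {vspace A}) (e : nat -> A) (nx : nat) (P0 : set A).
Hypothesis G0even : (G0 <= part A false)%VS.
Hypothesis G0br : forall x y, x \in G0 -> y \in G0 -> br x y \in G0.
Hypothesis P0G0 : forall x, P0 x -> x \in G0.
Hypothesis eG0 : forall i, (i < nx)%N -> e i \in G0.
Hypothesis decG0 : forall x, x \in G0 -> exists (c : nat -> K) b,
  P0 b /\ x = \sum_(i < nx) c i *: e i + b.

Definition xword s := sorted leq s && all (fun i => i < nx)%N s.

Lemma aM_comm x y w : x \in G0 -> y \in G0 ->
  aM x (aM y w) = aM y (aM x w) + aM (br x y) w.
Proof.
move=> /(subvP G0even) x0 /(subvP G0even) y0; rewrite (modM.2 _ _ _ _ _ x0 y0).
by rewrite expr0 scale1r addrC subrK.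
Qed.

Definition xspan (E : set M) : set M := lspan [set m | exists s v,
  [/\ xword s, E v & m = foldr (fun i => aM (e i)) v s]].

Variables (E W : set M).
Hypothesis sW : subspace W.
Hypothesis W_stable : forall x w, x \in G0 -> W w -> W (aM x w).
Hypothesis P0_E : forall b v, P0 b -> E v -> sadd E W (aM b v).

Definition gfilt (m : nat) : set M := sadd (lspan [set u | exists w v,
  [/\ all (fun x => x \in G0) w, (size w <= m)%N, E v & u = wact aM w v]]) W.

Lemma gfilt_sub m : subspace (gfilt m).
Proof. by apply: subspace_sadd => //; exact: subspace_lspan. Qed.

Lemma gfilt_word m w v : all (fun x => x \in G0) w -> (size w <= m)%N -> E v ->
  gfilt m (wact aM w v).
Proof. by move=> wG wm Ev; apply: saddl => //; apply: sub_lspan; exists w, v. Qed.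

Lemma gfilt_W m : W `<=` gfilt m.
Proof. by apply: saddr; exact: subspace_lspan. Qed.

Lemma gfilt_ind m (S : set M) : subspace S -> W `<=` S ->
  (forall w v, all (fun x => x \in G0) w -> (size w <= m)%N -> E v -> S (wact aM w v)) ->
  gfilt m `<=` S.
Proof.
move=> sS WS H _ [u [w [hu /WS Sw ->]]]; apply: subD => //.
by apply: lspan_le hu => // _ [w' [v [h1 h2 h3 ->]]]; exact: H.
Qed.

Lemma gfilt_act x m u : x \in G0 -> gfilt m u -> gfilt m.+1 (aM x u).
Proof.
move=> xG; apply: (gfilt_ind (S := aM x @^-1` gfilt m.+1)).
- by apply: subspace_preim; [exact: modM.1.2 | exact: gfilt_sub].
- by move=> w /(W_stable xG); exact: gfilt_W.
- by move=> w v wG wm Ev; apply: (gfilt_word (w := x :: w)) => //=; rewrite xG.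
Qed.

(** Moving b to the right past a letter x leaves the commutator [b, x], a single letter of G0 in
    place of x, and at the end [P0_E] absorbs b. The length therefore does not grow. *)
Lemma gfilt_P0 b m u : P0 b -> gfilt m u -> gfilt m (aM b u).
Proof.
move=> Pb; apply: (gfilt_ind (S := aM b @^-1` gfilt m)).
- by apply: subspace_preim; [exact: modM.1.2 | exact: gfilt_sub].
- by move=> w /(W_stable (P0G0 Pb)); exact: gfilt_W.
elim: m => [|m IH] [|x w] v //=.
- move=> _ _ Ev; have [e' [w' [Ee' Ww' ->]]] := P0_E Pb Ev.
  by apply: (subD (gfilt_sub _)); [exact: (gfilt_word (w := [::])) | exact: gfilt_W].
- move=> _ _ Ev; have [e' [w' [Ee' Ww' ->]]] := P0_E Pb Ev.
  by apply: (subD (gfilt_sub _)); [exact: (gfilt_word (w := [::])) | exact: gfilt_W].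
move=> /andP[xG wG] wm Ev; rewrite /= (aM_comm _ (P0G0 Pb) xG); apply: (subD (gfilt_sub _)).
- by apply: gfilt_act => //; apply: IH.
- by apply: (gfilt_word (w := br b x :: w)) => //=; rewrite wG (G0br (P0G0 Pb) xG).
Qed.

(** Each letter splits by [decG0] into a combination of the e_i and an element of P0, which does not
    raise the length. The words in the e_i are then sorted; commutators are shorter words, but with
    letters in G0, so the argument recurs on the length. *)
Lemma straighten m : gfilt m `<=` sadd (xspan E) W.
Proof.
have sS : subspace (sadd (xspan E) W).
  by apply: subspace_sadd => //; exact: subspace_lspan.
pose F s v := foldr (fun i => aM (e i)) v s.
pose H m := sadd (lspan [set u | exists s v,
  [/\ all (fun i => i < nx)%N s, (size s <= m)%N, E v & u = F s v]]) W.
have sH k : subspace (H k) by apply: subspace_sadd => //; exact: subspace_lspan.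
have GH k : gfilt k `<=` H k.
  elim: k => [|k IH].
    apply: gfilt_ind => //; first by apply: saddr; exact: subspace_lspan.
    move=> [|//] v _ _ Ev; apply: saddl => //; apply: sub_lspan.
    by exists [::], v.
  apply: gfilt_ind => //; first by apply: saddr; exact: subspace_lspan.
  have HS : H k `<=` H k.+1.
    move=> _ [u [w [hu Ww ->]]]; exists u, w; split=> //.
    apply: lspan_mono hu => _ [s [v [h1 h2 h3 ->]]]; exists s, v; split=> //.
    exact: leqW.
  move=> [|x w] v.
    by move=> _ _ Ev; apply/HS/IH; apply: (gfilt_word (w := [::])).
  move=> /= /andP[xG wG] wk Ev; have [c [b [Pb ->]]] := decG0 xG.
  have gw : gfilt k (wact aM w v) by exact: gfilt_word.
  rewrite (linD (modM.1.1 _)); apply: subD => //; last first.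
    by apply/HS/IH/gfilt_P0.
  rewrite (lin_sum _ _ _ (modM.1.1 _)); apply: sub_bigsum => // i _.
  rewrite (linZ (modM.1.1 _)); apply: subZ => //.
  have [u [w' [hu Ww' ->]]] := IH _ gw.
  rewrite (linD (modM.1.2 _)); apply: subD => //; last first.
    by apply: saddr; [exact: subspace_lspan | apply: W_stable => //; exact: eG0].
  apply: saddl => //; apply: lspan_map hu; first exact: modM.1.2.
  move=> _ [s [v' [h1 h2 h3 ->]]]; apply: sub_lspan; exists (nat_of_ord i :: s), v'.
  by split=> //=; rewrite ltn_ord.
have nxG (i : 'I_nx) : e i \in G0 by exact: eG0.
suff HX k : H k `<=` sadd (xspan E) W by move=> u /GH /HX.
have sx s v : E v -> all (fun i => i < nx)%N s -> (size s <= k)%N -> sadd (xspan E) W (F s v).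
  elim: k s v => [|k IH] s v Ev sn sk.
    apply: saddl => //; apply: sub_lspan; exists s, v; split=> //.
    by move: sk; rewrite leqn0 => /nilP ->.
  (* Letters out of range act by 0, because [reorder] has its hypotheses on all letters. *)
  pose e' i := if (i < nx)%N then aM (e i) else fun=> 0.
  have e'lin i : linear (e' i).
    by rewrite /e'; case: ifP => // _; [exact: modM.1.2 | move=> a x y; rewrite scaler0 addr0].
  have e'act i n u : gfilt n u -> gfilt n.+1 (e' i u).
    rewrite /e'; case: ifP => [iN|_ _]; last exact: sub0 (gfilt_sub _).
    by apply: gfilt_act; exact: eG0.
  have e'comm i j n u : gfilt n u -> gfilt n.+1 (e' i (e' j u) - 1 *: e' j (e' i u)).
    move=> gu; rewrite scale1r /e'; case: ifP => iN; case: ifP => jN;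
      rewrite ?(lin0 (modM.1.2 _)) ?subrr; try exact: sub0 (gfilt_sub _).
    rewrite aM_comm ?eG0 // addrAC subrr add0r.
    by apply: gfilt_act => //; rewrite G0br ?eG0.
  have e'E t : all (fun i => i < nx)%N t -> foldr e' v t = F t v.
    by elim: t => //= i t IHt /andP[iN tN]; rewrite IHt // /e' iN.
  have v0 : gfilt 0 v by exact: (gfilt_word (w := [::])).
  have ps : perm_eq s (sort leq s) by rewrite perm_sym perm_sort.
  have [a Ha] := reorder e'lin gfilt_sub e'act e'comm v0 ps.
  have ssn : all (fun i => i < nx)%N (sort leq s) by rewrite -(perm_all _ ps).
  rewrite -(subrK (a *: F (sort leq s) v) (F s v)); apply: (subD sS); last first.
    apply: (subZ sS); apply: saddl => //; apply: sub_lspan; exists (sort leq s), v.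
    by split=> //; rewrite /xword ssn sort_sorted //; exact: leq_total.
  move: Ha; rewrite !e'E // => Ha; case: (size s) sk Ha => [_ ->|n nk /GH].
    exact: sub0.
  move=> [u [w [hu Ww ->]]]; apply: (subD sS); last first.
    by apply: saddr => //; exact: subspace_lspan.
  apply: (lspan_le sS) hu => _ [t [v' [h1 h2 h3 ->]]].
  by apply: IH => //; apply: leq_trans h2 _.
move=> _ [u [w [hu Ww ->]]]; apply: (subD sS); last first.
  by apply: saddr => //; exact: subspace_lspan.
by apply: (lspan_le sS) hu => _ [t [v' [h1 h2 h3 ->]]]; exact: sx.
Qed.

Lemma xspan_stable x u : x \in G0 -> sadd (xspan E) W u -> sadd (xspan E) W (aM x u).
Proof.
move=> xG [u1 [w [hu Ww ->]]].
have sS : subspace (sadd (xspan E) W).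
  by apply: subspace_sadd => //; exact: subspace_lspan.
rewrite (linD (modM.1.2 _)); apply: (subD sS); last first.
  by apply: saddr; [exact: subspace_lspan | exact: W_stable].
apply: (lspan_le (subspace_preim (modM.1.2 x) sS)) hu => _ [s [v [/andP[_ sn] Ev ->]]] /=.
apply: (straighten (m := (size s).+1)); apply: gfilt_act => //.
rewrite (_ : foldr _ _ _ = wact aM (map e s) v).
  by apply: gfilt_word; rewrite ?size_map // all_map; apply: sub_all sn => i; exact: eG0.
by elim: s {sn} => //= i s ->.
Qed.

End Straightening.

(** * Subspaces of the coordinate space and the submodules that they generate *)

Section SpanOfSpace.
Variables (K : fieldType) (A : superalg K) (M : lmodType K) (aM : A -> M -> M).
Hypothesis modM : is_module aM.
Variables (G0 : {vspace A}) (e : nat -> A) (nx : nat) (P0 : set A).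
Hypothesis G0even : (G0 <= part A false)%VS.
Hypothesis G0br : forall x y, x \in G0 -> y \in G0 -> br x y \in G0.
Hypothesis P0G0 : forall x, P0 x -> x \in G0.
Hypothesis eG0 : forall i, (i < nx)%N -> e i \in G0.
Hypothesis decG0 : forall x, x \in G0 -> exists (c : nat -> K) b,
  P0 b /\ x = \sum_(i < nx) c i *: e i + b.
Variables (V : vectType K) (iota : V -> M).
Hypothesis iota_lin : linear iota.
Implicit Type U : {vspace V}.

(* This is U(G0) iota(U) if U is reached from 0 by adjacent steps: [adjacent_stable]. *)
Definition wspan U : set M := xspan aM e nx (iota @` [set` U]).

Lemma wspan_sub U : subspace (wspan U). Proof. exact: subspace_lspan. Qed.

Lemma wspan_word U s v : xword nx s -> v \in U -> wspan U (foldr (fun i => aM (e i)) (iota v) s).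
Proof.
by move=> xs vU; apply: sub_lspan; exists s, (iota v); split=> //; exists v.
Qed.

Lemma wspan_iota U v : v \in U -> wspan U (iota v).
Proof. exact: (wspan_word (s := [::])). Qed.

Lemma wspan_ind U (S : set M) : subspace S ->
  (forall s v, xword nx s -> v \in U -> S (foldr (fun i => aM (e i)) (iota v) s)) ->
  wspan U `<=` S.
Proof.
by move=> sS H; apply: lspan_le => // _ [s [_ [xs [v vU <-] ->]]]; exact: H.
Qed.

Lemma wspan_le U U' : (U <= U')%VS -> wspan U `<=` wspan U'.
Proof.
move=> /subvP le; apply: wspan_ind; first exact: wspan_sub.
by move=> s v xs /le; exact: wspan_word.
Qed.

Lemma wspan0 : wspan 0%VS = [set 0].
Proof.
apply/seteqP; split; last by move=> _ ->; exact: sub0 (wspan_sub _).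
apply: wspan_ind; first by split=> //= a u v -> ->; rewrite scaler0 addr0.
move=> s v _; rewrite memv0 => /eqP ->; rewrite (lin0 iota_lin).
by elim: s => //= i s ->; rewrite (lin0 (modM.1.2 _)).
Qed.

Lemma subspace_iota U : subspace (iota @` [set` U]).
Proof.
split=> [|a _ _ [u uU <-] [v vU <-]].
  by exists 0; [exact: mem0v | exact: (lin0 iota_lin)].
by exists (a *: u + v); [rewrite /= memvD ?memvZ | exact: iota_lin].
Qed.

(** The condition for P0 to act on U' / U: applied to the image of U', an element of P0 leaves it
    only by an error in [wspan U]. *)
Definition adjacent U U' := (U <= U')%VS /\
  forall b v, P0 b -> v \in U' -> sadd (iota @` [set` U']) (wspan U) (aM b (iota v)).

Definition wspan_stable U := forall x w, x \in G0 -> wspan U w -> wspan U (aM x w).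

Lemma wspan_stable0 : wspan_stable 0%VS.
Proof. by move=> x w _; rewrite wspan0 => ->; exact: lin0 (modM.1.2 x). Qed.

Lemma adjacent_stable U U' : wspan_stable U -> adjacent U U' -> wspan_stable U'.
Proof.
move=> FU [le adj] x w x0 Fw.
suff : sadd (wspan U') (wspan U) (aM x w).
  by move=> [u [v [Fu /(wspan_le le) Fv ->]]]; apply: (subD (wspan_sub _)).
apply: (xspan_stable modM G0even G0br P0G0 eG0 decG0) => //.
- exact: wspan_sub.
- by move=> b _ Pb [v vU' <-]; exact: adj.
- by apply: saddl => //; exact: wspan_sub.
Qed.

(** This encodes that U' / U is a simple P0-module: its submodules correspond to the intermediate G
    with [adjacent U G]. *)
Definition simple_step U U' := [/\ adjacent U U', U != U'
  & forall G, (U <= G)%VS -> (G <= U')%VS -> adjacent U G -> G = U \/ G = U'].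

Fixpoint chain (R : {vspace V} -> {vspace V} -> Prop) U s : Prop :=
  if s is U' :: s' then R U U' /\ chain R U' s' else True.

Lemma chain_cat R U s s' : chain R U s -> chain R (last U s) s' -> chain R U (s ++ s').
Proof. by elim: s U => //= U' s IH U [RU cs] cs'; split=> //; exact: IH. Qed.

(** A composition series, by induction on the difference of dimensions. An intermediate G is again
    adjacent to U', since a larger lower space only allows a larger error. *)
Lemma refine_adjacent U U' : adjacent U U' ->
  exists s, chain simple_step U s /\ last U s = U'.
Proof.
have [n] := ubnP (\dim U' - \dim U)%N; elim: n U U' => // n IH U U' /[!ltnS] dn adj.
have [->|neU] := eqVneq U U'; first by exists [::].
have [[G [UG GU' aUG /eqP GneU /eqP GneU']]|noG] := pselect (exists G,
    [/\ (U <= G)%VS, (G <= U')%VS, adjacent U G, G <> U & G <> U']); last first.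
  exists [:: U']; do ![split=> //]; move=> G UG GU' aUG.
  apply: contrapT => /not_orP[h1 h2]; apply: noG; by exists G.
have aGU' : adjacent G U'.
  split=> // b v Pb vU'; have [u [w [hu /(wspan_le UG) hw ->]]] := adj.2 b v Pb vU'.
  by exists u, w.
have dUG : (\dim U < \dim G)%N.
  rewrite ltn_neqAle dimvS // andbT; apply: contra GneU => /eqP e'.
  by rewrite eq_sym eqEdim UG e' leqnn.
have dGU' : (\dim G < \dim U')%N.
  rewrite ltn_neqAle dimvS // andbT; apply: contra GneU' => /eqP e'.
  by rewrite eqEdim GU' e' leqnn.
have [|s [cs ls]] := IH U G _ aUG.
  by apply: leq_trans dn; rewrite ltn_sub2r // (ltn_trans dUG).
have [|s' [cs' ls']] := IH G U' _ aGU'.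
  by apply: leq_trans dn; rewrite ltn_sub2l // (ltn_trans dUG).
exists (s ++ s'); split; last by rewrite last_cat ls.
by apply: chain_cat => //; rewrite ls.
Qed.

End SpanOfSpace.

(** * The filtration by odd degree *)

Section OddFiltration.
Variables (K : fieldType) (A : superalg K) (M : lmodType K) (aM : A -> M -> M).
Hypothesis HA : lie_superalgebra A.
Hypothesis ch2 : 2%:R != 0 :> K.
Hypothesis modM : is_module aM.
Local Notation g0 := (part A false).
Local Notation g1 := (part A true).
Variables (P : {vspace A}) (e : nat -> A) (nx n0 d : nat) (nu : 'I_d -> M) (L0 : set M).
Hypothesis e0 : forall i, (i < nx)%N -> e i \in g0.
Hypothesis e1 : forall i, (nx <= i < n0)%N -> e i \in g1.
Hypothesis dec0 : forall x, x \in g0 -> exists (c : nat -> K) b,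
  b \in (P :&: g0)%VS /\ x = \sum_(i < nx) c i *: e i + b.
Hypothesis dec1 : forall x, x \in g1 -> exists (c : nat -> K) b,
  (b \in P /\ b \in g1) /\ x = \sum_(nx <= i < n0) c i *: e i + b.
Hypothesis L0P : forall b n, b \in P -> L0 n -> L0 (aM b n).
Hypothesis L0nu : forall j, L0 (nu j).
Hypothesis L0dec : forall n, L0 n -> exists c : 'I_d -> K, n = \sum_j c j *: nu j.
Hypothesis L0gen : forall S : set M, subspace S -> L0 `<=` S ->
  (forall x w, S w -> S (aM x w)) -> forall w, S w.

Let linl := modM.1.1.
Let linr := modM.1.2.

Lemma aM_super a b x y w : x \in part A a -> y \in part A b ->
  aM x (aM y w) = (-1) ^+ (a && b) *: aM y (aM x w) + aM (br x y) w.
Proof. by move=> xa yb; rewrite (modM.2 _ _ _ _ _ xa yb) addrC subrK. Qed.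

(** The letters run over all of g1 and not only over a complement of P, so that brackets with even
    elements stay inside. *)
Definition odd_words (m : nat) : set M := lspan [set u | exists w n,
  [/\ all (fun z => z \in g1) w, (size w <= m)%N, L0 n & u = wact aM w n]].

Lemma odd_words_sub m : subspace (odd_words m). Proof. exact: subspace_lspan. Qed.

Lemma odd_words_word m w n : all (fun z => z \in g1) w -> (size w <= m)%N -> L0 n ->
  odd_words m (wact aM w n).
Proof. by move=> h1 h2 h3; apply: sub_lspan; exists w, n. Qed.

Lemma odd_words_ind m (S : set M) : subspace S ->
  (forall w n, all (fun z => z \in g1) w -> (size w <= m)%N -> L0 n -> S (wact aM w n)) ->
  odd_words m `<=` S.
Proof. by move=> sS H; apply: lspan_le => // _ [w [n [h1 h2 h3 ->]]]; exact: H. Qed.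

Lemma odd_words_le m m' : (m <= m')%N -> odd_words m `<=` odd_words m'.
Proof.
move=> mm'; apply: odd_words_ind; first exact: odd_words_sub.
by move=> w n h1 h2 h3; apply: odd_words_word => //; apply: leq_trans mm'.
Qed.

Lemma odd_words_odd z m w : z \in g1 -> odd_words m w -> odd_words m.+1 (aM z w).
Proof.
move=> z1; apply: (odd_words_ind (S := aM z @^-1` odd_words m.+1)).
  by apply: subspace_preim; [exact: linr | exact: odd_words_sub].
by move=> u n h1 h2 h3; apply: (odd_words_word (w := z :: u)) => //=; rewrite z1.
Qed.

Lemma odd_words_P0 b m w : b \in P -> b \in g0 -> odd_words m w -> odd_words m (aM b w).
Proof.
move=> bP b0; apply: (odd_words_ind (S := aM b @^-1` odd_words m)).
  by apply: subspace_preim; [exact: linr | exact: odd_words_sub].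
elim: m => [|m IH] [|z u] n //= h1 h2 h3.
- by apply: (odd_words_word (w := [::])) => //; exact: L0P.
- by apply: (odd_words_word (w := [::])) => //; exact: L0P.
case/andP: h1 => z1 u1; rewrite /preimage /= (aM_super _ b0 z1) /= expr0 scale1r.
apply: (subD (odd_words_sub _)); first by apply: odd_words_odd => //; exact: IH.
apply: (odd_words_word (w := br b z :: u)) => //=; rewrite u1 andbT.
exact: (br_part HA b0 z1).
Qed.

Definition filt (m : nat) : set M := lspan [set w | exists u v,
  [/\ all (fun x => x \in g0) u, odd_words m v & w = wact aM u v]].

Lemma filt_sub m : subspace (filt m). Proof. exact: subspace_lspan. Qed.

Lemma filt_word m u v : all (fun x => x \in g0) u -> odd_words m v -> filt m (wact aM u v).
Proof. by move=> h1 h2; apply: sub_lspan; exists u, v. Qed.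

Lemma filt_ind m (S : set M) : subspace S -> odd_words m `<=` S ->
  (forall x w, x \in g0 -> S w -> S (aM x w)) -> filt m `<=` S.
Proof.
move=> sS LS HS; apply: lspan_le => // _ [u [v [h1 h2 ->]]].
elim: u h1 => [_|x u IH /= /andP[x0 u0]]; first exact: LS.
by apply: HS => //; exact: IH.
Qed.

Lemma odd_words_filt m : odd_words m `<=` filt m.
Proof. by move=> v; exact: (filt_word (u := [::])). Qed.

Lemma filt_even m x w : x \in g0 -> filt m w -> filt m (aM x w).
Proof.
move=> x0; apply: (lspan_le (S := aM x @^-1` filt m)).
  by apply: subspace_preim; [exact: linr | exact: filt_sub].
by move=> _ [u [v [h1 h2 ->]]]; apply: (filt_word (u := x :: u)) => //=; rewrite x0.
Qed.

Lemma filtS m : filt m `<=` filt m.+1.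
Proof.
apply: filt_ind; [exact: filt_sub | | by move=> x w; exact: filt_even].
by move=> w /(odd_words_le (leqnSn m)) /odd_words_filt.
Qed.

Lemma filt_odd z m w : z \in g1 -> filt m w -> filt m.+1 (aM z w).
Proof.
(* The claim is proved for all odd letters at once, because passing z over an even x also produces
   the odd letter [z, x]. *)
move=> z1 Gw; suff : filt m `<=` [set w | filt m w /\ forall z, z \in g1 -> filt m.+1 (aM z w)].
  by move/(_ w Gw) => /= [_]; exact.
apply: filt_ind.
- split=> [|a u v [Gu zu] [Gv zv]] /=.
    split=> [|y _]; first exact: sub0 (filt_sub _).
    by rewrite (lin0 (linr y)); exact: sub0 (filt_sub _).
  split=> [|y y1]; first exact: (filt_sub _).2.
  by rewrite (linr y); apply: (filt_sub _).2; [exact: zu | exact: zv].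
- move=> v Lv; split=> [|y y1]; first exact: odd_words_filt.
  by apply: odd_words_filt; exact: odd_words_odd.
move=> x v x0 /= [Gv zv]; split=> [|y y1]; first exact: filt_even.
rewrite (aM_super _ y1 x0) /= expr0 scale1r; apply: (subD (filt_sub _)).
  by apply: filt_even => //; exact: zv.
by apply: zv; exact: (br_part HA y1 x0).
Qed.

(** The anticommutator of two odd letters is the action of their bracket, which is even; exchanging
    them costs a term with two odd letters fewer. *)
Lemma filt_anti z z' m w : z \in g1 -> z' \in g1 -> filt m w ->
  filt m (aM z (aM z' w) - (-1) *: aM z' (aM z w)).
Proof.
move=> z1 z1' Gw; rewrite (aM_super _ z1 z1') /= expr1 addrAC subrr add0r.
by apply: filt_even => //; exact: (br_part HA z1 z1').
Qed.

Lemma filt_square z m w : z \in g1 -> filt m w -> filt m (aM z (aM z w)).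
Proof.
move=> z1 Gw; have := filt_anti z1 z1 Gw; rewrite scaleN1r opprK => h.
by rewrite [aM z _](half_half ch2 (erefl _)); apply: (subZ (filt_sub _)).
Qed.

(** Moving b to the right past an odd letter z leaves [b, z], which is even and absorbed by the even
    words of [filt]; what reaches the end is absorbed by L0. So odd elements of P do not raise the
    odd degree. *)
Lemma odd_words_P1 b m w : b \in P -> b \in g1 -> odd_words m w -> filt m (aM b w).
Proof.
move=> bP b1; apply: (odd_words_ind (S := aM b @^-1` filt m)).
  by apply: subspace_preim; [exact: linr | exact: filt_sub].
elim: m => [|m IH] [|z u] n //= h1 h2 h3.
- by apply: odd_words_filt; apply: (odd_words_word (w := [::])) => //; exact: L0P.
- by apply: odd_words_filt; apply: (odd_words_word (w := [::])) => //; exact: L0P.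
case/andP: h1 => z1 u1; rewrite /preimage /= (aM_super _ b1 z1) /=.
apply: (subD (filt_sub _)).
  by apply: (subZ (filt_sub _)); apply: filt_odd => //; exact: IH.
apply: filt_even; first exact: (br_part HA b1 z1).
by apply: odd_words_filt; apply: odd_words_word => //; exact: leqW.
Qed.

Lemma filt_top w : exists m, filt m w.
Proof.
apply: (L0gen (S := [set w | exists m, filt m w])).
- have filt_le m m' : (m <= m')%N -> filt m `<=` filt m'.
    move/subnK <-; elim: (m' - m)%N => [|k IH] // v /IH; exact: filtS.
  split=> [|a u v /= [m Gu] [m' Gv]]; first by exists 0; exact: sub0 (filt_sub _).
  exists (maxn m m'); apply: (filt_sub _).2; first exact: filt_le (leq_maxl _ _) _ Gu.
  exact: filt_le (leq_maxr _ _) _ Gv.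
- by move=> n Ln; exists 0; apply: odd_words_filt; apply: (odd_words_word (w := [::])).
move=> x v [m Gv] /=; have [x0 [x1 [h0 h1 ->]]] := part_dec HA x.
exists m.+1; rewrite (linD (linl v)); apply: (subD (filt_sub _)).
  by apply: filtS; exact: filt_even.
exact: filt_odd.
Qed.

Definition eact_word s v := foldr (fun i => aM (e i)) v s.

Definition yword s := sorted ltn s && all (fun i => nx <= i < n0)%N s.

(** An odd letter is a combination of the e_i plus an element of P, which contributes only to lower
    degree by [odd_words_P1]. The e_i anticommute up to lower degree and their squares drop in
    degree, which leaves the strictly increasing words. *)
Lemma odd_words_yspan m : odd_words m `<=`
  sadd (lspan [set u | exists s j, [/\ yword s, (size s <= m)%N & u = eact_word s (nu j)]])
       (shiftf filt m).
Proof.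
pose Y m := lspan [set u | exists s j, [/\ yword s, (size s <= m)%N & u = eact_word s (nu j)]].
rewrite -[lspan _]/(Y m).
have sY k : subspace (Y k) by exact: subspace_lspan.
have sG k : subspace (shiftf filt k).
  case: k => [|k]; last exact: filt_sub.
  by split=> //= a u v -> ->; rewrite scaler0 addr0.
have sYG k : subspace (sadd (Y k) (shiftf filt k)) by exact: subspace_sadd.
have YS k : Y k `<=` Y k.+1.
  apply: lspan_mono => _ [s [j [h1 h2 ->]]]; exists s, j; split=> //.
  exact: leqW.
have GS k : shiftf filt k `<=` shiftf filt k.+1.
  case: k => [|k] /=; last exact: filtS.
  by move=> _ ->; exact: sub0 (filt_sub _).
have YGS k : sadd (Y k) (shiftf filt k) `<=` sadd (Y k.+1) (shiftf filt k.+1).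
  by move=> _ [u [w [/YS hu /GS hw ->]]]; exists u, w.
elim: m => [|m IH].
  apply: odd_words_ind => // -[|//] n _ _ Ln; have [c ->] := L0dec Ln.
  apply: (sub_bigsum (sYG 0)) => j _; apply: (subZ (sYG 0)).
  by apply: saddl => //; apply: sub_lspan; exists [::], j.
have YL k : Y k `<=` odd_words k.
  apply: lspan_le; first exact: odd_words_sub.
  move=> _ [s [j [/andP[_ ys] sk ->]]].
  rewrite (_ : eact_word s (nu j) = wact aM (map e s) (nu j)); last first.
    by elim: s {ys sk} => //= i s <-.
  apply: odd_words_word; rewrite ?size_map //; rewrite all_map.
  by apply: sub_all ys => i; exact: e1.
apply: odd_words_ind => // -[|z u] n /=.
  by move=> _ _ Ln; apply/YGS/IH; apply: (odd_words_word (w := [::])).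
move=> /andP[z1 u1] um Ln; have Lu : odd_words m (wact aM u n) by exact: odd_words_word.
have [c [b [[bP b1] ->]]] := dec1 z1.
rewrite (linD (linl _)); apply: (subD (sYG _)); last first.
  by apply: saddr => //=; exact: odd_words_P1.
rewrite (lin_sum _ _ _ (linl _)) big_seq; apply: (sub_bigsum (sYG _)) => i.
rewrite mem_index_iota => iy; rewrite (linZ (linl _)); apply: (subZ (sYG _)).
have [y [r [Yy Gr ->]]] := IH _ Lu.
rewrite (linD (linr _)); apply: (subD (sYG _)); last first.
  apply: saddr => //=; case: (m) Gr => [->|k Gr] /=.
    by rewrite (lin0 (linr _)); exact: sub0 (filt_sub _).
  by apply: filt_odd => //; exact: e1.
apply: (lspan_le (subspace_preim (linr (e i)) (sYG m.+1))) Yy => _ [s [j [ys sm ->]]].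
rewrite /preimage /=.
pose e' i := if (nx <= i < n0)%N then aM (e i) else fun=> 0.
have e'lin k : linear (e' k).
  by rewrite /e'; case: ifP => // _ a x x'; rewrite scaler0 addr0.
have e'act k p v : filt p v -> filt p.+1 (e' k v).
  rewrite /e'; case: ifP => [kN|_ _]; last exact: sub0 (filt_sub _).
  by apply: filt_odd; exact: e1.
have e'comm k l p v : filt p v -> filt p.+1 (e' k (e' l v) - (-1) *: e' l (e' k v)).
  move=> gv; rewrite /e'; case: ifP => kN; case: ifP => lN;
    rewrite ?(lin0 (linr _)) ?scaler0 ?subrr; try exact: sub0 (filt_sub _).
  by apply: filtS; apply: filt_anti => //; exact: e1.
have e'E t v : all (fun i => nx <= i < n0)%N t -> foldr e' v t = eact_word t v.
  by elim: t => //= k t IHt /andP[kN tN]; rewrite IHt // /e' kN.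
have n0' : filt 0 (nu j).
  by apply: odd_words_filt; apply: (odd_words_word (w := [::])).
have [ss sn] := andP ys.
have sin : all (fun k => nx <= k < n0)%N (i :: s) by rewrite /= iy.
have Gle p : shiftf filt (size s).+1 p -> shiftf filt m.+1 p.
  move=> /=; move: p; rewrite -/(filt _ `<=` filt _).
  move/subnK: sm => <-; elim: (m - size s)%N => [|k IHk] // v /IHk; exact: filtS.
have [ui|nui] := boolP (uniq (i :: s)); last first.
  apply: saddr => //; apply: Gle.
  have := reorder_dup e'lin filt_sub e'act e'comm n0' nui; rewrite e'E //; apply.
  move=> k p v kis Gv; have kN : (nx <= k < n0)%N by exact: (allP sin).
  by rewrite /e' kN; apply: filtS; apply: filt_square => //; exact: e1.
have ps : perm_eq (i :: s) (sort leq (i :: s)) by rewrite perm_sym perm_sort.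
have [a Ha] := reorder e'lin filt_sub e'act e'comm n0' ps.
have sson : all (fun k => nx <= k < n0)%N (sort leq (i :: s)) by rewrite -(perm_all _ ps).
move: Ha; rewrite !e'E // => /Gle Ha.
rewrite -[aM _ _](subrK (a *: eact_word (sort leq (i :: s)) (nu j))) addrC.
exists (a *: eact_word (sort leq (i :: s)) (nu j)), (eact_word (i :: s) (nu j) - a *: eact_word (sort leq (i :: s)) (nu j)).
split=> //; apply: (subZ (sY _)); apply: sub_lspan; exists (sort leq (i :: s)), j.
split=> //; last by rewrite size_sort.
rewrite /yword sson andbT ltn_sorted_uniq_leq sort_uniq ui.
by apply: sort_sorted; exact: leq_total.
Qed.

Local Notation c := (n0 - nx)%N.
Local Notation D := #|{: {set 'I_c} * 'I_d}|.

Definition ysub (J : {set 'I_c}) : seq nat := [seq (nx + i)%N | i : 'I_c <- enum J].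

Lemma size_ysub J : size (ysub J) = #|J|.
Proof. by rewrite size_map cardE. Qed.

Lemma ysub_yword J : yword (ysub J).
Proof.
apply/andP; split; last first.
  apply/allP => _ /mapP[i _ ->]; rewrite leq_addr /=.
  by rewrite -ltn_subRL ltn_ord.
rewrite sorted_map (@eq_sorted _ _ (relpre val ltn)); last first.
  by move=> i j /=; rewrite ltn_add2l.
rewrite -sorted_map; apply: (@subseq_sorted _ ltn ltn_trans _ (map val (enum 'I_c))).
  by apply: map_subseq; rewrite [enum 'I_c]enumT; exact: filter_subseq.
by rewrite val_enum_ord iota_ltn_sorted.
Qed.

Lemma yword_ysub s : yword s -> exists J, s = ysub J.
Proof.
move=> ys; pose J : {set _} := finset.finset (fun i : 'I_c => (nx + i)%N \in s); exists J.
have [ss sn] := andP ys.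
apply: (irr_sorted_eq ltn_trans ltnn ss); first by case/andP: (ysub_yword J).
move=> k; apply/idP/mapP => [ks|]; last by case=> l; rewrite mem_enum finset.inE => ? ->.
have /andP[k1 k2] := allP sn _ ks.
have kc : (k - nx < c)%N by rewrite ltn_sub2r // (leq_ltn_trans k1).
exists (Ordinal kc); last by rewrite /= subnKC.
by rewrite mem_enum finset.inE /= subnKC.
Qed.

(* The exterior power of a complement of P in g1, tensored with L0: the pair (J, j)
   goes to the product of the odd basis vectors indexed by J, applied to nu j. *)
Definition odd_iota (v : 'rV[K]_D) : M :=
  \sum_k v 0 k *: eact_word (ysub (enum_val k).1) (nu (enum_val k).2).

Lemma odd_iota_linear : linear odd_iota.
Proof.
move=> a u v; rewrite /odd_iota scaler_sumr -big_split; apply: eq_bigr => k _ /=.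
by rewrite !mxE scalerDl scalerA.
Qed.

Lemma odd_iota_delta J j :
  odd_iota (delta_mx 0 (enum_rank (J, j))) = eact_word (ysub J) (nu j).
Proof.
rewrite /odd_iota (bigD1 (enum_rank (J, j))) //= mxE !eqxx scale1r enum_rankK big1 ?addr0 //.
by move=> k /negbTE ne; rewrite mxE ne andbF scale0r.
Qed.

Lemma eact_word_odd_words s j : yword s -> odd_words (size s) (eact_word s (nu j)).
Proof.
move=> /andP[_ sn].
rewrite (_ : eact_word s (nu j) = wact aM (map e s) (nu j)); last first.
  by elim: s {sn} => //= i s <-.
apply: odd_words_word; rewrite ?size_map // all_map.
by apply: sub_all sn => i; exact: e1.
Qed.

Local Notation wspan := (wspan aM e nx odd_iota).
Local Notation adjacent := (adjacent aM e nx [set b | b \in (P :&: g0)%VS] odd_iota).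

Lemma g0br x y : x \in g0 -> y \in g0 -> br x y \in g0.
Proof. by move=> x0 y0; have := br_part HA x0 y0. Qed.

Lemma Pg0 x : x \in (P :&: g0)%VS -> x \in g0.
Proof. by rewrite memv_cap => /andP[]. Qed.

Definition odd_layer m : {vspace 'rV[K]_D} := vspan [set v | odd_words m (odd_iota v)].

Lemma mem_odd_layer m v : v \in odd_layer m <-> odd_words m (odd_iota v).
Proof.
apply: mem_vspan; apply: (subspace_preim (f := odd_iota) odd_iota_linear); exact: odd_words_sub.
Qed.

(** The index is shifted by one, in step with [shiftf filt], so that the chain of layers starts at
    0. *)
Definition layer m : {vspace 'rV[K]_D} := if m is m'.+1 then odd_layer m' else 0%VS.

Lemma odd_layer_le m : (odd_layer m <= odd_layer m.+1)%VS.
Proof.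
by apply/subvP => v /mem_odd_layer/(odd_words_le (leqnSn m)) h; apply/mem_odd_layer.
Qed.

Lemma odd_words_odd_layer m : odd_words m `<=` sadd (odd_iota @` [set` odd_layer m]) (shiftf filt m).
Proof.
have sG : subspace (shiftf filt m).
  case: (m) => [|k]; last exact: filt_sub.
  by split=> //= a u v -> ->; rewrite scaler0 addr0.
move=> w /odd_words_yspan [u [r [hu hr ->]]]; exists u, r; split=> //.
apply: (lspan_le (subspace_iota odd_iota_linear _)) hu => _ [s [j [ys sm ->]]].
have [J eJ] := yword_ysub ys; exists (delta_mx 0 (enum_rank (J, j))); last first.
  by rewrite odd_iota_delta eJ.
by apply/mem_odd_layer; rewrite odd_iota_delta -eJ; apply: (odd_words_le sm); exact: eact_word_odd_words.
Qed.

(** Induction on m, with the lower odd degrees as the stable subspace W of [xspan_stable]: modulo W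
    the even part of P preserves the layer, so the ordered even words on the layer span a space
    stable under g0. *)
Lemma filt_wspan m : shiftf filt m = wspan (layer m).
Proof.
elim: m => [|m IH] /=; first by rewrite (wspan0 modM e nx odd_iota_linear).
have FW x w : x \in g0 -> shiftf filt m w -> shiftf filt m (aM x w).
  case: (m) => [|k] x0 /=; last exact: filt_even.
  by move=> ->; exact: (lin0 (linr _)).
apply/seteqP; split; last first.
  apply: wspan_ind; first exact: filt_sub.
  move=> s v /andP[_ sn] /mem_odd_layer Lv; elim: s sn => [_|i s IHs /= /andP[iN sN]].
    exact: odd_words_filt.
  by apply: filt_even; [exact: e0 | exact: IHs].
have EcEm : (layer m <= odd_layer m)%VS by case: (m) => [|k]; [exact: sub0v | exact: odd_layer_le].
suff H : filt m `<=` sadd (wspan (odd_layer m)) (wspan (layer m)).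
  by move=> _ /H[u [r [Fu /(wspan_le EcEm) Fr ->]]]; apply: (subD (wspan_sub _ _ _ _ _)).
rewrite -IH in EcEm *.
have sW : subspace (shiftf filt m) by rewrite IH; exact: wspan_sub.
apply: filt_ind.
- by apply: subspace_sadd => //; exact: wspan_sub.
- move=> w /odd_words_odd_layer [u [r [[v vE <-] Gr ->]]]; exists (odd_iota v), r; split=> //.
  exact: wspan_iota.
move=> x w x0; apply: (xspan_stable modM (subvv _) g0br Pg0 e0 dec0) => //.
move=> b _ /[!(inE, memv_cap)] /andP[bP b0] [v /mem_odd_layer vE <-].
by apply: odd_words_odd_layer; exact: odd_words_P0.
Qed.

Lemma layer_adjacent m : adjacent (layer m) (layer m.+1).
Proof.
split; first by case: (m) => [|k]; [exact: sub0v | exact: odd_layer_le].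
move=> b v /= /[!memv_cap] /andP[bP b0] /mem_odd_layer Lv; rewrite -filt_wspan; apply: odd_words_odd_layer; exact: odd_words_P0.
Qed.

Lemma odd_layer_top m : (c <= m)%N -> odd_layer m = fullv.
Proof.
move=> cm; apply/eqP; rewrite eqEsubv subvf; apply/subvP => v _; apply/mem_odd_layer.
apply: (sub_bigsum (odd_words_sub m)) => k _; apply: (subZ (odd_words_sub m)).
have := eact_word_odd_words (enum_val k).2 (ysub_yword (enum_val k).1).
by apply: odd_words_le; rewrite size_ysub (leq_trans _ cm) // -[X in (_ <= X)%N]card_ord max_card.
Qed.

Lemma wspan_top w : wspan fullv w.
Proof.
have [m Gw] := filt_top w; have := filt_wspan m.+1 => /= e'.
by rewrite e' in Gw; apply: wspan_le Gw; exact: subvf.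
Qed.

End OddFiltration.

(** * Layers as induced modules over the even part *)

(** Row vectors model U' / U through a basis of a complement of U in U': [sg] is the section and [q]
    the projection. The dimension is written as a successor, which U != U' permits, to have the
    matrix algebra ['M[K]_n.+1] at hand. *)
Lemma quotient_model (K : fieldType) (V : vectType K) (U U' : {vspace V}) :
  (U <= U')%VS -> U != U' -> exists n (sg : 'rV[K]_n.+1 -> V) (q : V -> 'rV[K]_n.+1),
  [/\ linear sg /\ linear q, forall w, sg w \in U' /\ q (sg w) = w,
      forall u, u \in U -> q u = 0, forall v, v \in U' -> v - sg (q v) \in U
    & (\dim U' = \dim U + n.+1)%N].
Proof.
move=> UU' neU; pose C := (U' :\: U)%VS.
have CU0 : (C :&: U = 0)%VS by exact: capv_diff.
have UC0 : (U :&: C = 0)%VS by rewrite capvC.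
have capU : (U' :&: U = U)%VS by apply/capv_idPr.
have CU : (C + U = U')%VS.
  by have := addv_diff_cap U' U; rewrite capU.
have dC : (\dim U' = \dim U + \dim C)%N.
  by have := dimv_cap_compl U' U; rewrite capU.
have : (0 < \dim C)%N.
  rewrite lt0n; apply: contra neU => /eqP e0; apply/eqP/esym/eqP.
  by rewrite eq_sym eqEdim UU' dC e0 addn0 leqnn.
case en : (\dim C) => [//|n] _; exists n.
move: (vbasis C) (vbasisP C); rewrite {1 2}en dC en => b bP.
have fb := basis_free bP.
pose sg (w : 'rV[K]_n.+1) := \sum_i w 0 i *: b`_i.
pose q v : 'rV[K]_n.+1 := \row_i coord b i (daddv_pi C U v).
have sgC w : sg w \in C.
  by apply: memv_suml => i _; apply/memvZ/(basis_mem bP)/mem_nth; rewrite size_tuple.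
have C_U' x : x \in C -> x \in U' by move=> xC; rewrite -CU (subvP (addvSl _ _)).
exists sg, q; split=> //.
- split=> [a u v|a u v].
    rewrite /sg scaler_sumr -big_split; apply: eq_bigr => i _ /=.
    by rewrite !mxE scalerDl scalerA.
  by apply/rowP => i; rewrite !mxE !linearP.
- move=> w; split; first exact: C_U'.
  by apply/rowP => i; rewrite mxE daddv_pi_id // coord_sum_free.
- move=> u uU; have := daddv_pi_add CU0 (w := u).
  rewrite (daddv_pi_id UC0 uU) => /(_ (subvP (addvSr _ _) _ uU)) h.
  have d0 : daddv_pi C U u = 0 by apply: (addIr u); rewrite add0r.
  by apply/rowP => i; rewrite !mxE d0 linear0.
- move=> v vU'; have := daddv_pi_add CU0 (w := v); rewrite CU => /(_ vU') {1}<-.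
  have -> : sg (q v) = daddv_pi C U v.
    rewrite [RHS](coord_basis bP (memv_pi _ _ _)).
    by apply: eq_bigr => i _; rewrite mxE.
  by rewrite addrC addKr memv_pi.
Qed.

Section Subquotient.
Variables (K : fieldType) (A : superalg K) (M : lmodType K) (aM : A -> M -> M).
Hypothesis HA : lie_superalgebra A.
Hypothesis modM : is_module aM.
Local Notation g0 := (part A false).
Variables (e : nat -> A) (nx : nat) (Pv : {vspace A}).
Hypothesis Pvg0 : (Pv <= g0)%VS.
Hypothesis e0 : forall i, (i < nx)%N -> e i \in g0.
Hypothesis dec0 : forall x, x \in g0 -> exists (c : nat -> K) b,
  b \in Pv /\ x = \sum_(i < nx) c i *: e i + b.
Variables (V : vectType K) (iota : V -> M).
Hypothesis iota_lin : linear iota.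
(* The words in e 0, ..., e (nx - 1) applied to a basis of iota V are linearly independent. *)
Hypothesis hfree : forall (T : lmodType K) (h : seq nat -> V -> T),
  (forall s, linear (h s)) -> exists phi : M -> T, linear phi /\
    forall s v, xword nx s -> phi (foldr (fun i => aM (e i)) (iota v) s) = h s v.

Local Notation wspan := (wspan aM e nx iota).
Local Notation adjacent := (adjacent aM e nx [set b | b \in Pv] iota).
Local Notation wspan_stable := (wspan_stable aM g0 e nx iota).
Local Notation simple_step := (simple_step aM e nx [set b | b \in Pv] iota).
Local Notation Xf s m := (foldr (fun i => aM (e i)) m s).

Lemma X_lin s : linear (fun m => Xf s m).
Proof. by elim: s => //= i s IH a u v; rewrite IH modM.1.2. Qed.

(** The functional that reads the empty word recovers U from [wspan U]; this also makes the steps of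
    the final filtration strict. *)
Lemma hfree_const : exists c0 : M -> V, [/\ linear c0, forall v, c0 (iota v) = v
  & forall U w, wspan U w -> c0 w \in U].
Proof.
have [|c0 [lc0 c0E]] := hfree (h := fun s v => if s is [::] then v else 0).
  by case=> [|i s] a u v //; rewrite scaler0 addr0.
exists c0; split=> // [v|U w]; first by have := c0E [::] v isT.
apply: (wspan_ind (S := [set w | c0 w \in U])).
  split=> /= [|a u v cu cv]; first by rewrite (lin0 lc0) mem0v.
  by rewrite lc0 memvD ?memvZ.
by move=> [|i s] v xs vU /=; rewrite (c0E _ v xs) ?mem0v.
Qed.

Variables (U U' : {vspace V}).
Hypothesis stU : wspan_stable U.
Hypothesis adj : adjacent U U'.
Variables (n : nat) (sg : 'rV[K]_n.+1 -> V) (q : V -> 'rV[K]_n.+1).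
Hypotheses (lsg : linear sg) (lq : linear q).
Hypothesis sgU' : forall w, sg w \in U'.
Hypothesis qsg : forall w, q (sg w) = w.
Hypothesis qU : forall u, u \in U -> q u = 0.
Hypothesis sgq : forall v, v \in U' -> v - sg (q v) \in U.
Variable c0 : M -> V.
Hypothesis lc0 : linear c0.
Hypothesis c0iota : forall v, c0 (iota v) = v.
Hypothesis c0F : forall U w, wspan U w -> c0 w \in U.

(* The action of Pv on U' / U: by sg and q, row vectors are a model of U' / U, and
   c0 is the coefficient of the empty word. *)
Definition layer_act (b : A) (w : 'rV[K]_n.+1) : 'rV[K]_n.+1 := q (c0 (aM b (iota (sg w)))).

Lemma layer_act_bilinear : bilinear_op layer_act.
Proof.
split=> [w a x y|b a x y]; rewrite /layer_act.
  by rewrite modM.1.1 lc0 lq.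
by rewrite lsg iota_lin modM.1.2 lc0 lq.
Qed.

Lemma adj_c0 b v : b \in Pv -> v \in U' ->
  c0 (aM b (iota v)) \in U' /\ wspan U (aM b (iota v) - iota (c0 (aM b (iota v)))).
Proof.
move=> Pb vU'; have [_ [w [[u uU' <-] Fw ->]]] := adj.2 b v Pb vU'.
rewrite (linD lc0) c0iota; have cw := c0F Fw.
split; first by rewrite memvD // (subvP adj.1).
rewrite (linD iota_lin) opprD addrACA subrr add0r.
by apply: (subB (wspan_sub _ _ _ _ _)) => //; exact: wspan_iota.
Qed.

Lemma q_c0_wspan w : wspan U w -> q (c0 w) = 0.
Proof. by move=> /c0F /qU. Qed.

(** The action does not depend on the lift of [q v] to U': two lifts differ by an element of U, and
    [wspan U] is stable. *)
Lemma layer_act_q b v : b \in Pv -> v \in U' -> layer_act b (q v) = q (c0 (aM b (iota v))).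
Proof.
move=> Pb vU'; apply/eqP; rewrite eq_sym -subr_eq0 -(linB lq) -(linB lc0).
rewrite -(linB (modM.1.2 b)) -(linB iota_lin); apply/eqP/q_c0_wspan.
by apply: stU; [exact: (subvP Pvg0) | apply: wspan_iota; exact: sgq].
Qed.

Lemma layer_act_mul b b' w : b \in Pv -> b' \in Pv ->
  layer_act b (layer_act b' w) = q (c0 (aM b (aM b' (iota (sg w))))).
Proof.
move=> Pb Pb'; have [cU' Fc] := adj_c0 Pb' (sgU' w).
rewrite {2}/layer_act layer_act_q //; apply/eqP; rewrite eq_sym -subr_eq0.
rewrite -(linB lq) -(linB lc0) -(linB (modM.1.2 b)); apply/eqP/q_c0_wspan.
by apply: stU => //; exact: (subvP Pvg0).
Qed.

Lemma layer_act_br b b' w : b \in Pv -> b' \in Pv ->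
  layer_act (br b b') w = layer_act b (layer_act b' w) - layer_act b' (layer_act b w).
Proof.
move=> Pb Pb'; rewrite !layer_act_mul // -(linB lq) -(linB lc0) /layer_act.
by rewrite (modM.2 _ _ _ _ _ (subvP Pvg0 _ Pb) (subvP Pvg0 _ Pb')) expr0 scale1r.
Qed.

Hypothesis simp : forall G, (U <= G)%VS -> (G <= U')%VS -> adjacent U G -> G = U \/ G = U'.

(** The preimage G in U' of an invariant W is adjacent to U, so the minimality of the step leaves
    only G = U and G = U'. *)
Lemma layer_act_simple (W : set 'rV[K]_n.+1) : subspace W ->
  (forall b w, b \in Pv -> W w -> W (layer_act b w)) -> W = [set 0] \/ W = setT.
Proof.
move=> sW HW; pose G := vspan [set v | v \in U' /\ W (q v)].
have GE v : v \in G <-> v \in U' /\ W (q v).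
  apply: (mem_vspan (A := [set v | v \in U' /\ W (q v)])); split=> /= [|a x y [xU Wx] [yU Wy]].
    by rewrite mem0v (lin0 lq); split=> //; exact: sub0.
  by rewrite memvD ?memvZ // lq; split=> //; apply: sW.2.
have UG : (U <= G)%VS.
  apply/subvP => u uU; apply/GE; rewrite qU //; split; last exact: sub0.
  exact: (subvP adj.1).
have GU' : (G <= U')%VS by apply/subvP => v /GE[].
have aUG : adjacent U G.
  split=> // b v Pb /GE[vU' Wv]; have [cU' Fc] := adj_c0 Pb vU'.
  exists (iota (c0 (aM b (iota v)))), (aM b (iota v) - iota (c0 (aM b (iota v)))).
  split=> //; last by rewrite addrC subrK.
  exists (c0 (aM b (iota v))) => //; apply/GE; split=> //.
  by rewrite -layer_act_q //; exact: HW.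
case: (simp UG GU' aUG) => eG; [left | right].
  apply/seteqP; split=> [w Ww /=|_ ->]; last exact: sub0.
  by rewrite -(qsg w); apply: qU; rewrite -eG; apply/GE; rewrite qsg.
apply/seteqP; split=> // w _; rewrite -(qsg w).
have : sg w \in G by rewrite eG.
by move/GE => [].
Qed.

Variables (Lv Mp : {vspace A}).
Hypothesis PvE : (Lv + Mp)%VS = Pv.
Hypothesis LMp0 : (Lv :&: Mp)%VS = 0%VS.
Hypothesis layer_act_Mp : forall b w, b \in Mp -> layer_act b w = 0.

Definition levi_act (x : sub Lv) (w : 'rV[K]_n.+1) := layer_act (vsval x) w.

Lemma inflate_layer_act (x : sub Pv) w : inflate Mp (P := Pv) levi_act x w = layer_act (vsval x) w.
Proof.
have [aCl _] := layer_act_bilinear.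
have xE : daddv_pi Lv Mp (vsval x) + daddv_pi Mp Lv (vsval x) = vsval x.
  by apply: daddv_pi_add => //; rewrite PvE; exact: subvsP.
rewrite -[in RHS]xE (linD (aCl w)) (layer_act_Mp _ (memv_pi _ _ _)) addr0.
by rewrite /inflate /levi_act vsprojK ?memv_pi.
Qed.

Local Notation gz := (sub g0).
Local Notation MSx := (ind (@incl _ A Pv g0) (inflate Mp (P := Pv) levi_act)).
Local Notation ione w := (indt (@incl _ A Pv g0) (inflate Mp (P := Pv) levi_act) 1 w).
Definition msact : gz -> MSx -> MSx := @ind_act _ _ _ _ _ _.

Lemma msact_mod : is_module msact. Proof. exact: ind_act_is_module. Qed.

Definition ez (i : nat) : gz := vsproj g0 (e i).
Local Notation XS s m := (foldr (fun i => msact (ez i)) m s).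

Lemma XS_lin s : linear (fun m => XS s m).
Proof. by elim: s => //= i s IH a u v; rewrite IH msact_mod.1.2. Qed.

Lemma msact_ione (x : gz) w : vsval x \in Pv -> msact x (ione w) = ione (layer_act (vsval x) w).
Proof.
move=> xP; rewrite /msact /ind_act ind_mulE mulr1.
have -> : x = @incl _ A Pv g0 (vsproj Pv (vsval x)).
  by rewrite /incl vsprojK // vsvalK.
rewrite -[env_inj _]mul1r indt_balanced inflate_layer_act.
by rewrite /incl !vsprojK // ?(subvP Pvg0) // vsprojK // subvsP.
Qed.

Lemma ione_lin : linear (fun w => ione w).
Proof. by move=> a u v; rewrite indt_linearr. Qed.

(** The straightening is applied to the induced module itself, with error space 0: the vectors 1 (x)
    w are stable under Pv. *)
Lemma ms_span (S : set MSx) : subspace S ->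
  (forall s w, xword nx s -> S (XS s (ione w))) -> forall z, S z.
Proof.
move=> sS HS.
pose E := [set ione w | w in setT].
have e0' i : (i < nx)%N -> ez i \in (fullv : {vspace gz}) by rewrite memvf.
have sub0z : subspace ([set 0] : set MSx).
  by split=> //= a u v -> ->; rewrite scaler0 addr0.
have xs_le : xspan msact ez nx E `<=` S.
  by apply: lspan_le => // _ [s [_ [xs [w _ <-] ->]]]; exact: HS.
have st : forall x u, xspan msact ez nx E u -> xspan msact ez nx E (msact x u).
  move=> x u Xu.
  have H : sadd (xspan msact ez nx E) [set 0] (msact x u).
    apply: (xspan_stable msact_mod (G0 := fullv) (P0 := [set b : gz | vsval b \in Pv])).
    - by apply/subvP => y _; rewrite sub_partE subvsP.
    - by move=> *; rewrite memvf.
    - by move=> *; rewrite memvf.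
    - by move=> *; rewrite memvf.
    - move=> y _; have [c [b [Pb yE]]] := dec0 (subvsP y).
      exists c, (vsproj g0 b); split; first by rewrite /= vsprojK // (subvP Pvg0).
      have -> : y = vsproj g0 (vsval y) by rewrite vsvalK.
      rewrite yE [LHS]linearD [X in X + _]linear_sum; congr (_ + _).
      by apply: eq_bigr => i _; exact: linearZ.
    - exact: sub0z.
    - by move=> y w _ ->; rewrite (lin0 (msact_mod.1.2 y)).
    - move=> b _ Pb [w _ <-]; rewrite msact_ione //; apply: saddl => //.
      by exists (layer_act (vsval b) w).
    - by rewrite memvf.
    by apply: saddl.
  by case: H => [v [_ [Xv -> ->]]]; rewrite addr0.
move=> z; apply: xs_le; apply: (ind_gen (W := xspan msact ez nx E)).
- exact: subspace_lspan.
- by move=> w; apply: sub_lspan; exists [::], (ione w); split=> //; exists w.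
- exact: st.
Qed.

Definition wquot : lmodType K := quotl (wspan U).
Definition pq (m : M) : wquot := pil (wspan U) m.
Definition rp (z : wquot) : M := sval (cid (pil_surj z)).
Lemma rpK z : pq (rp z) = z. Proof. by rewrite /rp; case: cid. Qed.
Lemma pq_lin : linear pq. Proof. exact: pil_linear. Qed.
Lemma pq_eq m m' : pq m = pq m' <-> wspan U (m - m').
Proof.
split=> [/pil_eq|h]; first by rewrite lspan_id //; exact: wspan_sub.
by apply/pil_eq; rewrite lspan_id //; exact: wspan_sub.
Qed.
Definition quot_act (x : gz) (z : wquot) : wquot := pq (aM (vsval x) (rp z)).

Lemma quot_actE x m : quot_act x (pq m) = pq (aM (vsval x) m).
Proof.
apply/pq_eq; rewrite -(linB (modM.1.2 _)); apply: stU; first exact: subvsP.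
by apply/pq_eq; rewrite rpK.
Qed.

Lemma pq_surj z : exists m, z = pq m. Proof. by exists (rp z); rewrite rpK. Qed.

Lemma quot_act_mod : is_module quot_act.
Proof.
split; first split=> [z a x y|x a z t].
- have [m ->] := pq_surj z; rewrite !quot_actE -pq_lin; congr pq.
  by rewrite linearP /= modM.1.1.
- have [m ->] := pq_surj z; have [m' ->] := pq_surj t.
  by rewrite -pq_lin !quot_actE modM.1.2 pq_lin.
move=> a b x y z xa yb; have [m ->] := pq_surj z.
rewrite !quot_actE -(linZ pq_lin) -(linB pq_lin); congr pq.
rewrite -(modM.2 _ _ _ _ _ (_ : vsval x \in part A a) (_ : vsval y \in part A b)).
- by rewrite sub_brE //; have := br_part HA (subvsP x) (subvsP y).
- by rewrite -sub_partE.
- by rewrite -sub_partE.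
Qed.

(** Two inverse maps. [Psi], from the induced module to M / [wspan U], comes from the universal
    property and is equivariant. [phi], in the other direction, comes from the independence of words
    and is a priori only linear; it inherits equivariance on [wspan U'] from [Psi]. *)
Lemma subquotient_exists :
  subquotient_iso (fun x : gz => aM (vsval x)) msact (wspan U') (wspan U).
Proof.
pose tau w : wquot := pq (iota (sg w)).
have ltau : linear tau by move=> a u v; rewrite /tau lsg iota_lin pq_lin.
have tauB (b : sub Pv) w : tau (inflate Mp (P := Pv) levi_act b w) = quot_act (@incl _ A Pv g0 b) (tau w).
  rewrite inflate_layer_act /tau quot_actE; have bP := subvsP b.
  have -> : vsval (@incl _ A Pv g0 b) = vsval b by rewrite vsprojK // (subvP Pvg0).
  have [cU' Fc] := adj_c0 bP (sgU' w).
  apply/esym; transitivity (pq (iota (c0 (aM (vsval b) (iota (sg w)))))); first exact/pq_eq.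
  by apply/pq_eq; rewrite -(linB iota_lin); apply: wspan_iota; exact: sgq.
have [Psi [lPsi Psi1 PsiA]] := ind_lift_ex quot_act_mod ltau tauB.
have [|phi [lphi phiE]] := hfree (T := MSx) (h := fun s v => XS s (ione (q v))).
  by move=> s a u v; rewrite lq ione_lin XS_lin.
have xval s m : xword nx s -> foldr (fun i => quot_act (ez i)) (pq m) s = pq (Xf s m).
  move=> /andP[_]; elim: s => //= i s IH /andP[iN sN].
  by rewrite IH // quot_actE vsprojK // e0.
have PsiX s w : xword nx s -> Psi (XS s (ione w)) = pq (Xf s (iota (sg w))).
  move=> xs; rewrite -xval //; elim: {xs} s => [|i s IH] /=; first exact: Psi1.
  by rewrite PsiA IH.
have phiU w : wspan U w -> phi w = 0.
  apply: (wspan_ind (S := [set w | phi w = 0])).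
    by split=> /= [|a u v pu pv]; rewrite ?(lin0 lphi) // lphi pu pv scaler0 addr0.
  move=> s v xs vU /=; rewrite phiE // qU // (lin0 ione_lin).
  exact: (lin0 (XS_lin s)).
pose phiQ z := phi (rp z).
have phiQE m : phiQ (pq m) = phi m.
  apply/eqP; rewrite -subr_eq0 -(linB lphi); apply/eqP/phiU/pq_eq; exact: rpK.
have phiPsi z : phiQ (Psi z) = z.
  apply: (ms_span (S := [set z | phiQ (Psi z) = z])) => [|s w xs].
    apply: (subspace_eq (f := fun z => phiQ (Psi z)) (g := id)) => // a u v.
    rewrite lPsi; have [m ->] := pq_surj (Psi u); have [m' ->] := pq_surj (Psi v).
    by rewrite -pq_lin !phiQE lphi.
  by rewrite /= PsiX // phiQE phiE // qsg.
have Psiphi m : wspan U' m -> Psi (phi m) = pq m.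
  apply: (wspan_ind (S := [set m | Psi (phi m) = pq m])).
    apply: (subspace_eq (f := fun m => Psi (phi m)) (g := pq)); last exact: pq_lin.
    by move=> a u v; rewrite lphi lPsi.
  move=> s v xs vU' /=; rewrite phiE // PsiX //; apply/esym/pq_eq.
  rewrite -(linB (X_lin s)) -(linB iota_lin); apply: wspan_word => //; exact: sgq.
have stU' : wspan_stable U'.
  apply: (adjacent_stable modM (subvv _) _ _ e0 dec0 stU adj).
    by move=> x y x0 y0; have := br_part HA x0 y0.
  by move=> x; exact: (subvP Pvg0).
exists phi; split.
- by move=> a u v _ _; exact: lphi.
- move=> x m Fm; have Fxm : wspan U' (aM (vsval x) m) by apply: stU' => //; exact: subvsP.
  by rewrite -[LHS]phiPsi -[RHS]phiPsi PsiA !Psiphi // quot_actE.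
- apply: ms_span => [|s w xs].
    split=> [|a u v [x Fx <-] [y Fy <-]].
      by exists 0; [exact: sub0 (wspan_sub _ _ _ _ _) | exact: lin0 lphi].
    by exists (a *: x + y); [exact: (wspan_sub _ _ _ _ _).2 | exact: lphi].
  exists (Xf s (iota (sg w))); last by rewrite phiE // qsg.
  exact: wspan_word.
- move=> m Fm; split=> [p0|]; last exact: phiU.
  by rewrite -[m]subr0; apply/pq_eq; rewrite -Psiphi // p0 (lin0 lPsi) (lin0 pq_lin).
Qed.

End Subquotient.

(** * Nilpotent operators and weights *)

Section VspanLspan.
Variables (K : fieldType) (V : vectType K).

Lemma mem_vspan_lspan (T : set V) x : x \in vspan T <-> lspan T x.
Proof.
have e : vspan T = vspan (lspan T).
  apply/eqP; rewrite eqEsubv; apply/andP; split; apply: (vspanP _).2.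
    by move=> y /sub_lspan; exact: (vspanP _).1.
  apply: lspan_le; last exact: (vspanP _).1.
  by split=> [|a u v /= uT vT]; rewrite /= ?mem0v ?memvD ?memvZ.
rewrite e; exact: (mem_vspan _ (subspace_lspan T)).
Qed.

(** Eigenvectors with distinct eigenvalues are independent, and a finite dimensional space has no
    infinite independent sequence. Both the nilpotency of root vectors and the finiteness of
    sl2-strings are obtained in this way. *)
Lemma eigen_contra (f : V -> V) (v : nat -> V) (a : nat -> K) : linear f ->
  injective a -> (forall k, f (v k) = a k *: v k) -> exists k, v k = 0.
Proof.
move=> lf injA fv; apply: contrapT => nv.
have v0 k : v k != 0 by apply/eqP => vk; apply: nv; exists k.
have indep n (c : nat -> K) : \sum_(i < n) c i *: v i = 0 -> forall i, (i < n)%N -> c i = 0.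
  elim: n c => // n IH c e i; rewrite big_ord_recr /= in e.
  have e2 : \sum_(j < n) (c j * (a j - a n)) *: v j = 0.
    have := congr1 f e; rewrite (linD lf) (lin0 lf) (lin_sum _ _ _ lf) (linZ lf) fv => e3.
    have := congr1 (fun x => a n *: x) e; rewrite scaler0 scalerDr => e4.
    move: (etrans e3 (esym e4)); rewrite !scalerA [a n * c n]mulrC => /addIr e5.
    apply/eqP; rewrite (eq_bigr (fun j : 'I_n => f (c j *: v j) - a n *: (c j *: v j))).
      by rewrite sumrB -scaler_sumr e5 subrr.
    by move=> j _; rewrite (linZ lf) fv !scalerA mulrBr scalerBl [c j * a n]mulrC.
  have cj j : (j < n)%N -> c j = 0.
    move=> jn; have /eqP := IH (fun j => c j * (a j - a n)) e2 j jn; rewrite mulf_eq0 subr_eq0.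
    by move=> /orP[/eqP //|/eqP/injA ejn]; rewrite ejn ltnn in jn.
  rewrite ltnS leq_eqVlt => /orP[/eqP ->|/cj //].
  move: e; rewrite big1 ?add0r; last by move=> j _; rewrite cj ?scale0r.
  by move/eqP; rewrite scaler_eq0 (negbTE (v0 n)) orbF => /eqP.
pose m := (\dim (fullv : {vspace V})).+1.
pose X := [tuple v i | i < m].
have fX : free X.
  apply/freeP => c e i.
  pose c' j := if insub j is Some k then c k else 0.
  have -> : c i = c' i by rewrite /c' valK.
  apply: (indep m c') => //; rewrite -[RHS]e; apply: eq_bigr => j _.
  by rewrite /c' valK (nth_map j) ?size_enum_ord // nth_ord_enum.
have := dimvS (subvf <<X>>%VS); rewrite (eqnP fX) size_tuple.
by rewrite ltnn.
Qed.

End VspanLspan.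

(** * Sets of nilpotent operators closed under commutators *)

Section WeaklyClosed.
Variables (K : fieldType) (R : falgType K).
Implicit Types (S T : set R) (w : seq R).

Definition letters S w := forall x, x \in w -> S x.
Definition nil_words S N := forall w, letters S w -> (N <= size w)%N -> \prod_(x <- w) x = 0.
Definition comm_closed S := forall s t, S s -> S t -> S (s * t - t * s).

Lemma letters_cons S x w : letters S (x :: w) <-> S x /\ letters S w.
Proof.
split=> [h|[Sx Sw] y]; last by rewrite inE => /orP[/eqP->//|/Sw].
by split=> [|y yw]; apply: h; rewrite inE ?eqxx // yw orbT.
Qed.

Lemma mulr_lin (a b : R) : linear (fun x => a * x * b).
Proof. by move=> c u v; rewrite mulrDr mulrDl -scalerAr -scalerAl. Qed.

Lemma comm_lin (t : R) : linear (fun x => t * x - x * t).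
Proof.
by move=> c u v; rewrite mulrDr mulrDl -scalerAr -scalerAl opprD addrACA scalerBr.
Qed.

Lemma comm_linl (t : R) : linear (fun x => x * t - t * x).
Proof.
by move=> c u v; rewrite mulrDr mulrDl -scalerAr -scalerAl opprD addrACA scalerBr.
Qed.

Lemma subspace0 : subspace ([set 0] : set R).
Proof. by split=> //= a u v -> ->; rewrite scaler0 addr0. Qed.

Lemma comm_closed_lspan T : comm_closed T -> comm_closed (lspan T).
Proof.
move=> cT s t Ts Tt.
apply: (lspan_map (f := fun s => s * t - t * s) (comm_linl t)) Ts => s' Ts'.
apply: (lspan_map (f := fun t => s' * t - t * s') (comm_lin s')) Tt => t' Tt'.
by apply: sub_lspan; exact: cT.
Qed.

(** Products are multilinear in their letters; [w1] collects the letters already replaced by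
    elements of T. *)
Lemma nil_words_lspan T N : nil_words T N -> nil_words (lspan T) N.
Proof.
move=> nT w.
suff H w1 : letters T w1 -> letters (lspan T) w -> (N <= size w1 + size w)%N ->
    \prod_(x <- w1) x * \prod_(x <- w) x = 0.
  by move=> lw sw; have := H [::] _ lw sw; rewrite big_nil mul1r; apply.
elim: w w1 => [|x w IH] w1 lw1.
  by rewrite addn0 => _ s1; rewrite nT // mul0r.
move=> /letters_cons[Tx lw] sw; rewrite big_cons mulrA.
apply: (lspan_le (S := [set x | \prod_(x <- w1) x * x * \prod_(x <- w) x = 0])) Tx.
  apply: (subspace_eq (f := fun x => \prod_(x <- w1) x * x * \prod_(x <- w) x)
    (g := fun => 0)); first exact: mulr_lin.
  by move=> a u v; rewrite scaler0 addr0.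
move=> y Ty /=.
have := IH (rcons w1 y); rewrite big_rcons /=; apply=> //.
  by move=> z; rewrite mem_rcons => zw; move: z zw; apply/letters_cons.
by rewrite size_rcons addSnnS.
Qed.

Definition words_around T (s : R) m : set R := lspan [set z | exists u v,
  [/\ letters T u, letters T v, (size u + size v)%N = m
     & z = \prod_(x <- u) x * s * \prod_(x <- v) x]].

Lemma words_around_comm T s m t z : T t -> words_around T s m z ->
  words_around T s m.+1 (t * z - z * t).
Proof.
move=> Tt; apply: (lspan_map (f := fun z => t * z - z * t) (comm_lin t)).
move=> _ [u [v [lu lv uv ->]]]; apply: (subB (subspace_lspan _)); apply: sub_lspan.
  exists (t :: u), v; split=> //; first exact/letters_cons.
    by rewrite -uv.
  by rewrite big_cons !mulrA.
exists u, (rcons v t); split=> //.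
- by move=> z'; rewrite mem_rcons => zw; move: z' zw; apply/letters_cons.
- by rewrite size_rcons addnS uv.
- by rewrite big_rcons !mulrA.
Qed.

(* Otherwise commutators with T could be iterated forever outside the span of T, but
   a 2N-fold commutator has N letters of T on one side of s. *)
Lemma normalizing_element S T N : comm_closed S -> T `<=` S -> nil_words T N ->
  (exists2 s, S s & ~ lspan T s) ->
  exists2 s, S s /\ ~ lspan T s & forall t, T t -> lspan T (t * s - s * t).
Proof.
move=> cS TS nT [s0 Ss0 nTs0]; apply: contrapT => no.
have step s : S s -> ~ lspan T s -> exists2 t, T t & ~ lspan T (t * s - s * t).
  move=> Ss ns; apply: contrapT => h; apply: no; exists s => // t Tt.
  by apply: contrapT => h'; apply: h; exists t.
have ex m : exists z, [/\ S z, ~ lspan T z & words_around T s0 m z].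
  elim: m => [|m [z [Sz nz wz]]].
    exists s0; split=> //; apply: sub_lspan; exists [::], [::]; split=> //.
    by rewrite !big_nil mul1r mulr1.
  have [t Tt nt] := step z Sz nz; exists (t * z - z * t); split=> //.
    by apply: cS => //; exact: TS.
  exact: words_around_comm.
have [z [_ nz wz]] := ex (N + N)%N; apply: nz.
suff -> : z = 0 by exact: sub0 (subspace_lspan _).
apply: (lspan_le subspace0 _ wz) => _ [u [v [lu lv uv ->]]] /=.
have [Nu|uN] := leqP N (size u); first by rewrite (nT u) // !mul0r.
rewrite (nT v) ?mulr0 // leqNgt; apply/negP => vN.
by move: uv uN vN; lia.
Qed.

Definition sorted_words T (s : R) b : set R := lspan [set z | exists i u,
  [/\ letters T u, size u = b & z = s ^+ i * \prod_(x <- u) x]].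

(** As x s = s x + [x, s] with [x, s] again in the span of T, powers of s move to the left past one
    letter and leave one letter. *)
Lemma commute_power T s i x : (forall t, T t -> lspan T (t * s - s * t)) ->
  lspan T x -> lspan [set z | exists j x', lspan T x' /\ z = s ^+ j * x'] (x * s ^+ i).
Proof.
move=> ns; elim: i x => [|i IH] x Tx.
  by apply: sub_lspan; exists 0, x; rewrite expr0 mulr1 mul1r.
have -> : x * s ^+ i.+1 = s * (x * s ^+ i) + (x * s - s * x) * s ^+ i.
  by rewrite exprS mulrBl !mulrA addrC subrK.
apply: (subD (subspace_lspan _)); last first.
  by apply: IH; exact: (lspan_map (comm_linl s) ns Tx).
have ls : linear (fun z => s * z) by move=> a u v; rewrite mulrDr -scalerAr.
apply: (lspan_map ls _ (IH x Tx)) => _ [j [x' [Tx' ->]]].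
by apply: sub_lspan; exists j.+1, x'; rewrite exprS mulrA.
Qed.

Lemma word_sorted T s w : comm_closed T -> (forall t, T t -> lspan T (t * s - s * t)) ->
  letters (fun x => T x \/ x = s) w ->
  sorted_words (lspan T) s (count (predC1 s) w) (\prod_(x <- w) x).
Proof.
move=> cT ns; elim: w => [|x w IH].
  by move=> _; apply: sub_lspan; exists 0, [::]; rewrite expr0 !big_nil mulr1.
move=> /letters_cons[Tx lw]; have {IH} Iw := IH lw; rewrite big_cons /=.
have lx : linear (fun z : R => x * z) by move=> a u v; rewrite mulrDr -scalerAr.
have [xs|nxs] := eqVneq x s; rewrite /= ?add0n.
  apply: (lspan_map lx _ Iw) => _ [i [u [lu su ->]]].
  by apply: sub_lspan; exists i.+1, u; rewrite xs exprS mulrA.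
case: Tx nxs => [Tx|->]; last by rewrite eqxx.
move=> _; apply: (lspan_map lx _ Iw) => _ [i [u [lu su ->]]]; rewrite mulrA.
have lu' : linear (fun z : R => z * \prod_(x <- u) x).
  by move=> a y z; rewrite mulrDl -scalerAl.
apply: (lspan_map lu' _ (commute_power i ns (sub_lspan Tx))) => _ [j [x' [Tx' ->]]].
apply: sub_lspan; exists j, (x' :: u); split; first exact/letters_cons.
  by rewrite /= su.
by rewrite big_cons mulrA.
Qed.

(** Pigeonhole: at most b other letters cut the word into at most b + 1 blocks of letters s, and one
    of these has length at least M. *)
Lemma word_block s M b w : s ^+ M = 0 -> (count (predC1 s) w <= b)%N ->
  (b.+1 * M <= size w)%N -> \prod_(x <- w) x = 0.
Proof.
move=> sM; elim: b w => [|b IH] w cw szw; set k := find (predC1 s) w.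
all: have tk : \prod_(x <- take k w) x = s ^+ k.
1,3: have kw : (k <= size w)%N by exact: find_size.
1,2: have -> : take k w = nseq k s.
1,3: apply: (@eq_from_nth _ 0); rewrite ?size_nseq size_takel // => i ik;
  rewrite nth_nseq ik nth_take //; have := before_find 0 ik => /negbFE/eqP //.
1,2: by rewrite big_nseq iter_mulr_1.
all: rewrite -(cat_take_drop k w) big_cat /= tk.
all: have [Mk|kM] := leqP M k; first by rewrite -(subnK Mk) exprD sM mulr0 mul0r.
  have : has (predC1 s) w by rewrite has_find -/k (leq_trans kM) // -[M]mul1n.
  by rewrite has_count; case: (count _ w) cw.
have kw : (k < size w)%N.
  by apply: leq_trans kM (leq_trans _ szw); rewrite leq_pmull.
rewrite (drop_nth 0 kw) big_cons IH ?mulr0 //.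
  have := cw; rewrite -[X in count _ X](cat_take_drop k w) count_cat (drop_nth 0 kw) /=.
  have -> : nth 0 w k != s by have := nth_find 0 (_ : has (predC1 s) w); rewrite has_find => /(_ kw).
  by rewrite addnCA add1n ltnS => h; apply: leq_trans h; rewrite leq_addl.
rewrite size_drop; move: szw kM; rewrite mulSn; lia.
Qed.

Lemma lspan_dim_lt S T : S `<=` T -> (exists2 s, T s & ~ lspan S s) ->
  (\dim (vspan S) < \dim (vspan T))%N.
Proof.
move=> ST [s Ts nSs]; have le : (vspan S <= vspan T)%VS.
  by apply: (vspanP _).2 => x /ST; exact: (vspanP _).1.
rewrite ltn_neqAle dimvS // andbT; apply/negP => /eqP e.
have /eqP eST : vspan S == vspan T by rewrite eqEdim le e leqnn.
by apply: nSs; apply/mem_vspan_lspan; rewrite eST; apply/mem_vspan_lspan; exact: sub_lspan.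
Qed.

(* Jacobson's theorem on weakly closed sets: if a maximal subset with nilpotent words
   did not span S, [normalizing_element] would enlarge it. *)
Lemma weakly_closed_nilpotent S : comm_closed S ->
  (forall s, S s -> exists m, s ^+ m = 0) -> exists N, nil_words S N.
Proof.
move=> cS nilS.
pose P T := [/\ T `<=` S, comm_closed T & exists N, nil_words T N].
pose p k := `[< exists T, P T /\ \dim (vspan T) = k >].
have exp : exists k, p k.
  exists (\dim (vspan (set0 : set R))); apply/asboolP; exists set0; split=> //; split=> //.
  exists 1%N => -[//|x w] lw _; have := lw x; rewrite mem_head => h.
  by case: (h isT).
have ubp k : p k -> (k <= \dim (fullv : {vspace R}))%N.
  by move=> /asboolP[T [_ <-]]; exact/dimvS/subvf.
case: (ex_maxnP exp ubp) => k /asboolP[T0 [[T0S cT0 [N nT0]] dT0]] maxk.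
(* Saturating T0 inside S makes T' below closed: the commutators of T with s lie in S and in the
   span of T0, hence in T. *)
pose T := S `&` lspan T0.
have T0T : T0 `<=` T by move=> x T0x; split; [exact: T0S | exact: sub_lspan].
have lT : lspan T = lspan T0.
  apply/seteqP; split; last exact: lspan_mono.
  by apply: lspan_le; [exact: subspace_lspan | move=> x []].
have nT : nil_words T N.
  by move=> w lw; apply: (nil_words_lspan nT0) => x /lw[].
have cT : comm_closed T.
  move=> s t [Ss Ts] [St Tt]; split; first exact: cS.
  exact: comm_closed_lspan.
have [ST|nST] := pselect (S `<=` lspan T).
  exists N => w lw; apply: nT => x xw; split; first exact: lw.
  by rewrite -lT; apply: ST; exact: lw.
have exs : exists2 s, S s & ~ lspan T s.
  apply: contrapT => h; apply: nST => s Ss; apply: contrapT => ns; apply: h.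
  by exists s.
have [s [Ss ns] ts] := normalizing_element cS (fun x => @proj1 _ _) nT exs.
pose T' := [set x | T x \/ x = s].
have T'S : T' `<=` S by move=> x [[]//|->].
have S0 : S 0 by have := cS s s Ss Ss; rewrite subrr.
have T_0 : T 0 by split=> //; exact: sub0 (subspace_lspan _).
have TS x : S x -> lspan T x -> T x by move=> Sx; rewrite lT.
have cT' : comm_closed T'.
  move=> x y [Tx|->] [Ty|->].
  - by left; exact: cT.
  - by left; apply: TS; [apply: cS => //; case: Tx | exact: ts].
  - left; apply: TS; first by apply: cS => //; case: Ty.
    by rewrite -opprB; apply: (subN (subspace_lspan _)); exact: ts.
  - by left; rewrite subrr.
have [M sM] := nilS s Ss.
(* A word with at least N letters other than s vanishes after its letters s are moved to the left; a
   word with at most N of them and this length contains M consecutive letters s. *)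
have nT' : nil_words T' (N.+1 * M)%N.
  move=> w lw sw; have [le|/ltnW lt] := leqP (count (predC1 s) w) N; last first.
    have := word_sorted cT ts lw; apply: (lspan_le subspace0).
    move=> _ [i [u [lu su ->]]] /=.
    by rewrite (nil_words_lspan nT lu) ?mulr0 // su.
  exact: word_block sM le sw.
have /maxk : p (\dim (vspan T')).
  by apply/asboolP; exists T'; split=> //; split=> //; exists (N.+1 * M)%N.
rewrite leqNgt -dT0 => /negP[]; apply: lspan_dim_lt.
  by move=> x /T0T Tx; left.
by exists s; [right | rewrite -lT].
Qed.

(* The powers of X are eigenvectors of ad H with distinct eigenvalues. *)
Lemma power_nilpotent (H X : R) c : (forall m : nat, m%:R = 0 :> K -> m = 0%N) -> c != 0 ->
  H * X - X * H = c *: X -> exists m, X ^+ m = 0.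
Proof.
move=> ch0 c0 HX.
have [||m Xm] := eigen_contra (f := fun Z => H * Z - Z * H) (v := fun k => X ^+ k)
    (a := fun k => k%:R * c) (comm_lin H); last by exists m.
  move=> i j /(mulIf c0) e; wlog ij : i j e / (i <= j)%N.
    by move=> h; case: (leqP i j) => [/h|/ltnW/h/esym]; apply.
  have /ch0/eqP : (j - i)%N%:R = 0 :> K by rewrite natrB // e subrr.
  by rewrite subn_eq0 => ji; apply/eqP; rewrite eqn_leq ij.
elim=> [|k IH]; first by rewrite expr0 mulr1 mul1r subrr mul0r scale0r.
rewrite exprS; have -> : H * (X * X ^+ k) - X * X ^+ k * H =
    (H * X - X * H) * X ^+ k + X * (H * X ^+ k - X ^+ k * H).
  by rewrite mulrBl mulrBr !mulrA addrA subrK.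
by rewrite HX IH -scalerAl -scalerAr -scalerDl -[in RHS]natr1 mulrDl mul1r addrC.
Qed.

End WeaklyClosed.

(** Engel's argument: among the words whose product does not kill [v0], whose lengths are bounded,
    take a longest one. Every further letter kills the vector it produces. *)
Lemma common_kernel (K : fieldType) n (S : set 'M[K]_n.+1) : comm_closed S ->
  (forall s, S s -> exists m, s ^+ m = 0) ->
  exists2 v : 'rV[K]_n.+1, v != 0 & forall s, S s -> v *m s = 0.
Proof.
move=> cS nilS; have [N nS] := weakly_closed_nilpotent cS nilS.
pose v0 : 'rV[K]_n.+1 := delta_mx 0 0.
have v0n : v0 != 0.
  by apply/eqP => /matrixP/(_ 0 0)/eqP; rewrite !mxE !eqxx oner_eq0.
pose p k := `[< exists w : seq 'M[K]_n.+1, [/\ letters S w, size w = k & v0 *m \prod_(x <- w) x != 0] >].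
have exp : exists k, p k.
  by exists 0; apply/asboolP; exists [::]; split=> //; rewrite big_nil mulmx1.
have ubp k : p k -> (k <= N)%N.
  move=> /asboolP[w [lw <- nz]]; rewrite leqNgt; apply/negP => lt.
  by move: nz; rewrite (nS w lw (ltnW lt)) mulmx0 eqxx.
case: (ex_maxnP exp ubp) => k /asboolP[w [lw sw nz]] maxk.
exists (v0 *m \prod_(x <- w) x) => // s Ss; apply: contrapT => /eqP ns.
have /maxk : p k.+1.
  apply/asboolP; exists (rcons w s); split.
  - by move=> z; rewrite mem_rcons => zw; move: z zw; apply/letters_cons.
  - by rewrite size_rcons sw.
  - by rewrite big_rcons /= mulmxA.
by rewrite ltnn.
Qed.

(** * Common eigenvectors and representations of sl2 *)

Section CommonEigenvector.
Variables (K : numClosedFieldType) (V : vectType K).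

Lemma eigenvector_in (f : V -> V) (U : {vspace V}) : linear f -> U != 0%VS ->
  (forall u, u \in U -> f u \in U) ->
  exists a v, [/\ v \in U, v != 0 & f v = a *: v].
Proof.
move=> lf U0 fU; pose b := vbasis U; have bP := vbasisP U; rewrite -/b in bP.
have fb := basis_free bP.
pose m : 'M[K]_(\dim U) := \matrix_(i, j) coord b j (f b`_i).
have d0 : (0 < \dim U)%N by rewrite lt0n dimv_eq0.
have [a /eigenvalueP[w wm w0]] := eigenvalue_closed m d0.
have bU (i : 'I_(\dim U)) : b`_i \in U by apply/(basis_mem bP)/mem_nth; rewrite size_tuple.
exists a, (\sum_i w 0 i *: b`_i); split.
- by apply: memv_suml => i _; exact: memvZ.
- apply: contra w0 => /eqP e; apply/eqP/rowP => i; rewrite mxE.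
  by have := coord_sum_free (fun i => w 0 i) i fb; rewrite e linear0 => <-.
rewrite (lin_sum _ _ _ lf) scaler_sumr.
transitivity (\sum_i \sum_j (w 0 i * m i j) *: b`_j).
  apply: eq_bigr => i _; rewrite (linZ lf) [f _](coord_basis bP (fU _ (bU i))).
  by rewrite scaler_sumr; apply: eq_bigr => j _; rewrite scalerA mxE.
rewrite exchange_big; apply: eq_bigr => j _ /=; rewrite -scaler_suml scalerA.
by congr (_ *: _); have /rowP/(_ j) := wm; rewrite !mxE.
Qed.

(** In a nonzero stable subspace W of least dimension, an eigenspace of any f in T is stable by
    commutativity and hence all of W. *)
Lemma common_eigenvector_in (T : set (V -> V)) (U : {vspace V}) :
  (forall f, T f -> linear f) ->
  (forall f g v, T f -> T g -> f (g v) = g (f v)) -> U != 0%VS ->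
  (forall f u, T f -> u \in U -> f u \in U) ->
  exists v, [/\ v \in U, v != 0 & forall f, T f -> exists a, f v = a *: v].
Proof.
move=> lT cT U0 TU.
pose P W := [/\ W != 0%VS, (W <= U)%VS & forall f u, T f -> u \in W -> f u \in W].
pose p k := `[< exists W, P W /\ \dim W = k >].
have exp : exists k, p k by exists (\dim U); apply/asboolP; exists U.
case: (ex_minnP exp) => k /asboolP[W [[W0 WU TW] dW]] mink.
have [v vW v0] : exists2 v, v \in W & v != 0.
  by exists (vpick W); [exact: memv_pick | rewrite vpick0].
exists v; split=> //; first exact: (subvP WU).
move=> f Tf; have [a [u [uW u0 fu]]] := eigenvector_in (lT f Tf) W0 (fun u => TW f u Tf).
exists a; pose W1 := vspan [set w | w \in W /\ f w = a *: w].
have W1E w : w \in W1 <-> w \in W /\ f w = a *: w.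
  apply: (mem_vspan (A := [set w | w \in W /\ f w = a *: w])).
  split=> /= [|c x y [xW fx] [yW fy]].
    by rewrite mem0v (lin0 (lT f Tf)) scaler0.
  rewrite memvD ?memvZ // (lT f Tf) fx fy scalerDr !scalerA mulrC.
  by split.
have W1W : (W1 <= W)%VS by apply/subvP => w /W1E[].
have /mink : p (\dim W1).
  apply/asboolP; exists W1; split=> //; split.
  - apply: contra u0 => /eqP e; rewrite -memv0 -e; exact/W1E.
  - exact: subv_trans WU.
  - move=> h w Th /W1E[wW fw]; apply/W1E; split; first exact: TW.
    by rewrite (cT f h w Tf Th) fw (linZ (lT h Th)).
rewrite -dW => le; have /eqP e : W1 == W by rewrite eqEdim W1W.
have : v \in W1 by rewrite e.
by case/W1E.
Qed.

End CommonEigenvector.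

(** The formula E F^(k+1) v = (k+1) (mu - k) F^k v is evaluated at the first vanishing power of F.
    Its base case asks only for F (E v) = 0 instead of E v = 0, which is the form available in
    [root_space_line]. *)
Lemma sl2_highest_weight (K : fieldType) (V : vectType K) (E F H : V -> V) mu v :
  (forall m : nat, m%:R = 0 :> K -> m = 0%N) -> linear E -> linear F -> linear H ->
  (forall u, E (F u) = F (E u) + H u) -> (forall u, H (F u) = F (H u) - 2%:R *: F u) ->
  v != 0 -> H v = mu *: v -> F (E v) = 0 -> exists n : nat, mu = n%:R.
Proof.
move=> ch0 lE lF lH EF HF v0 Hv FEv.
have natI : injective (fun n : nat => n%:R : K).
  move=> i j e; wlog ij : i j e / (i <= j)%N.
    by move=> h; case: (leqP i j) => [/h|/ltnW/h/esym]; apply.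
  have /ch0/eqP : (j - i)%N%:R = 0 :> K by rewrite natrB // e subrr.
  by rewrite subn_eq0 => ji; apply/eqP; rewrite eqn_leq ij.
have two : 2%:R != 0 :> K by apply/eqP => /ch0.
have HFk k : H (iter k F v) = (mu - 2%:R * k%:R) *: iter k F v.
  elim: k => [|k IH]; first by rewrite mulr0 subr0.
  by rewrite iterS HF IH (linZ lF) -scalerBl; congr (_ *: _); rewrite -natr1; ring.
have EFk k : E (iter k.+1 F v) = (k.+1%:R * (mu - k%:R)) *: iter k F v.
  elim: k => [|k IH]; first by rewrite /= EF FEv add0r Hv subr0 mul1r.
  rewrite iterS EF IH (linZ lF) HFk -iterS -scalerDl; congr (_ *: _).
  by rewrite -[k.+2%:R]natr1 -[k.+1%:R]natr1; ring.
have ex : exists k, iter k F v == 0.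
  have [||k /eqP Fk] := eigen_contra (f := H) (v := fun k => iter k F v)
    (a := fun k => mu - 2%:R * k%:R) lH; [|exact: HFk|by exists k].
  by move=> i j /addrI/oppr_inj/(mulfI two)/natI.
case: (ex_minnP ex) => -[|k] /eqP Fk mink; first by move: v0; rewrite -[v]/(iter 0 F v) Fk eqxx.
exists k; have := EFk k; rewrite Fk (lin0 lE) => /esym/eqP; rewrite scaler_eq0 mulf_eq0.
have /negbTE -> : k.+1%:R != 0 :> K by apply/eqP => /ch0.
have /negbTE -> : iter k F v != 0.
  by apply/negP => /mink; rewrite ltnn.
by rewrite orbF subr_eq0 => /eqP.
Qed.

(** * The parabolic subalgebra *)

Section SpaceLemmas.
Variables (K : fieldType) (g : superalg K).
Implicit Types U V W : {vspace g}.

Lemma daddv_pi_sum (T : vectType K) (U V : {vspace T}) u v : (U :&: V = 0)%VS ->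
  u \in U -> v \in V -> daddv_pi U V (u + v) = u.
Proof.
move=> UV0 uU vV; rewrite linearD /= (daddv_pi_id UV0 uU).
have VU0 : (V :&: U = 0)%VS by rewrite capvC.
have := daddv_pi_add UV0 (subvP (addvSr U V) _ vV).
rewrite (daddv_pi_id VU0 vV) => h.
by rewrite (_ : daddv_pi U V v = 0) ?addr0 //; apply: (addIr v); rewrite h add0r.
Qed.

Hypothesis HA : lie_superalgebra g.

Lemma mem_brs U V x y : x \in U -> y \in V -> br x y \in brs U V.
Proof. by move=> xU yV; apply: (vspanP _).1; exists x, y. Qed.

Lemma brs_le U V W : (forall x y, x \in U -> y \in V -> br x y \in W) ->
  (brs U V <= W)%VS.
Proof. by move=> h; apply: (vspanP _).2 => _ [x [y [xU yV ->]]]; exact: h. Qed.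

Lemma vspan_mem (A : set g) x : A x -> x \in vspan A.
Proof. exact: (vspanP A).1. Qed.

Lemma vspan_ind (A S : set g) : subspace S -> A `<=` S -> forall x, x \in vspan A -> S x.
Proof. by move=> sS AS x /mem_vspan_lspan; exact: lspan_le. Qed.

Lemma subspace_vspace V : subspace [set` V].
Proof. by split=> [|a u v /= uV vV]; rewrite /= ?mem0v ?memvD ?memvZ. Qed.

Lemma vspan_br (A B : set g) W : (forall a b, A a -> B b -> br a b \in W) ->
  forall x y, x \in vspan A -> y \in vspan B -> br x y \in W.
Proof.
move=> h x y xA yB.
apply: (vspan_ind (S := [set x | br x y \in W]) _ _ xA).
  exact: (subspace_preim (br_linl HA y) (subspace_vspace W)).
move=> a Aa; apply: (vspan_ind (S := [set y | br a y \in W]) _ _ yB).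
  exact: (subspace_preim (br_linr HA a) (subspace_vspace W)).
by move=> b Bb; exact: h.
Qed.

Definition parity_graded U := forall x, x \in U -> exists x0 x1,
  [/\ x0 \in (U :&: part g false)%VS, x1 \in (U :&: part g true)%VS & x = x0 + x1].

Lemma parity_graded_vspan (A : set g) :
  (forall x, A x -> exists x0 x1, [/\ x0 \in part g false, x1 \in part g true,
     A x0, A x1 & x = x0 + x1]) -> parity_graded (vspan A).
Proof.
move=> h x; apply: (vspan_ind (S := [set x | exists x0 x1,
  [/\ x0 \in (vspan A :&: part g false)%VS, x1 \in (vspan A :&: part g true)%VS & x = x0 + x1]])).
  split=> [|a _ _ [u0 [u1 [hu0 hu1 ->]]] [v0 [v1 [hv0 hv1 ->]]]] /=.
    by exists 0, 0; rewrite !mem0v addr0.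
  exists (a *: u0 + v0), (a *: u1 + v1).
  by rewrite scalerDr addrACA !memvD // memvZ.
move=> y /h [x0 [x1 [h0 h1 A0 A1 ->]]]; exists x0, x1.
by rewrite !memv_cap !vspan_mem.
Qed.

(** The components of u and v of the other parity add up to an element of both parities, that is to
    0, and [U :&: V = 0] makes each of them vanish. *)
Lemma parity_split U V a x u v : parity_graded U -> parity_graded V ->
  (U :&: V = 0)%VS -> x \in part g a -> u \in U -> v \in V -> x = u + v ->
  u \in part g a /\ v \in part g a.
Proof.
move=> gU gV UV0 xa /gU[u0 [u1 []]] /[!memv_cap] /andP[u0U u00] /andP[u1U u11] ->.
move=> /gV[v0 [v1 []]] /[!memv_cap] /andP[v0V v00] /andP[v1V v11] -> e.
have key y z : y \in U -> z \in V -> y + z = 0 -> y = 0 /\ z = 0.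
  move=> yU zV yz; have yz' : y = - z by apply/eqP; rewrite -addr_eq0 yz.
  have y0 : y = 0 by apply/eqP; rewrite -memv0 -UV0 memv_cap yU yz' memvN.
  by split=> //; rewrite -[z]opprK -yz' y0 oppr0.
case: a xa => xa.
  have [-> ->] : u0 = 0 /\ v0 = 0; last by rewrite !add0r.
  apply: key => //; apply: (part_cap HA); first by rewrite memvD.
  have -> : u0 + v0 = x - (u1 + v1) by rewrite e addrACA addrK.
  by rewrite memvB // memvD.
have [-> ->] : u1 = 0 /\ v1 = 0; last by rewrite !addr0.
apply: key => //; apply: (part_cap HA); last by rewrite memvD.
have -> : u1 + v1 = x - (u0 + v0) by rewrite e addrACA [_ + (u1 + v1)]addrC addrK.
by rewrite memvB // memvD.
Qed.

End SpaceLemmas.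

Section Graded.
Import Order.TTheory Num.Theory.
Variables (K : fieldType) (g : superalg K) (gr : int -> {vspace g}).
Hypothesis HA : lie_superalgebra g.
Hypothesis HZ : Z_grading gr.
Local Notation levi := (levi gr).
Local Notation mplus := (mplus gr).
Local Notation parab := (parab gr).

Lemma gr_br i j x y : x \in gr i -> y \in gr j -> br x y \in gr (i + j)%R.
Proof. by case: HZ => _ h _ _ xi yj; apply: (subvP (h i j)); exact: mem_brs. Qed.

Lemma gr_parity i : parity_graded (gr i).
Proof.
case: HZ => h _ _ _ x; rewrite {1}h => /memv_addP[x0 hx0 [x1 hx1 ->]].
by exists x0, x1.
Qed.

(** The graded complement of [levi], with degrees of both signs: root vectors of weight - al are
    later projected to degree 0 along it. *)
Definition gr_nonzero : {vspace g} := vspan (\bigcup_(i in [set i : int | i != 0]) [set` gr i]).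

Lemma bigcup_parity (I : set int) : parity_graded (vspan (\bigcup_(i in I) [set` gr i])).
Proof.
apply: parity_graded_vspan => x [i Ii xi].
have [x0 [x1 []]] := gr_parity xi; rewrite !memv_cap => /andP[x0i x00] /andP[x1i x11] ->.
by exists x0, x1; split=> //; exists i.
Qed.

Lemma mplus_sub x : x \in mplus -> x \in gr_nonzero.
Proof.
apply: (vspan_ind (S := [set` gr_nonzero])); first exact: subspace_vspace.
move=> y [i /= i0 yi]; apply: vspan_mem; exists i => //=.
by apply/eqP => e; rewrite e ltxx in i0.
Qed.

Lemma gr_nonzero_sum x : x \in gr_nonzero -> exists (s : seq int) (f : int -> g),
  [/\ uniq s, 0 \notin s, forall i, f i \in gr i, forall i, i \notin s -> f i = 0
    & x = \sum_(i <- s) f i].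
Proof.
apply: (vspan_ind (S := [set x | exists (s : seq int) (f : int -> g),
  [/\ uniq s, 0 \notin s, forall i, f i \in gr i, forall i, i \notin s -> f i = 0
    & x = \sum_(i <- s) f i]])).
  split=> [|a _ _ [s [f [us s0 fi fs ->]]] [s' [f' [us' s0' fi' fs' ->]]]] /=.
    exists [::], (fun=> 0); split=> // [i|]; first exact: mem0v.
    by rewrite big_nil.
  pose t := undup (s ++ s'); exists t, (fun i => a *: f i + f' i).
  have ext (r : seq int) (F : int -> g) : uniq r -> {subset r <= t} ->
      (forall i, i \notin r -> F i = 0) -> \sum_(i <- r) F i = \sum_(i <- t) F i.
    move=> ur rt F0; rewrite [RHS](bigID (mem r)) /= [X in _ + X]big1 ?addr0; last first.
      by move=> i /F0.
    rewrite -[RHS]big_filter; apply: perm_big; apply: uniq_perm => //.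
      by rewrite filter_uniq ?undup_uniq.
    by move=> i; rewrite mem_filter /= andb_idr // => /rt.
  have mt i : (i \in t) = (i \in s) || (i \in s') by rewrite mem_undup mem_cat.
  split.
  - exact: undup_uniq.
  - by rewrite mt negb_or s0.
  - by move=> i; rewrite memvD ?memvZ.
  - by move=> i; rewrite mt negb_or => /andP[/fs-> /fs'->]; rewrite scaler0 addr0.
  rewrite (ext s f) ?(ext s' f') //; first last.
  - by move=> i; rewrite mt => ->.
  - by move=> i; rewrite mt => ->; rewrite orbT.
  by rewrite scaler_sumr big_split.
move=> y [i /= i0 yi]; exists [:: i], (fun j => if j == i then y else 0); split=> //.
- by rewrite inE eq_sym.
- by move=> j; case: eqP => [->//|_]; rewrite mem0v.
- by move=> j; rewrite inE => /negbTE->.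
- by rewrite big_seq1 eqxx.
Qed.

Lemma levi_nonzero_cap : (levi :&: gr_nonzero = 0)%VS.
Proof.
apply/eqP; rewrite -subv0; apply/subvP => x; rewrite memv_cap => /andP[x0].
move=> /gr_nonzero_sum[s [f [us s0 fi fs xE]]]; rewrite memv0.
case: HZ => _ _ _ /(_ (0 :: s) (fun i => if i == 0 then - x else f i)) H.
have := H _ _ _ 0; rewrite mem_head eqxx => h; rewrite -oppr_eq0; apply/eqP/h => //.
- by rewrite /= s0.
- by move=> i; case: eqP => [->|_]; rewrite ?memvN.
rewrite big_cons eqxx big_seq (eq_bigr f) -?big_seq -?xE ?addNr //.
by move=> i si; case: eqP => // e; rewrite e (negbTE s0) in si.
Qed.

Lemma levi_nonzero_add : (levi + gr_nonzero)%VS = fullv.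
Proof.
apply/eqP; rewrite eqEsubv subvf /=; case: HZ => _ _ <- _.
apply: (vspanP _).2 => x [i _ /= xi]; have [e|i0] := eqVneq i 0.
  by apply: (subvP (addvSl _ _)); rewrite /Defs.levi -e.
by apply: (subvP (addvSr _ _)); apply: vspan_mem; exists i.
Qed.

Lemma levi_br x y : x \in levi -> y \in levi -> br x y \in levi.
Proof. by move=> xl yl; have := gr_br xl yl; rewrite addr0. Qed.

Lemma levi_nonzero_br x y : x \in levi -> y \in gr_nonzero -> br x y \in gr_nonzero.
Proof.
move=> xl; apply: (vspan_ind (S := [set y | br x y \in gr_nonzero])).
  exact: (subspace_preim (br_linr HA x) (subspace_vspace _)).
move=> z [i /= i0 zi]; apply: vspan_mem; exists i => //.
by have := gr_br xl zi; rewrite add0r.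
Qed.

Lemma levi_mplus_br x y : x \in levi -> y \in mplus -> br x y \in mplus.
Proof.
move=> xl; apply: (vspan_ind (S := [set y | br x y \in mplus])).
  exact: (subspace_preim (br_linr HA x) (subspace_vspace _)).
move=> z [i /= i0 zi]; apply: vspan_mem; exists i => //.
by have := gr_br xl zi; rewrite add0r.
Qed.

Lemma mplus_levi_br x y : x \in mplus -> y \in levi -> br x y \in mplus.
Proof.
move=> xm yl; move: x xm; apply: (vspan_ind (S := [set x | br x y \in mplus])).
  exact: (subspace_preim (br_linl HA y) (subspace_vspace _)).
move=> z [i /= i0 zi]; apply: vspan_mem; exists i => //.
by have := gr_br zi yl; rewrite addr0.
Qed.

Lemma mplus_br x y : x \in mplus -> y \in mplus -> br x y \in mplus.
Proof.
apply: (vspan_br HA) => a b [i /= i0 ai] [j /= j0 bj]; apply: vspan_mem.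
by exists (i + j)%R => /=; [exact: addr_gt0 | exact: gr_br].
Qed.

Lemma levi_mplus_cap : (levi :&: mplus = 0)%VS.
Proof.
apply/eqP; rewrite -subv0 -levi_nonzero_cap; apply: capvS; first exact: subvv.
by apply/subvP => x; exact: mplus_sub.
Qed.

Lemma parab_dec x : x \in parab -> exists l m, [/\ l \in levi, m \in mplus & x = l + m].
Proof. by move=> /memv_addP[l hl [m hm ->]]; exists l, m. Qed.

Lemma levi_parab x : x \in levi -> x \in parab.
Proof. by apply/subvP; exact: addvSl. Qed.

Lemma mplus_parab x : x \in mplus -> x \in parab.
Proof. by apply/subvP; exact: addvSr. Qed.

Lemma mplus_parab_br x y : x \in mplus -> y \in parab -> br x y \in mplus.
Proof.
move=> xm /parab_dec[l [m [hl hm ->]]]; rewrite (linD (br_linr HA x)).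
by apply: memvD; [exact: mplus_levi_br | exact: mplus_br].
Qed.

Lemma parab_br_split l m l' m' : l \in levi -> m \in mplus -> l' \in levi -> m' \in mplus ->
  exists2 r, r \in mplus & br (l + m) (l' + m') = br l l' + r.
Proof.
move=> hl hm hl' hm'; exists (br l m' + br m (l' + m')); last first.
  by rewrite (linD (br_linl HA _)) (linD (br_linr HA l)) addrA.
apply: memvD; first exact: levi_mplus_br.
apply: mplus_parab_br => //; apply: memvD; [exact: levi_parab | exact: mplus_parab].
Qed.

Lemma parab_br x y : x \in parab -> y \in parab -> br x y \in parab.
Proof.
move=> /parab_dec[l [m [hl hm ->]]] /parab_dec[l' [m' [hl' hm' ->]]].
have [r hr ->] := parab_br_split hl hm hl' hm'.
by apply: memvD; [apply/levi_parab/levi_br | exact: mplus_parab].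
Qed.

Lemma levi_parity : parity_graded levi. Proof. exact: gr_parity. Qed.
Lemma mplus_parity : parity_graded mplus. Proof. exact: bigcup_parity. Qed.
Lemma gr_nonzero_parity : parity_graded gr_nonzero. Proof. exact: bigcup_parity. Qed.

Lemma parab_split a x : x \in parab -> x \in part g a -> exists l m,
  [/\ l \in (levi :&: part g a)%VS, m \in (mplus :&: part g a)%VS & x = l + m].
Proof.
move=> /parab_dec[l [m [hl hm xE]]] xa.
have [la ma] := parity_split HA levi_parity mplus_parity levi_mplus_cap xa hl hm xE.
by exists l, m; rewrite !memv_cap hl hm.
Qed.

Lemma parab_parity : parity_graded parab.
Proof.
move=> _ /parab_dec[l [m [/levi_parity[l0 [l1 [h1 h2 ->]]] /mplus_parity[m0 [m1 [h3 h4 ->]]] ->]]].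
exists (l0 + m0), (l1 + m1); move: h1 h2 h3 h4; rewrite !memv_cap addrACA.
move=> /andP[a1 a2] /andP[b1 b2] /andP[c1 c2] /andP[d1 d2].
by split=> //; rewrite !memvD // ?(levi_parab a1) ?(levi_parab b1) ?mplus_parab.
Qed.

Lemma levi0_mplus0 : (levi0 gr + mplus0 gr)%VS = parab0 gr.
Proof.
apply/eqP; rewrite eqEsubv; apply/andP; split.
  apply/subvP => _ /memv_addP[l + [m + ->]]; rewrite !memv_cap => /andP[l1 l2] /andP[m1 m2].
  by rewrite !memvD // ?(levi_parab l1) ?(mplus_parab m1).
apply/subvP => x; rewrite memv_cap => /andP[xp x0].
by have [l [m [hl hm ->]]] := parab_split xp x0; rewrite memv_add.
Qed.

Lemma levi0_mplus0_cap : (levi0 gr :&: mplus0 gr)%VS = 0%VS.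
Proof.
apply/eqP; rewrite -subv0 -levi_mplus_cap; apply: capvS; exact: capvSl.
Qed.

Section Inflation.
Variables (L : lmodType K) (act : sub levi -> L -> L).
Hypothesis modL : is_module act.

(** Since [mplus] is an ideal of [parab], the projection onto [levi] along it respects brackets, and
    by [parab_split] it respects parity. *)
Lemma inflate_module : is_module (inflate mplus (P := parab) act).
Proof.
split.
  split=> [v a x y|x a v w]; last by rewrite /inflate modL.1.2.
  have lin : linear (fun x : subvs_of parab => vsproj levi (daddv_pi levi mplus (vsval x))).
    by move=> c u w; rewrite !linearP.
  by rewrite /inflate (lin a x y); exact: modL.1.1.
move=> a b x y v xa yb; rewrite /inflate.
have [l [m [+ + xE]]] := parab_split (subvsP x) (eq_ind _ is_true xa _ (sub_partE _ _)).
have [l' [m' [+ + yE]]] := parab_split (subvsP y) (eq_ind _ is_true yb _ (sub_partE _ _)).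
rewrite !memv_cap => /andP[ll' la'] /andP[mm' _] /andP[ll la] /andP[mm _].
have brp : br (vsval x) (vsval y) \in parab by apply: parab_br; exact: subvsP.
have -> : vsval (br x y) = br (vsval x) (vsval y) by exact: sub_brE.
have [r rm ->] : exists2 r, r \in mplus & br (vsval x) (vsval y) = br l l' + r.
  by rewrite xE yE; exact: parab_br_split.
rewrite xE yE !(daddv_pi_sum levi_mplus_cap) ?levi_br //.
have -> : vsproj levi (br l l') = @br _ (sub levi) (vsproj levi l) (vsproj levi l').
  by rewrite /= !vsprojK.
by apply: modL.2; rewrite sub_partE vsprojK.
Qed.

End Inflation.

End Graded.

(** Letters below nx are even and precede the odd ones, so an even word followed by an increasing
    odd word is an ordered word of the independence result. *)
Lemma okw_cat n0 par nx s t : (nx <= n0)%N -> (forall i, (i < nx)%N -> par i = false) ->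
  xword nx s -> yword nx n0 t -> okw n0 par (s ++ t).
Proof.
move=> le px /andP[ss sn] /andP[ts tn]; apply/andP; split; last first.
  rewrite all_cat; apply/andP; split.
    by apply: sub_all sn => i /= h; apply: leq_trans le.
  by apply: sub_all tn => i /= /andP[].
rewrite (sorted_pairwise (@allow_trans par)) pairwise_cat; apply/and3P; split.
- apply/allrelP => i j /(allP sn) /= ix /(allP tn) /= /andP[jx _].
  by rewrite /allow (leq_trans ix jx).
- rewrite -(sorted_pairwise (@allow_trans par)).
  case: s ss sn => //= i s; elim: s i => //= j s IH i /andP[ij js] /andP[ix sx].
  rewrite IH // andbT /allow; move: ij; rewrite leq_eqVlt => /orP[/eqP <-|->//].
  by rewrite eqxx px ?orbT.
- move: ts; rewrite (sorted_pairwise ltn_trans); apply: sub_pairwise => i j ij.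
  by rewrite /allow ij.
Qed.

Lemma vbasis_sum (K : fieldType) (V : vectType K) (U : {vspace V}) u : u \in U ->
  exists c : nat -> K, u = \sum_(i < \dim U) c i *: (vbasis U)`_i.
Proof.
move=> uU; exists (fun i => oapp (fun j => coord (vbasis U) j u) 0 (insub i)).
by rewrite {1}(coord_vbasis uU); apply: eq_bigr => i _; rewrite valK.
Qed.

(** * A homogeneous basis adapted to the parabolic subalgebra *)

Section AdaptedBasis.
Variables (K : fieldType) (g : superalg K) (B : {vspace g}).
Hypothesis HA : lie_superalgebra g.
Hypothesis gB : parity_graded B.
Local Notation g0 := (part g false).
Local Notation g1 := (part g true).

(** The basis lists complements of B in g0 and in g1, and then bases of the even and of the odd part
    of B; [nx] and [n0] mark the ends of the first two segments. Coordinates below [n0] vanish on B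
    because B is the sum of its homogeneous parts. *)
Lemma adapted_basis : exists (nx n0 nn : nat) (X : nn.-tuple g) (par : nat -> bool),
  [/\ [/\ (nx <= n0)%N, (n0 <= nn)%N & (n0 - nx = \dim g1 - \dim (B :&: g1))%N],
      basis_of fullv X,
      [/\ forall k, (k < nn)%N -> X`_k \in part g (par k),
        forall k, (n0 <= k < nn)%N -> X`_k \in B
      & forall b, b \in B -> forall k : 'I_nn, (k < n0)%N -> coord X k b = 0],
      (forall k, (k < nx)%N -> par k = false) /\
        (forall k, (nx <= k < n0)%N -> par k = true)
    & (forall x, x \in g0 -> exists (c : nat -> K) b,
        b \in (B :&: g0)%VS /\ x = \sum_(i < nx) c i *: X`_i + b) /\
      (forall x, x \in g1 -> exists (c : nat -> K) b,
        (b \in B /\ b \in g1) /\ x = \sum_(nx <= i < n0) c i *: X`_i + b)].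
Proof.
pose C0 := (g0 :\: B)%VS; pose C1 := (g1 :\: B)%VS.
pose B0 := (B :&: g0)%VS; pose B1 := (B :&: g1)%VS.
have E0 : (C0 + B0 = g0)%VS by rewrite /C0 /B0 capvC addv_diff_cap.
have E1 : (C1 + B1 = g1)%VS by rewrite /C1 /B1 capvC addv_diff_cap.
have D0 : (\dim B0 + \dim C0 = \dim g0)%N by rewrite /B0 capvC dimv_cap_compl.
have D1 : (\dim B1 + \dim C1 = \dim g1)%N by rewrite /B1 capvC dimv_cap_compl.
pose nx := \dim C0; pose n0 := (\dim C0 + \dim C1)%N.
pose X := [tuple of vbasis C0 ++ vbasis C1 ++ vbasis B0 ++ vbasis B1].
pose nn := (\dim C0 + (\dim C1 + (\dim B0 + \dim B1)))%N.
pose par k := [&& (nx <= k)%N & (k < n0)%N || (n0 + \dim B0 <= k)%N].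
have X0 i : (i < \dim C0)%N -> X`_i = (vbasis C0)`_i.
  by move=> h; rewrite nth_cat size_tuple h.
have X1 i : (i < \dim C1)%N -> X`_(\dim C0 + i) = (vbasis C1)`_i.
  move=> h; rewrite nth_cat size_tuple ltnNge leq_addr /= addKn.
  by rewrite nth_cat size_tuple h.
have X2 i : (i < \dim B0)%N -> X`_(n0 + i) = (vbasis B0)`_i.
  move=> h; rewrite nth_cat size_tuple ltnNge /n0 -addnA leq_addr /= addKn.
  by rewrite nth_cat size_tuple ltnNge leq_addr /= addKn nth_cat size_tuple h.
have X3 i : X`_(n0 + \dim B0 + i) = (vbasis B1)`_i.
  rewrite nth_cat size_tuple ltnNge /n0 -!addnA leq_addr /= addKn.
  rewrite nth_cat size_tuple ltnNge leq_addr /= addKn.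
  by rewrite nth_cat size_tuple ltnNge leq_addr /= addKn.
have vb (U : {vspace g}) i : (i < \dim U)%N -> (vbasis U)`_i \in U.
  by move=> h; apply/vbasis_mem/mem_nth; rewrite size_tuple.
have subC0 : (C0 <= g0)%VS by rewrite -E0 addvSl.
have subC1 : (C1 <= g1)%VS by rewrite -E1 addvSl.
have bX : basis_of fullv X.
  rewrite basisEdim size_tuple; case: HA => _ [gE gI] _ _ _; apply/andP; split; last first.
    have := dimv_sum_cap g0 g1; rewrite gE gI dimv0 addn0 => ->.
    by rewrite -D0 -D1 -!addnA leq_eqVlt; apply/orP; left; apply/eqP; lia.
  rewrite -gE -E0 -E1 !span_cat !(span_basis (vbasisP _)).
  rewrite !subv_add; apply/andP; split; apply/andP; split.
  - exact: addvSl.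
  - by apply: subv_trans (addvSr _ _); apply: subv_trans (addvSr _ _); exact: addvSl.
  - by apply: subv_trans (addvSr _ _); exact: addvSl.
  - by apply: subv_trans (addvSr _ _); apply: subv_trans (addvSr _ _); exact: addvSr.
have fX := basis_free bX.
have segment k : (k < nn)%N -> [\/ (k < nx)%N,
    exists2 i, (i < \dim C1)%N & k = (nx + i)%N,
    exists2 i, (i < \dim B0)%N & k = (n0 + i)%N
  | exists2 i, (i < \dim B1)%N & k = (n0 + \dim B0 + i)%N].
  move=> kn; have [h|h1] := ltnP k nx; first exact: Or41.
  have [h|h2] := ltnP k n0.
    by apply: Or42; exists (k - nx)%N; move: h h1; rewrite /n0 /nx; lia.
  have [h|h3] := ltnP k (n0 + \dim B0).
    by apply: Or43; exists (k - n0)%N; move: h h2; lia.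
  by apply: Or44; exists (k - (n0 + \dim B0))%N; move: kn h3; rewrite /nn /n0; lia.
have coordB : forall b : g, (exists (c : nat -> K) (i0 : nat), b = \sum_(i < i0) c i *: X`_(n0 + i) /\ (n0 + i0 <= nn)%N) ->
    forall k : 'I_nn, (k < n0)%N -> coord X k b = 0.
  move=> _ [c [i0 [-> le]]] k kn; rewrite linear_sum big1 // => i _; rewrite linearZ /=.
  have ln : (n0 + i < nn)%N by apply: leq_trans le; rewrite ltn_add2l.
  rewrite (coord_free (Ordinal ln)) //.
  by rewrite -val_eqE /= gtn_eqF ?mulr0 // (leq_trans kn) // leq_addr.
exists nx, n0, nn, X, par; split=> //.
- split; [exact: leq_addr | by rewrite /nn /n0; lia |].
  by rewrite /n0 /nx addKn -D1 addKn.
- split.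
  + move=> k /segment[h|[i h ->]|[i h ->]|[i h ->]].
    * by rewrite /par leqNgt h /= X0 // (subvP subC0) // vb.
    * by rewrite /par leq_addr ltn_add2l h /= X1 // (subvP subC1) // vb.
    * rewrite X2 // (_ : par _ = false); last by rewrite /par /nx /n0; move: h; lia.
      by have := vb _ _ h; rewrite memv_cap => /andP[].
    * rewrite X3 // (_ : par _ = true); last by rewrite /par /nx /n0; lia.
      by have := vb _ _ h; rewrite memv_cap => /andP[].
  + move=> k /andP[k0 /segment[h|[i h e]|[i h ->]|[i h ->]]].
    * by move: k0 h; rewrite /n0 /nx; lia.
    * by move: k0 h e; rewrite /n0 /nx; lia.
    * by rewrite X2 //; have := vb _ _ h; rewrite memv_cap => /andP[].
    * by rewrite X3 //; have := vb _ _ h; rewrite memv_cap => /andP[].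
  + move=> _ /gB[b0 [b1 [h0 h1 ->]]] k kn; rewrite linearD /=.
    have [c0 e0] := vbasis_sum h0; have [c1 e1] := vbasis_sum h1.
    rewrite (coordB b0) ?(coordB b1) ?addr0 //.
      exists (fun i => if (i < \dim B0)%N then 0 else c1 (i - \dim B0)%N), (\dim B0 + \dim B1)%N.
      split; last by rewrite /n0 /nn; lia.
      rewrite big_split_ord /= big1 ?add0r; last by move=> i _; rewrite ltn_ord scale0r.
      rewrite e1; apply: eq_bigr => i _; rewrite ltnNge leq_addr /= addKn.
      by rewrite addnA X3.
    exists c0, (\dim B0); split; last by rewrite /n0 /nn; lia.
    by rewrite e0; apply: eq_bigr => i _; rewrite X2.
- split=> k; rewrite /par; first by move=> h; rewrite leqNgt h.
  by move=> /andP[-> ->].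
split=> x.
  move=> x0; have : x \in (C0 + B0)%VS by rewrite E0.
  move=> /memv_addP[u uC [b bB ->]]; have [c ->] := vbasis_sum uC.
  exists c, b; split=> //; congr (_ + _); apply: eq_bigr => i _.
  by rewrite X0.
move=> x1; have : x \in (C1 + B1)%VS by rewrite E1.
move=> /memv_addP[u uC [b bB ->]]; have [c ->] := vbasis_sum uC.
exists (fun i => c (i - nx)%N), b; split; first by apply/andP; rewrite -memv_cap.
congr (_ + _); rewrite -{1}[nx]add0n big_addn /n0 /nx addKn big_mkord.
by apply: eq_bigr => i _; rewrite addnK addnC X1.
Qed.

End AdaptedBasis.

(** * Simple modules over the even parabolic subalgebra *)

Section Weights.
Variables (K : numClosedFieldType) (g : superalg K) (gr : int -> {vspace g}).
Variables (h0 : {vspace g}) (Dp Dm : set (weight h0)).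
Hypothesis HA : lie_superalgebra g.
Hypothesis HZ : Z_grading gr.
Hypothesis Hh : semisimple_cartan gr h0.
Hypothesis HD : positive_system gr Dp Dm.
Local Notation g0 := (part g false).
Local Notation levi := (levi gr).
Local Notation mplus := (mplus gr).
Implicit Types al be : weight h0.

Lemma natr0 (m : nat) : m%:R = 0 :> K -> m = 0%N.
Proof. by move/eqP; rewrite Num.Theory.pnatr_eq0 => /eqP. Qed.

Lemma h0_even h : h \in h0 -> h \in g0.
Proof. by case: Hh => _ [le _ _ _] _; apply: (subvP le). Qed.

Lemma h0_levi h : h \in h0 -> h \in levi.
Proof. by case: Hh => le _ _; apply: (subvP le). Qed.

Lemma even_br x y : x \in g0 -> y \in g0 -> br x y \in g0.
Proof. by move=> x0 y0; have := br_part HA x0 y0. Qed.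

Lemma even_jacobi x y z : x \in g0 -> y \in g0 -> br x (br y z) = br (br x y) z + br y (br x z).
Proof. by move=> x0 y0; rewrite (br_jacobi HA z x0 y0) expr0 scale1r. Qed.

Lemma even_brC x y : x \in g0 -> y \in g0 -> br x y = - br y x.
Proof. by move=> x0 y0; rewrite (brC HA x0 y0) expr0 scale1r. Qed.

Lemma brs_mono (U V W : {vspace g}) : (V <= W)%VS -> (brs U V <= brs U W)%VS.
Proof.
by move=> /subvP VW; apply: brs_le => x y xU /VW yW; exact: mem_brs.
Qed.

(** Let D = [h0, h0] and let W be an h0-stable complement of D. Modulo D an element of h0 may be
    taken in W, and its brackets with h0 lie in both D and W, so vanish. Hence D lies in [h0, D],
    and nilpotency forces D = 0. *)
Lemma h0_abelian x y : x \in h0 -> y \in h0 -> br x y = 0.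
Proof.
case: Hh => _ [_ cl [n nil] _] ss xh yh; pose D := brs h0 h0.
have hD : (brs h0 D <= D)%VS by exact: brs_mono.
have [W [hW DW0 DW]] := ss D hD.
have DD : (D <= brs h0 D)%VS.
  apply: brs_le => u v uh vh; have : v \in fullv by exact: memvf.
  rewrite -DW0 => /memv_addP[d dD [w wW ve]].
  have wh : w \in h0.
    have -> : w = v - d by rewrite ve addrC addKr.
    by rewrite memvB // (subvP cl).
  have uw : br u w = 0.
    apply/eqP; rewrite -memv0 -DW memv_cap mem_brs //=.
    by apply: (subvP hW); exact: mem_brs.
  by rewrite ve (linD (br_linr HA u)) uw addr0 mem_brs.
have Dn m : (D <= iter m (brs h0) h0)%VS.
  by elim: m => //= m IH; apply: subv_trans DD _; exact: brs_mono.
apply/eqP; rewrite -memv0 -nil; apply: (subvP (Dn n)); exact: mem_brs.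
Qed.

Lemma wt_linear al : linear (wt al : g -> K^o).
Proof. by move=> a x y; rewrite /wt !linearP. Qed.

Lemma wtD al be h : wt (al + be) h = wt al h + wt be h.
Proof. by rewrite /wt add_lfunE. Qed.

Lemma wtN al h : wt (- al) h = - wt al h.
Proof. by rewrite /wt opp_lfunE. Qed.

Lemma wt0 h : wt (0 : weight h0) h = 0.
Proof. by rewrite /wt zero_lfunE. Qed.

Lemma mem_rspace al x : x \in rspace al <-> forall h, h \in h0 -> br h x = wt al h *: x.
Proof.
apply: (mem_vspan (A := [set x | forall h, h \in h0 -> br h x = wt al h *: x])).
split=> [h _|a u v hu hv h hh] /=; first by rewrite (lin0 (br_linr HA h)) scaler0.
by rewrite (br_linr HA h) hu // hv // scalerDr !scalerA mulrC.
Qed.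

Lemma rspace_br al be x y : x \in g0 -> x \in rspace al -> y \in rspace be ->
  br x y \in rspace (al + be).
Proof.
move=> x0 /mem_rspace hx /mem_rspace hy; apply/mem_rspace => h hh.
rewrite (even_jacobi _ (h0_even hh) x0) (hx _ hh) (hy _ hh).
by rewrite (wtD al be h) (linZ (br_linl HA y)) (linZ (br_linr HA x)) -scalerDl.
Qed.

(** Even vectors of weight 0 normalize h0, which is its own normalizer in g0. *)
Lemma rspace0_h0 x : x \in g0 -> x \in rspace (0 : weight h0) -> x \in h0.
Proof.
move=> x0 /mem_rspace hx; case: Hh => _ [_ _ _ sn] _; apply: sn => // y yh.
by rewrite (even_brC x0 (h0_even yh)) hx // wt0 scale0r oppr0 mem0v.
Qed.

Lemma wt_neq0 al : al != 0 -> exists2 h, h \in h0 & wt al h != 0.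
Proof.
move=> /eqP al0; apply: contrapT => no; apply: al0; apply/lfunP => h.
rewrite zero_lfunE; apply: contrapT => /eqP hn; apply: no.
by exists (vsval h); [exact: subvsP | rewrite /wt vsvalK].
Qed.

Lemma weight_of (V : lmodType K) (rho : g -> V -> V) v :
  linear (rho^~ v) -> v != 0 -> (forall h, h \in h0 -> exists a, rho h v = a *: v) ->
  exists al : weight h0, forall h, h \in h0 -> rho h v = wt al h *: v.
Proof.
move=> lr v0 ev.
pose f (h : subvs_of h0) : K^o := xget 0 [set a | rho (vsval h) v = a *: v].
have fE h : rho (vsval h) v = f h *: v.
  rewrite /f; case: xgetP => [a _ //|no]; have [a ha] := ev _ (subvsP h).
  by case: (no a).
have inj a b : a *: v = b *: v -> a = b.
  by move/eqP; rewrite -subr_eq0 -scalerBl scaler_eq0 (negbTE v0) orbF subr_eq0 => /eqP.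
have lf : linear f.
  move=> a x y; apply: inj; rewrite -fE linearP lr !fE scalerDl scalerA.
  by [].
pose fl := GRing.isLinear.Build _ _ _ _ f lf.
pose F : {linear subvs_of h0 -> K^o} := HB.pack f fl.
exists (linfun F) => h hh; rewrite /wt lfunE /=.
by have := fE (vsproj h0 h); rewrite vsprojK.
Qed.

Lemma ad_commute h h' x : h \in h0 -> h' \in h0 -> br h (br h' x) = br h' (br h x).
Proof.
move=> hh hh'; rewrite (even_jacobi _ (h0_even hh) (h0_even hh')) (h0_abelian hh hh').
by rewrite (lin0 (br_linl HA x)) add0r.
Qed.

Definition weight_vectors (U : {vspace g}) : set g :=
  [set x | x \in U /\ exists al : weight h0, x \in rspace al].

(** If an h0-stable complement of the span of the weight vectors met U, it would contain a common
    eigenvector of h0 in U, which is itself a weight vector. *)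
Lemma weight_vectors_span (U : {vspace g}) : (brs h0 U <= U)%VS ->
  vspan (weight_vectors U) = U.
Proof.
move=> hU; pose W := vspan (weight_vectors U); rewrite -/W.
have WU : (W <= U)%VS by apply: (vspanP _).2 => x [].
have hW : (brs h0 W <= W)%VS.
  apply: brs_le => h x hh; apply: (vspan_ind (S := [set x | br h x \in W])).
    exact: (subspace_preim (br_linr HA h) (subspace_vspace W)).
  move=> y [yU [al ya]] /=; apply: vspan_mem; split; first by apply: (subvP hU); exact: mem_brs.
  by exists al; rewrite (mem_rspace al y).1 // memvZ.
case: Hh => _ _ ss; have [W' [hW' WW' WW0]] := ss W hW.
suff UW0 : (U :&: W' = 0)%VS.
  apply/eqP; rewrite eqEsubv WU; apply/subvP => x xU.
  have : x \in fullv by exact: memvf.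
  rewrite -WW' => /memv_addP[w wW [w' wW' xE]].
  have : w' \in (U :&: W')%VS.
    have e : w' = x - w by rewrite xE addrC addKr.
    by rewrite memv_cap wW' andbT e memvB // (subvP WU).
  by rewrite UW0 memv0 => /eqP w0; rewrite xE w0 addr0.
apply: contrapT => /eqP UWn.
have [|||v [vUW v0 ev]] := common_eigenvector_in (T := [set br h | h in [set` h0]])
    (U := (U :&: W')%VS) _ _ UWn _.
- by move=> _ [h hh <-]; exact: br_linr.
- by move=> _ _ x [h hh <-] [h' hh' <-]; exact: ad_commute.
- move=> _ x [h hh <-]; rewrite !memv_cap => /andP[xU xW'].
  by rewrite (subvP hU) ?mem_brs // (subvP hW') // mem_brs.
have [||al hal] := weight_of (rho := fun h x => br h x) (v := v) _ v0.
- exact: (br_linl HA v).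
- by move=> h hh; apply: ev; exists h.
move: vUW; rewrite memv_cap => /andP[vU vW'].
have vW : v \in W by apply: vspan_mem; split=> //; exists al; apply/mem_rspace.
by move: v0; rewrite -memv0 -WW0 memv_cap vW vW'.
Qed.

Section Representation.
Variables (n : nat) (rho : g -> 'rV[K]_n.+1 -> 'rV[K]_n.+1).
Local Notation p0 := (parab0 gr).
Hypothesis rho_lin : bilinear_op rho.
Hypothesis rho_br : forall b b' w, b \in p0 -> b' \in p0 ->
  rho (br b b') w = rho b (rho b' w) - rho b' (rho b w).
Hypothesis rho_simple : forall W : set 'rV[K]_n.+1, subspace W ->
  (forall b w, b \in p0 -> W w -> W (rho b w)) -> W = [set 0] \/ W = setT.

(** Matrices act on row vectors from the right, so [mrho] reverses products, as the order in
    [mrho_br] shows. *)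
Definition mrho (b : g) : 'M[K]_n.+1 := \matrix_(i, j) rho b (delta_mx 0 i) 0 j.

Lemma mrhoE b w : rho b w = w *m mrho b.
Proof.
rewrite mulmx_sum_row {1}[w]row_sum_delta (lin_sum _ _ _ (rho_lin.2 b)).
apply: eq_bigr => i _; rewrite (linZ (rho_lin.2 b)); congr (_ *: _).
by apply/rowP => j; rewrite !mxE.
Qed.

Lemma mrho_inj (A A' : 'M[K]_n.+1) : (forall w : 'rV[K]_n.+1, w *m A = w *m A') -> A = A'.
Proof. by move=> h; apply/row_matrixP => i; rewrite !rowE. Qed.

Lemma mrho_br b b' : b \in p0 -> b' \in p0 ->
  mrho (br b b') = mrho b' * mrho b - mrho b * mrho b'.
Proof.
move=> hb hb'; apply: mrho_inj => w.
by rewrite -mrhoE rho_br // !mrhoE mulmxBr !mulmxA.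
Qed.

Lemma mrhoZ c b : mrho (c *: b) = c *: mrho b.
Proof.
by apply: mrho_inj => w; rewrite -mrhoE (linZ (rho_lin.1 w)) mrhoE scalemxAr.
Qed.

Lemma mrho0 : mrho 0 = 0.
Proof. by rewrite -[0 in LHS](scale0r (0 : g)) mrhoZ scale0r. Qed.

Lemma h0_p0 h : h \in h0 -> h \in p0.
Proof. by move=> hh; rewrite memv_cap h0_even // andbT levi_parab // h0_levi. Qed.

Lemma root_nilpotent al x : al != 0 -> x \in p0 -> x \in rspace al ->
  exists m, mrho x ^+ m = 0.
Proof.
move=> /wt_neq0[h hh hn] xp /mem_rspace/(_ h hh) hx.
(* The sign compensates for the reversal of products by [mrho]. *)
apply: (power_nilpotent (H := - mrho h) natr0 hn).
have := mrho_br (h0_p0 hh) xp; rewrite hx mrhoZ => ->.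
by rewrite mulNr mulrN opprK addrC.
Qed.

Lemma common_kernel_rho (S : set g) : (forall x, S x -> x \in p0) ->
  (forall x y, S x -> S y -> S (br x y)) ->
  (forall x, S x -> exists m, mrho x ^+ m = 0) ->
  exists2 v : 'rV[K]_n.+1, v != 0 & forall x, S x -> rho x v = 0.
Proof.
move=> Sp Sbr Snil.
have [||v v0 hv] := common_kernel (S := [set mrho x | x in S]).
- move=> _ _ [x Sx <-] [y Sy <-]; exists (br y x); first exact: Sbr.
  by rewrite mrho_br ?Sp.
- by move=> _ [x Sx <-]; exact: Snil.
by exists v => // x Sx; rewrite mrhoE; apply: hv; exists x.
Qed.

Lemma mplus0_br x y : x \in mplus0 gr -> y \in p0 -> br x y \in mplus0 gr.
Proof.
rewrite !memv_cap => /andP[xm x0] /andP[yp y0].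
by rewrite (mplus_parab_br HA HZ) // even_br.
Qed.

Lemma mplus0_p0 x : x \in mplus0 gr -> x \in p0.
Proof. by rewrite !memv_cap => /andP[xm ->]; rewrite mplus_parab. Qed.

(** The weight vectors of [mplus0] act nilpotently: those of weight 0 lie in h0, which meets [mplus]
    in 0 only. They have a common kernel vector, and the kernel of the ideal [mplus0] is invariant,
    so simplicity makes it everything. *)
Lemma mplus0_acts_by_zero x w : x \in mplus0 gr -> rho x w = 0.
Proof.
have hm : (brs h0 (mplus0 gr) <= mplus0 gr)%VS.
  apply: brs_le => h y hh; rewrite !memv_cap => /andP[ym y0].
  by rewrite (levi_mplus_br HA HZ) ?h0_levi // even_br // h0_even.
have wm := weight_vectors_span hm.
pose S : set g := weight_vectors (mplus0 gr).
have [||v v0 hv] := common_kernel_rho (S := S) (fun x => @mplus0_p0 x \o @proj1 _ _).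
- move=> y z [ym [al ya]] [zm [be zb]]; split.
    by apply: mplus0_br => //; exact: mplus0_p0.
  by exists (al + be); apply: rspace_br => //; move: ym; rewrite memv_cap => /andP[].
- move=> y [ym [al ya]]; have [e|al0] := eqVneq al 0; last first.
    by apply: root_nilpotent al0 _ ya; exact: mplus0_p0.
  move: (ym); rewrite memv_cap => /andP[ym' y0].
  have : y \in (levi :&: mplus)%VS.
    by rewrite memv_cap ym' andbT; apply/h0_levi/rspace0_h0 => //; rewrite -e.
  rewrite (levi_mplus_cap HZ) memv0 => /eqP ->.
  by exists 1%N; rewrite mrho0 expr1.
pose W := [set w | forall x, x \in mplus0 gr -> rho x w = 0].
have sW : subspace W.
  split=> [y _|a u z hu hz y ym] /=; first exact: (lin0 (rho_lin.2 y)).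
  by rewrite rho_lin.2 hu // hz // scaler0 addr0.
have vW : W v.
  move=> y; rewrite -wm; apply: (vspan_ind (S := [set y | rho y v = 0])) => //.
  apply: (subspace_eq (f := rho^~ v) (g := fun=> 0)); first exact: rho_lin.1.
  by move=> a u z; rewrite scaler0 addr0.
move=> xm; case: (rho_simple sW) => [b u bp Wu y ym|eW|eW].
- have := rho_br u (mplus0_p0 ym) bp; rewrite (Wu y ym) (lin0 (rho_lin.2 b)) subr0.
  by rewrite (Wu _ (mplus0_br ym bp)) => <-.
- have e : v = 0 by move: vW; rewrite eW.
  by rewrite e eqxx in v0.
- have : W w by rewrite eW.
  by move/(_ x xm).
Qed.

Lemma levi0_p0 x : x \in levi0 gr -> x \in p0.
Proof. by rewrite !memv_cap => /andP[xl ->]; rewrite levi_parab. Qed.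

Lemma levi0_br x y : x \in levi0 gr -> y \in levi0 gr -> br x y \in levi0 gr.
Proof.
by rewrite !memv_cap => /andP[xl x0] /andP[yl y0]; rewrite (levi_br HZ) // even_br.
Qed.

Lemma h0_levi0 h : h \in h0 -> h \in levi0 gr.
Proof. by move=> hh; rewrite memv_cap h0_levi // h0_even. Qed.

(** Root vectors rather than their span, as the nilpotency theorem applies to a set closed under
    commutators; 0 is included for brackets that vanish. *)
Definition pos_vectors : set g := [set x | x \in levi0 gr /\
  (x = 0 \/ exists2 al, pos_levi gr Dp al & x \in rspace al)].

Lemma pos_vectors_br x y : pos_vectors x -> pos_vectors y -> pos_vectors (br x y).
Proof.
move=> [xl hx] [yl hy]; split; first exact: levi0_br.
case: hx => [->|[al [Dal _] xa]]; first by left; exact: (lin0 (br_linl HA y)).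
case: hy => [->|[be [Dbe _] yb]]; first by left; exact: (lin0 (br_linr HA x)).
have [->|n0] := eqVneq (br x y) 0; [by left | right].
have x0 : x \in g0 by move: xl; rewrite memv_cap => /andP[].
have ab := rspace_br x0 xa yb; exists (al + be) => //.
have nz : rspace (al + be) != 0%VS.
  by apply: contra n0 => /eqP e; rewrite -memv0 -e.
case: HD => rE _ cl _ _; have Dab : Dp (al + be).
  by case: (cl al be Dal Dbe) => // e; rewrite e eqxx in nz.
split=> //; split; first by have [] : @Defs.roots _ _ h0 (al + be) by rewrite rE; left.
apply: contra n0 => /eqP e; rewrite -memv0 -e memv_cap ab.
by have := levi0_br xl yl; rewrite memv_cap => /andP[].
Qed.

Lemma h0_pos h x : h \in h0 -> pos_vectors x -> pos_vectors (br h x).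
Proof.
move=> hh [xl hx]; split; first by apply: levi0_br => //; exact: h0_levi0.
case: hx => [->|[al Pal xa]]; first by left; exact: (lin0 (br_linr HA h)).
by right; exists al => //; rewrite (mem_rspace al x).1 // memvZ.
Qed.

(** The common kernel of [pos_vectors] is nonzero, and it is stable under h0 because h0 normalizes
    [pos_vectors]; commuting operators have a common eigenvector on it. *)
Lemma highest_weight_exists : exists (lam : weight h0) (v : 'rV[K]_n.+1),
  [/\ v != 0, forall h, h \in h0 -> rho h v = wt lam h *: v
    & forall x, pos_vectors x -> rho x v = 0].
Proof.
have [||v0 v0n hv0] := common_kernel_rho (S := pos_vectors) (fun x => @levi0_p0 x \o @proj1 _ _).
- exact: pos_vectors_br.
- move=> x [xl [->|[al [_ [al0 _]] xa]]]; first by exists 1%N; rewrite mrho0 expr1.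
  by apply: root_nilpotent al0 _ xa; exact: levi0_p0.
pose U := vspan [set w : 'rV[K]_n.+1 | forall x, pos_vectors x -> rho x w = 0].
have UE w : w \in U <-> forall x, pos_vectors x -> rho x w = 0.
  apply: (mem_vspan (A := [set w | forall x, pos_vectors x -> rho x w = 0])).
  split=> [y _|a u z hu hz y ym] /=; first exact: (lin0 (rho_lin.2 y)).
  by rewrite rho_lin.2 hu // hz // scaler0 addr0.
have U0 : U != 0%VS.
  by apply: contra v0n => /eqP e; rewrite -memv0 -e; apply/UE.
have [|||v [vU vn ev]] := common_eigenvector_in (T := [set rho h | h in [set` h0]]) _ _ U0 _.
- by move=> _ [h hh <-]; exact: rho_lin.2.
- move=> _ _ w [h hh <-] [h' hh' <-]; apply/eqP; rewrite -subr_eq0.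
  by rewrite -rho_br ?h0_p0 // (h0_abelian hh hh') (lin0 (rho_lin.1 w)).
- move=> _ w [h hh <-] /UE hw; apply/UE => x px.
  have xp : x \in p0 by apply: levi0_p0; case: px.
  have := rho_br w (h0_p0 hh) xp; rewrite (hw x px) (lin0 (rho_lin.2 h)) sub0r.
  by rewrite (hw _ (h0_pos hh px)) => /esym/eqP; rewrite oppr_eq0 => /eqP.
have [||lam hlam] := weight_of (rho := rho) (v := v) _ vn.
- exact: rho_lin.1.
- by move=> h hh; apply: ev; exists h.
by exists lam, v; split=> //; exact/UE.
Qed.

(** * Dominance of the highest weight *)

Section Dominance.
Variable al : weight h0.
Local Notation E := (rspace al :&: g0)%VS.
Local Notation F := (rspace (- al) :&: g0)%VS.

Lemma root_pair_h0 e f : e \in E -> f \in F -> br e f \in h0.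
Proof.
rewrite !memv_cap => /andP[ea e0] /andP[fa f0]; apply: rspace0_h0.
  exact: even_br.
by have := rspace_br e0 ea fa; rewrite subrr.
Qed.

(* [sl2_highest_weight] for the triple with [e] and [f] exchanged: a vector of
   positive weight killed by [e f] vanishes. *)
Lemma root_space_line e f : e \in E -> f \in F -> wt al (br e f) != 0 ->
  forall x, x \in E -> exists t, x = t *: e.
Proof.
(* The factor 2 / a normalizes the pair so that h = [e, f'] satisfies al(h) = 2. *)
move=> eE fF n0 x xE; pose a := wt al (br e f); pose f' := (2%:R / a) *: f.
have f'F : f' \in F by exact: memvZ.
have [ea e0] : e \in rspace al /\ e \in g0 by apply/andP; rewrite -memv_cap.
have [xa x0] : x \in rspace al /\ x \in g0 by apply/andP; rewrite -memv_cap.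
have f0 : f' \in g0 by move: f'F; rewrite memv_cap => /andP[].
pose h := br e f'; have hh : h \in h0 by exact: root_pair_h0.
have alh : wt al h = 2%:R.
  rewrite /h /f' (linZ (br_linr HA e)) (linZ (wt_linear al)).
  by rewrite -[_ *: _]/(_ * _) divfK.
(* This t makes al([y, f']) vanish for y = x - t e. *)
pose t := wt al (br x f') / 2%:R; exists t.
pose y := x - t *: e; have yE : y \in E by rewrite memvB ?memvZ.
have [ya y0] : y \in rspace al /\ y \in g0 by apply/andP; rewrite -memv_cap.
have two : 2%:R != 0 :> K by rewrite Num.Theory.pnatr_eq0.
have yf : wt al (br y f') = 0.
  rewrite /y (linB (br_linl HA f')) (linZ (br_linl HA f')).
  rewrite (linB (wt_linear al)) (linZ (wt_linear al)) -/h alh.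
  by rewrite -[_ *: _]/(_ * _) divfK // subrr.
apply/eqP; rewrite -subr_eq0 -/y; apply: contrapT => /negP yn0.
have ch := h0_even hh.
have he u : br h (br e u) = br e (br h u) + 2%:R *: br e u.
  rewrite (even_jacobi u ch e0) ((mem_rspace al e).1 ea h hh) alh.
  by rewrite (linZ (br_linl HA u)) addrC.
(* With H = - ad h the vector y has eigenvalue -2; if y were nonzero, -2 would be a natural
   number. *)
suff [m e2] : exists m : nat, - 2%:R = m%:R :> K.
  have /natr0 : (m + 2)%:R = 0 :> K by rewrite natrD -e2 addNr.
  by rewrite addn2.
apply: (sl2_highest_weight (E := br f') (F := br e) (H := fun u => - br h u) (v := y) natr0).
- exact: br_linr.
- exact: br_linr.
- by move=> c u v; rewrite (br_linr HA h) opprD scalerN.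
- move=> u; rewrite (even_jacobi u f0 e0) (even_brC f0 e0) -/h (linN (br_linl HA u)).
  by rewrite addrC.
- by move=> u; rewrite he opprD (linN (br_linr HA e)).
- exact: yn0.
- by rewrite ((mem_rspace al y).1 ya h hh) alh scaleNr.
have Th : br f' y \in h0.
  by rewrite (even_brC f0 y0) memvN; exact: root_pair_h0.
rewrite (even_brC e0 (h0_even Th)) ((mem_rspace al e).1 ea _ Th).
by rewrite (even_brC f0 y0) (linN (wt_linear al)) yf oppr0 scale0r oppr0.
Qed.

(** The coroot is a combination of brackets of root vectors of g0, which need not lie in p_0. It is
    rewritten as a single bracket [e, f0] of vectors of [levi0]; these form with it an sl2-triple
    acting on the layer, and v is a highest weight vector for it. *)
Lemma coroot_weight (lam : weight h0) (v : 'rV[K]_n.+1) : v != 0 ->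
  (forall h, h \in h0 -> rho h v = wt lam h *: v) ->
  (forall x, pos_vectors x -> rho x v = 0) ->
  pos_levi0 gr Dp al -> exists m : nat, wt lam (coroot al) = m%:R.
Proof.
(* If no element qualifies, [coroot] is 0 by default and pairs to 0. *)
move=> v0 hv pv [Pal /= nz]; rewrite /coroot; case: xgetP => [h _ [hEF alh]|_]; last first.
  by exists 0%N; rewrite (lin0 (wt_linear lam)).
have two : 2%:R != 0 :> K by rewrite Num.Theory.pnatr_eq0.
have [e1 [f1 [e1E f1F ef1]]] : exists e f, [/\ e \in E, f \in F & wt al (br e f) != 0].
  apply: contrapT => no; move/eqP: alh; apply/negP; rewrite eq_sym.
  suff -> : wt al h = 0 by exact: two.
  move: h hEF; apply: (vspan_ind (S := [set h | wt al h = 0])).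
    apply: (subspace_eq (f := wt al : g -> K^o) (g := fun=> 0)); first exact: wt_linear.
    by move=> a u w; rewrite scaler0 addr0.
  move=> _ [e [f [eE fF ->]]] /=; apply: contrapT => /eqP n0; apply: no.
  by exists e, f.
have [e ee e0] : exists2 e, e \in (rspace al :&: levi :&: g0)%VS & e != 0.
  by exists (vpick (rspace al :&: levi :&: g0)%VS); [exact: memv_pick | rewrite vpick0].
move: ee; rewrite !memv_cap => /andP[/andP[ea el] eg].
have eE : e \in E by rewrite memv_cap ea.
(* The even root space is a line, so it is spanned by the vector e of degree 0, and every bracket in
   the coroot can be written with e. *)
have line x : x \in E -> exists t, x = t *: e.
  have [s es] := root_space_line e1E f1F ef1 eE.
  have s0 : s != 0 by apply: contra e0 => /eqP s0; rewrite es s0 scale0r.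
  move=> /(root_space_line e1E f1F ef1)[t ->]; exists (t / s).
  by rewrite es scalerA divfK.
have [f fF hef] : exists2 f, f \in F & h = br e f.
  move: h hEF {alh}; apply: (vspan_ind (S := [set h | exists2 f, f \in F & h = br e f])).
    split=> [|a _ _ [f fF ->] [f' fF' ->]] /=.
      by exists 0; rewrite ?mem0v ?(lin0 (br_linr HA e)).
    by exists (a *: f + f'); [rewrite memvD ?memvZ | rewrite (br_linr HA e)].
  move=> _ [x [f [/line[t ->] fF ->]]]; exists (t *: f); first exact: memvZ.
  by rewrite (linZ (br_linl HA f)) (linZ (br_linr HA e)).
have hh : h \in h0 by rewrite hef; exact: root_pair_h0.
(* As e and h have degree 0, only the degree 0 component f0 of f contributes to [e, f]. It has again
   weight - al and lies in p_0. *)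
have : f \in (levi + gr_nonzero gr)%VS by rewrite (levi_nonzero_add HZ) memvf.
move=> /memv_addP[f0 fl [z zZ fE]].
have [f00 _] : f0 \in g0 /\ z \in g0.
  apply: (parity_split HA (levi_parity HZ) (gr_nonzero_parity HZ) (levi_nonzero_cap HZ) _ fl zZ fE).
  by move: fF; rewrite memv_cap => /andP[].
have unique x y : x \in levi -> y \in gr_nonzero gr -> x + y = 0 -> x = 0.
  move=> xl yZ xy; apply/eqP; rewrite -memv0 -(levi_nonzero_cap HZ) memv_cap xl /=.
  by rewrite (_ : x = - y) ?memvN //; apply/eqP; rewrite -addr_eq0 xy.
have f0a : f0 \in rspace (- al).
  apply/mem_rspace => k kh; apply/eqP; rewrite -subr_eq0; apply/eqP.
  apply: (unique _ (br k z - wt (- al) k *: z)).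
  - by rewrite memvB ?memvZ // (levi_br HZ) // h0_levi.
  - by rewrite memvB ?memvZ // (levi_nonzero_br HA HZ) // h0_levi.
  have : br k f = wt (- al) k *: f.
    by apply: (mem_rspace (- al) f).1 => //; move: fF; rewrite memv_cap => /andP[].
  rewrite fE (linD (br_linr HA k)) scalerDr => /eqP; rewrite -subr_eq0 opprD addrACA.
  by move/eqP.
have hef0 : h = br e f0.
  apply/eqP; rewrite -subr_eq0; apply/eqP; apply: (unique _ (- br e z)).
  - by apply: memvB; [exact: h0_levi | exact: (levi_br HZ)].
  - by rewrite memvN (levi_nonzero_br HA HZ).
  by rewrite hef fE (linD (br_linr HA e)) -addrA -opprD subrr.
have elp : e \in levi0 gr by rewrite memv_cap el.
have flp : f0 \in levi0 gr by rewrite memv_cap fl.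
have ep := levi0_p0 elp; have fp := levi0_p0 flp; have hp := h0_p0 hh.
apply: (sl2_highest_weight (E := rho e) (F := rho f0) (H := rho h) (v := v) natr0).
- exact: rho_lin.2.
- exact: rho_lin.2.
- exact: rho_lin.2.
- by move=> u; rewrite hef0 rho_br // addrC subrK.
- move=> u; have := rho_br u hp fp.
  rewrite ((mem_rspace (- al) f0).1 f0a h hh) (wtN al h) alh scaleNr.
  rewrite (linN (rho_lin.1 u)) (linZ (rho_lin.1 u)) => ->.
  by rewrite addrC subrK.
- exact: v0.
- exact: hv.
rewrite (pv e) ?(lin0 (rho_lin.2 f0)) //; split=> //; right; exists al => //.
Qed.

End Dominance.

End Representation.

End Weights.

(** * Assembly of the filtration *)

Section SimpleSubquotients.
Variables (K : numClosedFieldType) (g : superalg K) (gr : int -> {vspace g}).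
Variables (h0 : {vspace g}) (Dp Dm : set (weight h0)).
Hypothesis HA : lie_superalgebra g.
Hypothesis HZ : Z_grading gr.
Hypothesis Hh : semisimple_cartan gr h0.
Hypothesis HD : positive_system gr Dp Dm.
Local Notation g0 := (part g false).
Local Notation p0 := (parab0 gr).
Variables (M : lmodType K) (aM : g -> M -> M).
Hypothesis modM : is_module aM.
Variables (e : nat -> g) (nx : nat).
Hypothesis e0 : forall i, (i < nx)%N -> e i \in g0.
Hypothesis dec0 : forall x, x \in g0 -> exists (c : nat -> K) b,
  b \in p0 /\ x = \sum_(i < nx) c i *: e i + b.
Variables (V : vectType K) (iota : V -> M).
Hypothesis iota_lin : linear iota.
Hypothesis hfree : forall (T : lmodType K) (h : seq nat -> V -> T),
  (forall s, linear (h s)) -> exists phi : M -> T, linear phi /\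
    forall s v, xword nx s -> phi (foldr (fun i => aM (e i)) (iota v) s) = h s v.
Variables U U' : {vspace V}.
Hypothesis stU : wspan_stable aM g0 e nx iota U.
Hypothesis step : simple_step aM e nx [set b | b \in p0] iota U U'.

Lemma simple_subquotient : exists (n : nat) (lam : weight h0)
    (a : sub (levi0 gr) -> 'rV[K]_n.+1 -> 'rV[K]_n.+1),
  [/\ (\dim U' = \dim U + n.+1)%N, dominant gr Dp lam, is_LS Dp lam a
    & subquotient_iso (fun x : sub g0 => aM (vsval x)) (MS_act (act := a))
        (wspan aM e nx iota U') (wspan aM e nx iota U)].
Proof.
have [adj neU simp] := step.
have pg0 : (p0 <= g0)%VS by exact: capvSr.
have [n [sg [q [[lsg lq] sgP qU sgq dimU']]]] := quotient_model adj.1 neU.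
have sgU' w := (sgP w).1; have qsg w := (sgP w).2.
have [c0 [lc0 c0iota c0F]] := hfree_const hfree.
pose rho := layer_act aM iota sg q c0.
have rho_lin : bilinear_op rho := layer_act_bilinear modM iota_lin lsg lq lc0.
have rho_br b b' w : b \in p0 -> b' \in p0 ->
    rho (br b b') w = rho b (rho b' w) - rho b' (rho b w).
  exact: (layer_act_br modM pg0 iota_lin stU adj lq sgU' qU sgq lc0 c0iota c0F).
have rho_simple := layer_act_simple modM pg0 iota_lin stU adj lq sgU' qsg qU sgq lc0 c0iota c0F simp.
have rho_mplus x w : x \in mplus0 gr -> rho x w = 0.
  exact: (mplus0_acts_by_zero HA HZ Hh rho_lin rho_br rho_simple).
have [lam [v [v0 hv pv]]] := highest_weight_exists HA HZ Hh HD rho_lin rho_br.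
pose a (x : sub (levi0 gr)) w := rho (vsval x) w.
exists n, lam, a; split=> //.
- by move=> al [pal _]; exact: (coroot_weight HA HZ Hh rho_lin rho_br v0 hv pv pal).
- have lp0 x : x \in levi0 gr -> x \in p0 by exact: levi0_p0.
  split; last first.
    exists v; split=> //; split=> [x xh|al x pal xal]; first exact: hv.
    by apply: pv; split; [exact: subvsP | right; exists al].
  split; [split; [split=> [w k x y|x]|] | by exists v |].
  + by rewrite /a linearP rho_lin.1.
  + exact: rho_lin.2.
  + move=> b b' x y w; rewrite !sub_partE => xb yb'.
    have xl := subvsP x; have yl := subvsP y.
    rewrite /a sub_brE ?levi0_br //.
    rewrite (rho_br _ _ w (lp0 _ xl) (lp0 _ yl)).
    (* The sign matters only when both elements are odd; but [levi0] is even, so an odd x is 0. *)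
    case: b b' xb yb' => [] [] xb yb'; rewrite ?expr0 ?scale1r //.
    have x0 : vsval x = 0.
      by apply: (part_cap HA) xb; move: xl; rewrite memv_cap => /andP[].
    by rewrite x0 !(lin0 (rho_lin.1 _)) (lin0 (rho_lin.2 _)) scaler0.
  + move=> W [sW Wa]; apply: rho_simple => // b w; rewrite -levi0_mplus0 //.
    move=> /memv_addP[l ll [m mm ->]] Ww.
    rewrite -[layer_act _ _ _ _ _ _ _]/(rho (l + m) w) (linD (rho_lin.1 w)) (rho_mplus m) // addr0.
    by have := Wa (vsproj (levi0 gr) l) w Ww; rewrite /a vsprojK.
- exact: (subquotient_exists HA modM pg0 e0 dec0 iota_lin hfree stU adj lsg lq sgU' qsg qU
    sgq lc0 c0iota c0F (levi0_mplus0 HA HZ) (levi0_mplus0_cap HZ) rho_mplus).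
Qed.

End SimpleSubquotients.

(** * Independence of the even words applied to the exterior part *)

Section InducedFree.
Variables (K : fieldType) (A : superalg K).
Hypothesis HA : lie_superalgebra A.
Hypotheses (ch2 : 2%:R != 0 :> K) (ch3 : 3%:R != 0 :> K).
Variables (nx n0 nn d : nat) (X : nn.-tuple A) (par : nat -> bool) (B : {vspace A}).
Hypothesis bX : basis_of fullv X.
Hypothesis le_nx : (nx <= n0)%N.
Hypothesis le_n0 : (n0 <= nn)%N.
Hypothesis parX : forall k, (k < nn)%N -> X`_k \in part A (par k).
Hypothesis BX : forall k, (n0 <= k < nn)%N -> X`_k \in B.
Hypothesis BE : forall b, b \in B -> forall k : 'I_nn, (k < n0)%N -> coord X k b = 0.
Hypothesis Bbr : forall x y, x \in B -> y \in B -> br x y \in B.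
Hypothesis par0 : forall k, (k < nx)%N -> par k = false.
Variables (N : lmodType K) (nu : 'I_d -> N) (co : 'I_d -> N -> K).
Hypothesis co_lin : forall j, linear (co j : N -> K^o).
Hypothesis coE : forall n, n = \sum_j co j n *: nu j.
Hypothesis co_nu : forall i j, co i (nu j) = (i == j)%:R.
Variable act : sub B -> N -> N.
Hypothesis act_mod : is_module act.
Local Notation M := (ind (fun x : sub B => vsval x) act).
Local Notation aM := (@ind_act _ _ _ (fun x : sub B => vsval x) _ act : A -> M -> M).
Local Notation nuM := (fun j => indt (fun x : sub B => vsval x) act 1 (nu j)).
Local Notation iota := (odd_iota aM (fun i => X`_i) (nx := nx) (n0 := n0) nuM).

(** Ordered words on the basis of N are independent, so a linear map may be prescribed on them. The
    letters below nx give back the even word s, the remaining ones the set J, that is the coordinate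
    of the row vector. *)
Lemma induced_free (T : lmodType K)
    (h : seq nat -> 'rV[K]_#|{: {set 'I_(n0 - nx)} * 'I_d}| -> T) :
  (forall s, linear (h s)) -> exists phi : M -> T, linear phi /\
    forall s v, xword nx s -> phi (foldr (fun i => aM X`_i) (iota v) s) = h s v.
Proof.
move=> lh; have modM := ind_act_is_module (fun x : sub B => vsval x) act.
have [Theta [lTheta ThetaE]] :=
  pbw_independent HA ch2 ch3 bX le_n0 parX BX BE Bbr co_lin coE co_nu act_mod.
pose J (t : seq nat) : {set 'I_(n0 - nx)} := finset.finset (fun i : 'I_(n0 - nx) => (nx + i)%N \in t).
pose hh (p : seq nat * 'I_d) :=
  h [seq i <- p.1 | (i < nx)%N] (delta_mx 0 (enum_rank (J p.1, p.2))).
exists (fun m => lext hh (Theta m)); split=> [a u v|s v xs].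
  by rewrite lTheta lext_linear.
have lX : linear (fun m => foldr (fun i => aM X`_i) m s).
  by elim: {xs} s => //= i s IH a u w; rewrite IH modM.1.2.
have lphi : linear (fun m => lext hh (Theta m)).
  by move=> a u w; rewrite lTheta lext_linear.
rewrite {1}/odd_iota (lin_sum _ _ _ lX) (lin_sum _ _ _ lphi).
rewrite {2}[v]row_sum_delta (lin_sum _ _ _ (lh s)); apply: eq_bigr => k _.
rewrite (linZ lX) (linZ lphi) (linZ (lh s)); congr (_ *: _).
case ek : (enum_val k) => [J0 j] /=.
have yJ := ysub_yword J0; have := ThetaE _ j (okw_cat le_nx par0 xs yJ).
have wE t m : foldr (fun i => aM X`_i) m t = wact aM [seq X`_i | i <- t] m.
  by elim: t => //= i t ->.
rewrite wE [eact_word _ _ _ _]wE => e1; rewrite (_ : wact _ _ _ = wact aM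
  [seq X`_i | i <- s ++ ysub J0] (nuM j)) ?e1; last by rewrite map_cat /wact foldr_cat.
rewrite lextU /hh /=.
move: xs yJ => /andP[_ sn] /andP[_ tn].
rewrite filter_cat (all_filterP sn) (_ : filter _ (ysub J0) = [::]) ?cats0; last first.
  apply/eqP; rewrite -(negbK (_ == _)) -has_filter; apply/hasPn => i /(allP tn) /andP[le _].
  by rewrite -leqNgt.
rewrite -(enum_valK k) ek; congr (h s (delta_mx 0 (enum_rank (_, j)))).
apply/setP => i; rewrite inE mem_cat.
rewrite (_ : (nx + i)%N \in s = false) /=; last first.
  by apply/negP => /(allP sn) /=; rewrite ltnNge leq_addr.
rewrite /ysub (mem_map (f := fun x : 'I_(n0 - nx) => (nx + x)%N)) ?mem_enum //.
by move=> x y /addnI /val_inj.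
Qed.

End InducedFree.

Lemma chain_nth (K : fieldType) (V : vectType K) (R : {vspace V} -> {vspace V} -> Prop) U s i :
  chain R U s -> (i < size s)%N -> R (nth 0%VS (U :: s) i) (nth 0%VS (U :: s) i.+1).
Proof. by elim: s U i => // U' s IH U [|i] /= [RU cs] // lt; exact: (IH U' i cs lt). Qed.

Lemma has_dim_row (K : fieldType) n : has_dim 'rV[K]_n n.
Proof.
exists (fun i => delta_mx 0 i); apply: (@Bijective _ _ _ id) => c; exact/esym/row_sum_delta.
Qed.

Section Filtration.
Variables (K : numClosedFieldType) (g : superalg K) (gr : int -> {vspace g}).
Variables (h0 : {vspace g}) (Dp Dm : set (weight h0)).
Hypothesis HA : lie_superalgebra g.
Hypothesis HZ : Z_grading gr.
Hypothesis Hh : semisimple_cartan gr h0.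
Hypothesis HD : positive_system gr Dp Dm.
Local Notation g0 := (part g false).
Local Notation p0 := (parab0 gr).
Variables (M : lmodType K) (aM : g -> M -> M).
Hypothesis modM : is_module aM.
Variables (e : nat -> g) (nx : nat).
Hypothesis e0 : forall i, (i < nx)%N -> e i \in g0.
Hypothesis dec0 : forall x, x \in g0 -> exists (c : nat -> K) b,
  b \in p0 /\ x = \sum_(i < nx) c i *: e i + b.
Variables (V : vectType K) (iota : V -> M).
Hypothesis iota_lin : linear iota.
Hypothesis hfree : forall (T : lmodType K) (h : seq nat -> V -> T),
  (forall s, linear (h s)) -> exists phi : M -> T, linear phi /\
    forall s v, xword nx s -> phi (foldr (fun i => aM (e i)) (iota v) s) = h s v.
Local Notation wspan := (wspan aM e nx iota).

Lemma wspan_proper (U U' : {vspace V}) : (U <= U')%VS -> U != U' -> wspan U `<` wspan U'.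
Proof.
move=> le neU; split; first exact: wspan_le.
move=> F'F; move/negP: neU; apply; rewrite eqEsubv le /=; apply/subvP => v vU'.
have [c0 [_ c0iota c0F]] := hfree_const hfree.
by rewrite -(c0iota v); apply: c0F; apply: F'F; exact: wspan_iota.
Qed.

Lemma filtration_of_chain (s : seq {vspace V}) :
  chain (simple_step aM e nx [set b | b \in p0] iota) 0%VS s -> last 0%VS s = fullv ->
  (forall w, wspan fullv w) ->
  exists (k : nat) (F : nat -> set M) (lams : 'I_k -> weight h0)
      (LS : 'I_k -> lmodType K)
      (actS : forall i, sub (levi0 gr) -> LS i -> LS i) (ds : 'I_k -> nat),
    [/\ F 0%N = [set 0] /\ F k = setT,
        forall i, (i <= k)%N -> submodule (fun x : sub g0 => aM (vsval x)) (F i),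
        forall i, (i < k)%N -> F i `<` F i.+1,
        forall i : 'I_k,
          [/\ dominant gr Dp (lams i), is_LS Dp (lams i) (actS i),
              has_dim (LS i) (ds i)
            & subquotient_iso (fun x : sub g0 => aM (vsval x))
                (MS_act (act := actS i)) (F i.+1) (F i)]
      & (\sum_(i < k) ds i = \dim (fullv : {vspace V}))%N].
Proof.
move=> cs ls Ftop; pose C i := nth 0%VS (0%VS :: s) i.
have CS i : (i < size s)%N -> simple_step aM e nx [set b | b \in p0] iota (C i) (C i.+1).
  exact: chain_nth.
have Ctop : C (size s) = fullv by rewrite /C -ls (last_nth 0%VS).
have stC i : (i <= size s)%N -> wspan_stable aM g0 e nx iota (C i).
  elim: i => [_|i IH lt]; first exact: wspan_stable0.
  have [adj _ _] := CS i lt; apply: (adjacent_stable modM (subvv _) _ _ e0 dec0 (IH (ltnW lt)) adj).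
    by move=> x y x0 y0; have := br_part HA x0 y0.
  by move=> x /=; rewrite memv_cap => /andP[].
have sub_ex (i : 'I_(size s)) : exists t : {n : nat &
    (weight h0 * (sub (levi0 gr) -> 'rV[K]_n.+1 -> 'rV[K]_n.+1))%type},
  [/\ (\dim (C i.+1) = \dim (C i) + (projT1 t).+1)%N, dominant gr Dp (projT2 t).1,
      is_LS Dp (projT2 t).1 (projT2 t).2
    & subquotient_iso (fun x : sub g0 => aM (vsval x)) (MS_act (act := (projT2 t).2))
        (wspan (C i.+1)) (wspan (C i))].
  have [n [lam [a H]]] := simple_subquotient HA HZ Hh HD modM e0 dec0 iota_lin hfree
    (stC i (ltnW (ltn_ord i))) (CS i (ltn_ord i)).
  by exists (existT _ n (lam, a)).
have [t tP] := choice sub_ex.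
exists (size s), (fun i => wspan (C i)), (fun i => (projT2 (t i)).1),
  (fun i => 'rV[K]_(projT1 (t i)).+1), (fun i => (projT2 (t i)).2), (fun i => (projT1 (t i)).+1).
split.
- split; first exact: wspan0.
  by rewrite Ctop; apply/seteqP; split.
- move=> i le; split; first exact: wspan_sub.
  by move=> x w; apply: stC => //; exact: subvsP.
- by move=> i lt; have [[le _] neC _] := CS i lt; exact: wspan_proper.
- by move=> i; have [_ dom LSi iso] := tP i; split=> //; exact: has_dim_row.
rewrite -Ctop; transitivity (\sum_(i < size s) (\dim (C i.+1) - \dim (C i)))%N.
  by apply: eq_bigr => i _; have [-> _ _ _] := tP i; rewrite addKn.
rewrite -(big_mkord xpredT (fun i => \dim (C i.+1) - \dim (C i))%N) telescope_sumn_in //.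
  by rewrite /C /= dimv0 subn0.
by move=> i /andP[_ lt]; have [[le _] _ _] := CS i lt; exact: dimvS.
Qed.

End Filtration.

(** A [numClosedFieldType] supplies the eigenvalues needed for weights and makes nonzero integers
    invertible, as the ordered words and the sl2 computations require. *)
Lemma kac_filtration (K : numClosedFieldType) (g : superalg K)
    (gr : int -> {vspace g}) (h0 : {vspace g}) (Dp Dm : set (weight h0))
    (Hg : graded_reductive gr) (Hh : semisimple_cartan gr h0)
    (HD : positive_system gr Dp Dm)
    (lam : weight h0)
    (L : lmodType K) (act : sub (levi gr) -> L -> L)
    (HL : is_LT Dp lam act)
    (d : nat) (Hd : has_dim L d) :
  let c := (\dim (part g true) - \dim (parab gr :&: part g true))%N in
  exists (k : nat) (M : nat -> set (MT act)) (lams : 'I_k -> weight h0)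
      (LS : 'I_k -> lmodType K)
      (actS : forall i, sub (levi0 gr) -> LS i -> LS i) (ds : 'I_k -> nat),
    [/\ M 0%N = [set 0] /\ M k = setT,
        forall i, (i <= k)%N ->
          submodule (fun x : sub (part g false) => MT_act (vsval x)) (M i),
        forall i, (i < k)%N -> M i `<` M i.+1,
        forall i : 'I_k,
          [/\ dominant gr Dp (lams i), is_LS Dp (lams i) (actS i),
              has_dim (LS i) (ds i)
            & subquotient_iso
                (fun x : sub (part g false) => MT_act (vsval x))
                (MS_act (act := actS i)) (M i.+1) (M i)]
      & (\sum_(i < k) ds i = 2 ^ c * d)%N].
Proof.
move=> c; have [HA HZ _] := Hg.
have modL : is_module act by case: HL => ? [? [? [? [? [_ [mod _ _ _] _ _ _]]]]].
have [nu [co nuK coK]] := Hd.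
have modN := inflate_module HA HZ modL.
have ch2 : 2%:R != 0 :> K by rewrite Num.Theory.pnatr_eq0.
have ch3 : 3%:R != 0 :> K by rewrite Num.Theory.pnatr_eq0.
have [nx [n0 [nn [X [par]]]]] := adapted_basis HA (parab_parity HZ).
move=> [[le_nx le_n0 cE] bX [parX BX BE] [par0 par1] [dec0 dec1]].
have Bbr x y : x \in parab gr -> y \in parab gr -> br x y \in parab gr by exact: parab_br.
have coE n : n = \sum_j co n 0 j *: nu j by rewrite -[LHS]coK.
have lnu : linear (fun c : 'rV[K]_d => \sum_i c 0 i *: nu i).
  move=> a u v; rewrite scaler_sumr -big_split; apply: eq_bigr => i _ /=.
  by rewrite !mxE scalerDl scalerA.
have lco : linear co by move=> a u v; apply: (can_inj nuK); rewrite lnu !coK.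
have co_lin j : linear ((fun n => co n 0 j) : L -> K^o).
  by move=> a u v; rewrite lco !mxE.
have co_nu i j : co (nu j) 0 i = (i == j)%:R.
  have -> : nu j = \sum_k (delta_mx 0 j : 'rV[K]_d) 0 k *: nu k.
    rewrite (bigD1 j) //= mxE !eqxx scale1r big1 ?addr0 // => k /negPf kj.
    by rewrite mxE kj andbF scale0r.
  by rewrite nuK mxE eqxx.
pose M := MT act; pose aM := MT_act (act := act); pose e i := X`_i.
have modM : is_module aM by exact: ind_act_is_module.
pose one n : M := indt _ _ 1 n.
have lone : linear one by move=> a u v; exact: indt_linearr.
have oneP (b : sub (parab gr)) n : aM (vsval b) (one n) = one (inflate (mplus gr) (P := parab gr) act b n).
  rewrite /aM /MT_act /ind_act ind_mulE mulr1 -[env_inj _]mul1r.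
  exact: (indt_balanced (fun x : sub (parab gr) => vsval x)).
pose nuM j := one (nu j); pose L0 : set M := range one.
have e0 i : (i < nx)%N -> e i \in part g false.
  move=> lt; rewrite -(par0 i lt); apply: parX.
  exact: leq_trans lt (leq_trans le_nx le_n0).
have e1 i : (nx <= i < n0)%N -> e i \in part g true.
  move=> lt; rewrite -(par1 i lt); apply: parX; case/andP: lt => _ lt.
  exact: leq_trans lt le_n0.
have L0P b w : b \in parab gr -> L0 w -> L0 (aM b w).
  move=> bP [n _ <-]; exists (inflate (mplus gr) (P := parab gr) act (vsproj _ b) n) => //.
  by rewrite -oneP vsprojK.
have L0nu j : L0 (nuM j) by exists (nu j).
have L0dec w : L0 w -> exists c : 'I_d -> K, w = \sum_j c j *: nuM j.
  move=> [n _ <-]; exists (fun j => co n 0 j); rewrite {1}[n]coE (lin_sum _ _ _ lone).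
  by apply: eq_bigr => j _; rewrite (linZ lone).
have L0gen (S : set M) : subspace S -> L0 `<=` S ->
    (forall x w, S w -> S (aM x w)) -> forall w, S w.
  move=> sS LS Sa; apply: (ind_gen (W := S)) => // n; apply: LS; by exists n.
have iota_lin := odd_iota_linear aM e (nx := nx) (n0 := n0) nuM.
have hfree := induced_free HA ch2 ch3 bX le_nx le_n0 parX BX BE Bbr par0 co_lin coE co_nu modN.
have Ftop := wspan_top HA ch2 modM e0 e1 dec0 dec1 L0P L0nu L0dec L0gen.
have Eadj := layer_adjacent HA ch2 modM e0 e1 dec0 dec1 L0P L0nu L0dec.
have Etop := odd_layer_top aM e1 L0nu (leqnn _).
have refine m : exists s, chain (simple_step aM e nx [set b | b \in parab0 gr] (odd_iota aM e nuM)) 0%VS s /\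
    last 0%VS s = layer aM e nx n0 nuM L0 m.
  elim: m => [|m [s [cs ls]]]; first by exists [::].
  have [s' [cs' ls']] := refine_adjacent (Eadj m).
  by exists (s ++ s'); rewrite last_cat ls ls'; split=> //; apply: chain_cat; rewrite // ls.
(* By the shift in [layer] this index gives the odd degree n0 - nx, which allows all odd letters and
   hence the whole coordinate space. *)
have [s [cs ls]] := refine (n0 - nx).+1.
have := filtration_of_chain HA HZ Hh HD modM e0 dec0 iota_lin hfree cs.
rewrite ls => /(_ Etop Ftop) [k [F [lams [LS [actS [ds [F0 FS Fp Fi sumE]]]]]]].
(* There is one coordinate for each pair of a set of odd letters and a basis vector of L, which
   gives 2 ^ c * d. *)
exists k, F, lams, LS, actS, ds; split=> //; rewrite sumE dimvf /dim /= mul1n card_prod card_ord.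
by rewrite -cardsT -powersetT card_powerset cardsT card_ord cE.
Qed.

Theorem theorem5p2 (R : realType) (g : superalg R[i])
    (gr : int -> {vspace g}) (h0 : {vspace g}) (Dp Dm : set (weight h0))
    (Hg : graded_reductive gr) (Hh : semisimple_cartan gr h0)
    (HD : positive_system gr Dp Dm)
    (lam : weight h0)
    (L : lmodType R[i]) (act : sub (levi gr) -> L -> L)
    (HL : is_LT Dp lam act)
    (d : nat) (Hd : has_dim L d) :
  let c := (\dim (part g true) - \dim (parab gr :&: part g true))%N in
  exists (k : nat) (M : nat -> set (MT act)) (lams : 'I_k -> weight h0)
      (LS : 'I_k -> lmodType R[i])
      (actS : forall i, sub (levi0 gr) -> LS i -> LS i) (ds : 'I_k -> nat),
    [/\ M 0%N = [set 0] /\ M k = setT,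
        forall i, (i <= k)%N ->
          submodule (fun x : sub (part g false) => MT_act (vsval x)) (M i),
        forall i, (i < k)%N -> M i `<` M i.+1,
        forall i : 'I_k,
          [/\ dominant gr Dp (lams i), is_LS Dp (lams i) (actS i),
              has_dim (LS i) (ds i)
            & subquotient_iso
                (fun x : sub (part g false) => MT_act (vsval x))
                (MS_act (act := actS i)) (M i.+1) (M i)]
      & (\sum_(i < k) ds i = 2 ^ c * d)%N].
Proof. exact (kac_filtration Hg Hh HD HL Hd). Qed.
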